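(* Let $\mathcal U$ be an upper cluster algebra with coefficient semifield $\mathbb P$ and initial seed $t_0$. Then the following statements hold. (i) If $L$ is a cluster monomial of $\mathcal U$ which does not contain the initial cluster variable $A_{k;t_0}$ for some $k$, then $L/A_{k;t_0}\notin\mathcal U$, that is, $(A_{k;t_0}\mid\mid L)_v=0$. (ii) If $L$ is a cluster monomial in non-initial cluster variables, then $L/A_{k;t_0}\notin\mathcal U$, that is, $(A_{k;t_0}\mid\mid L)_v=0$, for $k=1,\ldots,n$. (iii) Let $M=\prod_{i=1}^nA_{i;t}^{b_i}$ be a cluster monomial in a seed $t$ of $\mathcal U$ and let $I=\{i\mid A_{i;t}\in A_{t_0}\}$. Then $M=\prod_{i\in I}A_{i;t}^{b_i}\cdot\prod_{j\notin I}A_{j;t}^{b_j}$ is a local factorization of $M$ with respect to $t_0$.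
   Context: Throughout, $\mathbb K$ is a factorial domain (UFD) of characteristic $0$. A semifield $(\mathbb P,\oplus,\cdot)$ is an abelian multiplicative group with a commutative, associative operation $\oplus$ over which multiplication distributes; $\mathbb{KP}$ is its group ring over $\mathbb K$, and $\mathcal F$ is the field of rational functions in $n$ independent variables with coefficients in $\mathbb{KP}$. An integer $n\times n$ matrix $B$ is skew-symmetrizable if $SB$ is skew-symmetric for some integer diagonal matrix $S$ with positive diagonal entries. A (labeled) $\mathscr A$-seed over $\mathbb P$ is a triple $(B,X,A)$ with $B=(b_{ij})$ an $n\times n$ skew-symmetrizable integer matrix, $X=(X_1,\ldots,X_n)\in\mathbb P^n$, and $A=(A_1,\ldots,A_n)$ a free generating set of $\mathcal F$ over $\mathbb{KP}$. Its $k$-th exchange binomial is $P_k=\frac{X_k}{1\oplus X_k}\prod_{b_{jk}>0}A_j^{b_{jk}}+\frac{1}{1\oplus X_k}\prod_{b_{jk}<0}A_j^{-b_{jk}}$. The mutation $\mu_k(B,X,A)=(B',X',A')$ is: $b'_{ij}=-b_{ij}$ if $i=k$ or $j=k$, else $b'_{ij}=b_{ij}+\mathrm{sgn}(b_{ik})\max(b_{ik}b_{kj},0)$; $X'_k=X_k^{-1}$ and $X'_i=X_iX_k^{\max(b_{ki},0)}(1\oplus X_k)^{-b_{ki}}$ for $i\ne k$; $A'_i=A_i$ for $i\neq k$ and $A'_k=A_k^{-1}P_k$. Let $\mathbb T_n$ be the $n$-regular tree with edges labeled $1,\ldots,n$ so that edges at each vertex have distinct labels. An $\mathscr A$-seed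 pattern assigns to each vertex $t$ a seed $(B_t,X_t,A_t)$, $B_t=(b^t_{ij})$, $X_t=(X_{1;t},\ldots,X_{n;t})$, $A_t=(A_{1;t},\ldots,A_{n;t})$, such that seeds at vertices joined by an edge labeled $k$ are related by $\mu_k$. A vertex and its seed are denoted by the same letter; one vertex $t_0$ is chosen as initial, and the variables in $A_{t_0}$ are the initial cluster variables. The upper cluster algebra is $\mathcal U=\bigcap_{t}\mathcal L(t)$ with $\mathcal L(t)=\mathbb{KP}[A_{1;t}^{\pm1},\ldots,A_{n;t}^{\pm1}]$. The $A_{k;t}$ are the cluster variables (they lie in $\mathcal U$), $A_t$ is the cluster at $t$ (also viewed as a set). A cluster monomial in $t$ is a monomial with non-negative exponents in the variables of $A_t$; a cluster monomial of $\mathcal U$ is a cluster monomial in some seed; it contains the variables occurring with positive exponent. Standing assumption: no exchange binomial of $\mathcal U$ is invertible in $\mathbb{KP}$. Valuation pairing: for a cluster variable $A_{k;t}$ and $M\in\mathcal U$, $(A_{k;t}\mid\mid M)_v:=\max\{s\in\mathbb N\mid M/A_{k;t}^s\in\mathcal U\}\in\mathbb N\cup\{\infty\}$. A local factorization of $M\in\mathcal U$ with respect to a seed $t$ is a factorization $M=N\cdot L$ in $\mathcal U$ with $N$ a cluster monomial in $t$ and $(A_{k;t}\mid\mid L)_v=0$ for $k=1,\ldots,n$. *)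

(* Defs.v *)
From HB Require Import structures.
From mathcomp Require Import all_boot all_order all_algebra finmap.
From mathcomp Require boolp.
From mathcomp.multinomials Require monalg.

Set Implicit Arguments.
Unset Strict Implicit.
Unset Printing Implicit Defensive.

Import Order.TTheory GRing.Theory Num.Theory.
Local Open Scope ring_scope.

Definition ring_irreducible (K : idomainType) (p : K) : Prop :=
  [/\ p != 0, p \isn't a GRing.unit
    & forall a b, p = a * b -> a \is a GRing.unit \/ b \is a GRing.unit].

Definition associates (K : idomainType) (a b : K) : Prop :=
  exists2 u : K, u \is a GRing.unit & b = u * a.

Definition factorial_domain (K : idomainType) : Prop :=
  (forall a : K, a != 0 -> exists (u : K) (s : seq K),
     [/\ u \is a GRing.unit, forall p, p \in s -> ring_irreducible p
       & a = u * \prod_(p <- s) p])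
  /\
  (forall s1 s2 : seq K,
     (forall p, p \in s1 -> ring_irreducible p) ->
     (forall p, p \in s2 -> ring_irreducible p) ->
     associates (\prod_(p <- s1) p) (\prod_(p <- s2) p) ->
     exists s3 : seq K,
       [/\ perm_eq s2 s3, size s1 = size s3
         & forall i, (i < size s1)%N -> associates s1`_i s3`_i]).

HB.mixin Record isSemifield P of Group P := {
  semifield_mulC : forall x y : P, (x * y = y * x)%g;
  oplus : P -> P -> P;
  oplusA : associative oplus;
  oplusC : commutative oplus;
  mul_oplusl : forall x y z : P, (oplus x y * z = oplus (x * z) (y * z))%g
}.

#[short(type="semifieldType")]
HB.structure Definition Semifield := {P of isSemifield P & Group P}.

Definition expgz (G : groupType) (x : G) (z : int) : G :=
  match z with
  | Posz m => (x ^+ m)%g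
  | Negz m => (x ^- m.+1)%g
  end.

(* [monalg] only multiplies formal sums over monoids without nontrivial units,
   hence the alias carrying its own convolution product. *)
Definition groupring (K : comNzRingType) (P : semifieldType) : Type :=
  @monalg.malg P K.

Section GroupRing.
Import monalg.
Variables (K : comNzRingType) (P : semifieldType).

HB.instance Definition _ := GRing.Zmodule.copy (groupring K P) (@malg P K).

Implicit Types g : groupring K P.

Definition grone : groupring K P := << 1 *g 1%g >>.

Definition grmul g1 g2 : groupring K P :=
  \sum_(p1 <- msupp g1) \sum_(p2 <- msupp g2)
    << g1@_p1 * g2@_p2 *g (p1 * p2)%g >>.

Lemma grmulw (d1 d2 : {fset P}) g1 g2 :
  (msupp g1 `<=` d1)%fset -> (msupp g2 `<=` d2)%fset ->
  grmul g1 g2 = \sum_(p1 <- d1) \sum_(p2 <- d2)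
    << g1@_p1 * g2@_p2 *g (p1 * p2)%g >>.
Proof.
move=> le_d1 le_d2; rewrite /grmul (big_fset_incl _ le_d1) /=.
  apply/eq_bigr=> k1 _; apply/big_fset_incl => // k _ /mcoeff_outdom ->.
  by rewrite mulr0 monalgU0.
move=> k _ /mcoeff_outdom g1k.
by rewrite big1 => // k' _; rewrite g1k mul0r monalgU0.
Qed.

Lemma grmulC : commutative grmul.
Proof.
move=> g1 g2; rewrite /grmul exchange_big; apply: eq_bigr => p2 _.
by apply: eq_bigr => p1 _; rewrite mulrC semifield_mulC.
Qed.

Lemma grmulUU c1 c2 p1 p2 :
  grmul << c1 *g p1 >> << c2 *g p2 >> = << c1 * c2 *g (p1 * p2)%g >>.
Proof. by rewrite (grmulw msuppU_le msuppU_le) !big_seq_fset1 !mcoeffUU. Qed.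

Lemma grmulDl : left_distributive grmul +%R.
Proof.
move=> g1 g2 g; rewrite (grmulw (msuppD_le _ _) (fsubset_refl _)).
rewrite (grmulw (fsubsetUl _ (msupp g2)) (fsubset_refl (msupp g))).
rewrite (grmulw (fsubsetUr (msupp g1) _) (fsubset_refl (msupp g))).
rewrite -big_split /=; apply/eq_bigr=> k1 _.
rewrite -big_split /=; apply/eq_bigr=> k2 _.
by rewrite mcoeffD mulrDl monalgUD.
Qed.

Lemma grmul0g : left_zero 0 grmul.
Proof. by move=> g; rewrite /grmul msupp0 big_seq_fset0. Qed.

Lemma grmulDr : right_distributive grmul +%R.
Proof. by move=> g g1 g2; rewrite ![grmul g _]grmulC grmulDl. Qed.

Lemma grmulg0 : right_zero 0 grmul.
Proof. by move=> g; rewrite grmulC grmul0g. Qed.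

Lemma groupring_ind (Q : groupring K P -> Prop) :
  Q 0 -> (forall g1 g2, Q g1 -> Q g2 -> Q (g1 + g2)) ->
  (forall c p, Q << c *g p >>) -> forall g, Q g.
Proof. by move=> Q0 QD QU g; rewrite (monalgE g); apply: big_ind. Qed.

Lemma grmulA : associative grmul.
Proof.
move=> g1 g2 g3; elim/groupring_ind: g1 => [|g g' e e'|c1 p1].
- by rewrite !grmul0g.
- by rewrite !grmulDl e e'.
elim/groupring_ind: g2 => [|g g' e e'|c2 p2].
- by rewrite grmulg0 !grmul0g grmulg0.
- by rewrite grmulDl !grmulDr grmulDl e e'.
elim/groupring_ind: g3 => [|g g' e e'|c3 p3].
- by rewrite !grmulg0.
- by rewrite !grmulDr e e'.
by rewrite !grmulUU mulrA mulgA.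
Qed.

Lemma grmul1g : left_id grone grmul.
Proof.
elim/groupring_ind => [|g g' e e'|c p].
- by rewrite grmulg0.
- by rewrite grmulDr e e'.
by rewrite grmulUU mul1r mul1g.
Qed.

Lemma grone_neq0 : grone != 0.
Proof. by rewrite monalgU_eq0 oner_eq0. Qed.

HB.instance Definition _ := GRing.Zmodule_isComNzRing.Build (groupring K P)
  grmulA grmulC grmul1g grmulDl grone_neq0.

Definition groupring_of (p : P) : groupring K P := << 1 *g p >>.

End GroupRing.

Arguments groupring_of K {P} p.

From mathcomp.multinomials Require Import mpoly.

(* [x] is a free generating set of [F] over the group ring, i.e. [F] is the
   field of rational functions in the [x i].  The first clause also forces
   [iota] to be injective. *)
Definition free_generating_set (K : comNzRingType) (P : semifieldType)
    (F : fieldType) (iota : {rmorphism groupring K P -> F}) (n : nat)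
    (x : 'I_n -> F) : Prop :=
  (forall p : {mpoly (groupring K P)[n]}, mmap iota x p = 0 -> p = 0)
  /\
  (forall f : F, exists p q : {mpoly (groupring K P)[n]},
     mmap iota x q != 0 /\ f = mmap iota x p / mmap iota x q).

Definition rational_function_field (K : comNzRingType) (P : semifieldType)
    (F : fieldType) (iota : {rmorphism groupring K P -> F}) (n : nat) : Prop :=
  exists x : 'I_n -> F, free_generating_set iota x.

(* The vertices of the [n]-regular tree are the words over ['I_n] without two
   equal consecutive letters; an edge labeled [k] adds or removes a leading
   [k]. *)
Definition tree_vertex (n : nat) : Type :=
  {w : seq 'I_n | sorted [rel i j | i != j] w}.

Definition tree_edge (n : nat) (k : 'I_n) (t t' : tree_vertex n) : Prop :=
  val t' = k :: val t \/ val t = k :: val t'.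

Lemma tree_edge_regular (n : nat) (k : 'I_n) (t : tree_vertex n) :
  exists! t' : tree_vertex n, tree_edge k t t'.
Proof.
have [[w wP]|kNw] :
    {w | val t = k :: w & sorted [rel i j | i != j] w} + {ohead (val t) != Some k}.
  case: t => -[|i w] /= wP; first by right.
  have [->|ik] := eqVneq i k; last by right; apply: contraNneq ik => -[->].
  by left; exists w => //; apply: path_sorted wP.
- move=> wS; exists (exist _ w wS); split=> [|t' [] e]; first by right.
    by move: (valP t'); rewrite e wP /= eqxx.
  by apply: val_inj => /=; move: e; rewrite wP => -[].
- have kS : sorted [rel i j | i != j] (k :: val t).
    case: t kNw => -[|i w] //= wP ik; rewrite wP andbT.
    by apply: contraNneq ik => ->.
  exists (exist _ (k :: val t) kS); split=> [|t' [] e]; first by left.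
    by apply: val_inj.
  by rewrite e eqxx in kNw.
Qed.

Record seed (n : nat) (P F : Type) := Seed {
  exchange_matrix : 'M[int]_n;
  coefficients : {ffun 'I_n -> P};
  cluster : {ffun 'I_n -> F}
}.

Definition skew_symmetrizable (n : nat) (B : 'M[int]_n) : Prop :=
  exists d : 'rV[int]_n,
    (forall i, 0 < d 0 i) /\ (diag_mx d *m B)^T = - (diag_mx d *m B).

Section ClusterAlgebra.
Variables (K : idomainType) (P : semifieldType) (F : fieldType) (n : nat).
Variable iota : {rmorphism groupring K P -> F}.

Definition scalar_of (p : P) : F := iota (groupring_of K p).

Definition is_seed (s : seed n P F) : Prop :=
  skew_symmetrizable (exchange_matrix s)
  /\ free_generating_set iota (cluster s).

Definition exchange_binomial (s : seed n P F) (k : 'I_n) : F :=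
  let B := exchange_matrix s in
  let X := coefficients s in
  let A := cluster s in
  scalar_of (X k / oplus 1 (X k))%g * \prod_(j < n | 0 < B j k) A j ^ B j k
  + scalar_of (oplus 1 (X k))^-1%g * \prod_(j < n | B j k < 0) A j ^ (- B j k).

Definition mutation (k : 'I_n) (s : seed n P F) : seed n P F :=
  let B := exchange_matrix s in
  let X := coefficients s in
  let A := cluster s in
  Seed
    (\matrix_(i, j)
       if (i == k) || (j == k) then - B i j
       else B i j + Num.sg (B i k) * Num.max (B i k * B k j) 0)
    [ffun i =>
       if i == k then (X k)^-1%g
       else (X i * expgz (X k) (Num.max (B k i) 0)
             * expgz (oplus 1 (X k)) (- B k i))%g]
    [ffun i =>
       if i == k then (A k)^-1 * exchange_binomial s k else A i].

Definition is_seed_pattern (S : tree_vertex n -> seed n P F) : Prop :=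
  (forall t, is_seed (S t))
  /\ (forall k t t', tree_edge k t t' -> S t' = mutation k (S t)).

Definition laurent_ring (s : seed n P F) (f : F) : Prop :=
  exists (p : {mpoly (groupring K P)[n]}) (m : 'I_n -> nat),
    f = mmap iota (cluster s) p / \prod_(i < n) cluster s i ^+ m i.

Definition upper_cluster_algebra (S : tree_vertex n -> seed n P F) (f : F) :
    Prop :=
  forall t, laurent_ring (S t) f.

Definition invertible_in_groupring (f : F) : Prop :=
  exists u v : groupring K P, u * v = 1 /\ f = iota u.

Definition cluster_monomial (s : seed n P F) (b : 'I_n -> nat) : F :=
  \prod_(i < n) cluster s i ^+ b i.

Definition is_largest_power (U : F -> Prop) (a M : F) (s : nat) : Prop :=
  U (M / a ^+ s) /\ forall r : nat, U (M / a ^+ r) -> (r <= s)%N.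

(* [None] stands for infinity; for [M] in [U] it means that the set of [s]
   with [M / a ^+ s] in [U], which contains [0], is unbounded. *)
Definition valuation_pairing (U : F -> Prop) (a M : F) : option nat :=
  match boolp.pselect (exists s, is_largest_power U a M s) with
  | left ex_max => Some (proj1_sig (boolp.cid ex_max))
  | right _ => None
  end.

Definition local_factorization (U : F -> Prop) (s : seed n P F) (M N L : F) :
    Prop :=
  [/\ U N, U L, M = N * L,
      exists b : 'I_n -> nat, N = cluster_monomial s b
    & forall k, valuation_pairing U (cluster s k) L = Some 0%N].

End ClusterAlgebra.

(* Main.v *)
(** If a cluster monomial [L] of a seed [t] equals [A * M] with [A] an initial
cluster variable and [M] in the upper cluster algebra, then [A] is invertible in
the Laurent ring of [t], hence is a unit of the group ring times a Laurent
monomial in the cluster of [t].  A negative exponent would make some exchange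
binomial invertible after one mutation, so the exponents are nonnegative.  Some
variable [A'] of [t] therefore occurs in [A], and exchanging the roles of the
two seeds gives [A' = v * A] with [v] a unit of the group ring.

The Laurent phenomenon holds with coefficients in [Z P], so [v] is a unit of
[Z P], and since a semifield is torsion free, [v] is an element of [P] up to
sign.  Cluster variables are subtraction-free expressions in the initial ones;
evaluating them in the semifield [P] with every initial variable set to [1]
gives [1] for every cluster variable, so [v = 1].  Thus [A] is a variable of
[t] occurring in [L].

The Laurent phenomenon is proved by induction on the distance, as in
Fomin-Williams-Zelevinsky: an element that is Laurent both at the neighbour of
the base seed in direction [j] and at the seed reached through [j, k, j] is
Laurent at the base seed, provided that the exchanged variables are coprime.
This is automatic if [b_jk <> 0].  If [b_jk = 0], the coefficients are first
made generic by adjoining a tropical variable [y] to [P], and [y = 1] is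
substituted at the end. *)

Require Import Defs.
From HB Require Import structures.
From mathcomp Require Import all_boot all_order all_algebra fraction finmap.
From mathcomp Require Import ring zify.
From mathcomp.multinomials Require monalg.

Set Implicit Arguments.
Unset Strict Implicit.
Unset Printing Implicit Defensive.

Import Order.TTheory GRing.Theory Num.Theory.
Local Open Scope ring_scope.

(** * Laurent elements of a field *)

(** Why integer coefficients matter: a unit of the Laurent ring over [K P] may carry any unit of
    [K]. The Laurent phenomenon over the subring generated by [P], read at both seeds, makes [v] and
    its inverse integral. Finitely many elements of a torsion-free abelian group can be ordered, and
    the extreme terms of a product in the group ring cannot cancel; so such a unit is an element of
    [P] up to sign. Characteristic 0 embeds the integers in [K] and lets a sum of elements of [P]
    determine its summands, which gives sense to evaluation in the semifield.

    Coprimality takes the place of unique factorization. For [b_jk <> 0] the middle exchanged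
    variable is a unit modulo the first one. For [b_jk = 0] the variables [P_j / A_j] and
    [P_k / A_k] may have a common factor; once [X_k] is multiplied by [y], the binomial [P_k] is
    affine in [y] with a monomial as leading coefficient, while [P_j] is free of [y].

    Laurent rings are predicates on a field, indexed by their constants and a set of variables, so
    that each argument can single out one variable and work with ordinary polynomials over a
    field. *)

Record subring_pred (R : nzRingType) (L : R -> Prop) : Prop := SubringPred {
  subring1 : L 1;
  subringN : forall a, L a -> L (- a);
  subringD : forall a b, L a -> L b -> L (a + b);
  subringM : forall a b, L a -> L b -> L (a * b)
}.

Section SubringPred.
Variables (R : nzRingType) (L : R -> Prop) (Lsub : subring_pred L).

Lemma subring0 : L 0.
Proof.
have L1 := subring1 Lsub.
by rewrite -(subrr 1); apply: (subringD Lsub) => //; apply: subringN.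
Qed.

Lemma subringB a b : L a -> L b -> L (a - b).
Proof. by move=> La Lb; apply: subringD => //; apply: subringN. Qed.

Lemma subringX a m : L a -> L (a ^+ m).
Proof.
move=> La; elim: m => [|m IH]; first by rewrite expr0; apply: subring1.
by rewrite exprS; apply: subringM.
Qed.

Lemma subring_sum (I : Type) (r : seq I) (Q : pred I) (f : I -> R) :
  (forall i, Q i -> L (f i)) -> L (\sum_(i <- r | Q i) f i).
Proof. by move=> Lf; apply: big_ind => //; [apply: subring0|apply: subringD]. Qed.

Lemma subring_prod (I : Type) (r : seq I) (Q : pred I) (f : I -> R) :
  (forall i, Q i -> L (f i)) -> L (\prod_(i <- r | Q i) f i).
Proof. by move=> Lf; apply: big_ind => //; [apply: subring1|apply: subringM]. Qed.

Lemma subringMn a m : L a -> L (a *+ m).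
Proof.
move=> La; elim: m => [|m IH]; first by rewrite mulr0n; apply: subring0.
by rewrite mulrS; apply: subringD.
Qed.

Definition poly_over (q : {poly R}) : Prop := forall i, L q`_i.

Lemma poly_overC c : L c -> poly_over c%:P.
Proof. by move=> Lc i; rewrite coefC; case: eqP => // _; apply: subring0. Qed.

Lemma poly_overXn m : poly_over 'X^m.
Proof.
by move=> i; rewrite coefXn; case: eqP => _; [apply: subring1|apply: subring0].
Qed.

Lemma poly_over_subring : subring_pred poly_over.
Proof.
split=> [i|a La i|a b La Lb i|a b La Lb i].
- by rewrite coef1; case: eqP => _; [apply: subring1|apply: subring0].
- by rewrite coefN; apply: subringN.
- by rewrite coefD; apply: subringD.
by rewrite coefM; apply: subring_sum => k _; apply: subringM.
Qed.

End SubringPred.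

Section LaurentSubring.
Variables (F : fieldType).
Implicit Types (L R : F -> Prop).

(* Multiplication by [c1 'X + c0] with [c1] a unit reflects having coefficients
   in [L]: solve for the coefficients from the top down. *)
Lemma poly_over_linear_factor L c0 c1 (q : {poly F}) :
  subring_pred L -> L c0 -> L c1^-1 -> c1 != 0 ->
  poly_over L ((c1%:P * 'X + c0%:P) * q) -> poly_over L q.
Proof.
move=> Ls Lc0 Lc1 c1N0 Lp i.
have [m] := ubnP (size q - i)%N; elim: m i => // m IH i lem.
have [/leq_sizeP|ltiq] := leqP (size q) i.
  by move=> ->//; apply: subring0.
have := Lp i.+1; rewrite mulrDl coefD -mulrA !coefCM coefXM /= => Lqi.
have -> : q`_i = c1^-1 * ((c1 * q`_i + c0 * q`_i.+1) - c0 * q`_i.+1).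
  by rewrite addrK mulKf.
apply: subringM => //; apply: subringB => //; apply: subringM => //.
by apply: IH; move: lem ltiq; lia.
Qed.

Lemma poly_over_mulXn L m (q : {poly F}) :
  poly_over L ('X^m * q) -> poly_over L q.
Proof. by move=> Lq i; have := Lq (m + i)%N; rewrite coefXnM ltnNge leq_addr /= addKn. Qed.

Definition transcendental L (a : F) : Prop :=
  forall q : {poly F}, poly_over L q -> q.[a] = 0 -> q = 0.

Lemma transcendental_neq0 L a : subring_pred L -> transcendental L a -> a != 0.
Proof.
move=> Ls tr; apply/eqP => a0; have := tr 'X (poly_overXn Ls 1).
by rewrite hornerX => /(_ a0)/eqP; rewrite polyX_eq0.
Qed.

Lemma transcendental_inj L a (p q : {poly F}) : subring_pred L ->
  transcendental L a -> poly_over L p -> poly_over L q -> p.[a] = q.[a] -> p = q.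
Proof.
move=> Ls tr Lp Lq e; apply/eqP; rewrite -subr_eq0; apply/eqP/tr.
  exact: (subringB (poly_over_subring Ls)).
by rewrite hornerD hornerN e subrr.
Qed.

Variable I : finType.
Implicit Types (D : {set I}) (x y : I -> F).

(** The generated subring, with a free choice of constants: taking the image of [P] for [R] yields
    integer coefficients, taking the image of the group ring yields all of them. Shrinking [D]
    removes variables. *)
Inductive laurent R D x : F -> Prop :=
| laurent_const c of R c : laurent R D x c
| laurent1 : laurent R D x 1
| laurent_var i of i \in D : laurent R D x (x i)
| laurent_varV i of i \in D : laurent R D x (x i)^-1
| laurentN a of laurent R D x a : laurent R D x (- a)
| laurentD a b of laurent R D x a & laurent R D x b : laurent R D x (a + b)
| laurentM a b of laurent R D x a & laurent R D x b : laurent R D x (a * b).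

Lemma laurent_subring R D x : subring_pred (laurent R D x).
Proof. by split; [exact: laurent1|exact: laurentN|exact: laurentD|exact: laurentM]. Qed.
Hint Resolve laurent_subring : core.

Lemma laurent_trans R D x L :
  subring_pred L -> (forall c, R c -> L c) ->
  (forall i, i \in D -> L (x i) /\ L (x i)^-1) ->
  forall f, laurent R D x f -> L f.
Proof.
move=> Ls Rs xs f; elim=> {f} [c /Rs//| |i /xs[]//|i /xs[]//|a _ La|a b _ La _ Lb
  |a b _ La _ Lb].
- exact: subring1.
- exact: subringN.
- exact: subringD.
- exact: subringM.
Qed.

Lemma laurent_mono R D D' x y f : D \subset D' -> {in D, x =1 y} ->
  laurent R D x f -> laurent R D' y f.
Proof.
move=> sub e; apply: laurent_trans => // [c Rc|i iD]; first exact: laurent_const.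
by rewrite e //; split; [apply: laurent_var|apply: laurent_varV]; apply: (subsetP sub).
Qed.

Lemma laurent_exprz R D x i (z : int) : i \in D -> laurent R D x (x i ^ z).
Proof.
move=> iD; case: z => m; last rewrite NegzE -exprnN -exprVn.
  by apply: subringX => //; apply: laurent_var.
by apply: subringX => //; apply: laurent_varV.
Qed.

(** Singles out one variable: the coefficients of [q] are free of [x j], so degrees and divisibility
    in [{poly F}] become available. *)
Lemma laurent_polyE R D x j f : j \in D -> x j != 0 -> laurent R D x f ->
  exists (q : {poly F}) (m : nat),
    poly_over (laurent R (D :\ j) x) q /\ f = q.[x j] / x j ^+ m.
Proof.
move=> jD xj0; set L := laurent R (D :\ j) x.
have Ls : subring_pred L by apply: laurent_subring.
have Ps := poly_over_subring Ls.
elim=> {f} [c Rc| |i iD|i iD|a _ [q [m [Lq ->]]]|a b _ [q [m [Lq ->]]] _ [r [k [Lr ->]]]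
  |a b _ [q [m [Lq ->]]] _ [r [k [Lr ->]]]].
- exists c%:P, 0%N; rewrite hornerC divr1; split=> //; apply: poly_overC => //.
  exact: laurent_const.
- by exists 1, 0%N; rewrite hornerC divr1; split=> //; apply: (subring1 Ps).
- have [->|ij] := eqVneq i j.
    by exists 'X, 0%N; rewrite hornerX divr1; split=> //; apply: (poly_overXn Ls 1).
  exists (x i)%:P, 0%N; rewrite hornerC divr1; split=> //; apply: poly_overC => //.
  by apply: laurent_var; rewrite !inE ij.
- have [->|ij] := eqVneq i j.
    by exists 1, 1%N; rewrite hornerC expr1 div1r; split=> //; apply: (subring1 Ps).
  exists (x i)^-1%:P, 0%N; rewrite hornerC divr1; split=> //; apply: poly_overC => //.
  by apply: laurent_varV; rewrite !inE ij.
- by exists (- q), m; rewrite hornerN mulNr; split=> //; apply: (subringN Ps).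
- exists (q * 'X^k + r * 'X^m), (m + k)%N; split.
    by apply: (subringD Ps); apply: (subringM Ps) => //; apply: poly_overXn.
  by rewrite hornerD !hornerM !hornerXn exprD; field; rewrite !expf_neq0.
exists (q * r), (m + k)%N; split; first exact: (subringM Ps).
by rewrite hornerM exprD; field; rewrite !expf_neq0.
Qed.

(* For [R] a subring this is algebraic independence over [R], phrased so that
   only polynomials in one variable occur. *)
Definition independent R x : Prop :=
  forall j, transcendental (laurent R (setT :\ j) x) (x j).

Lemma independent_neq0 R x j : independent R x -> x j != 0.
Proof. by move/(_ j)/transcendental_neq0; apply. Qed.

(** Denominators of sums and products multiply, so a multiplicative family [M] that clears the
    inverses of the variables clears everything. *)
Lemma laurent_poly_denom R D x (L M : F -> Prop) :
  subring_pred L -> M 1 -> (forall a b, M a -> M b -> M (a * b)) ->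
  (forall a, M a -> L a) -> (forall c, R c -> L c) ->
  (forall i, i \in D -> L (x i) /\ exists2 m, M m & L (m / x i)) ->
  forall f, laurent R D x f -> exists2 m, M m & L (m * f).
Proof.
move=> Ls M1 MM ML RL xL f.
elim=> {f} [c Rc| |i iD|i /xL[_ [m]]|a _ [m Mm Lm]|a b _ [m Mm Lm] _ [m' Mm' Lm']
  |a b _ [m Mm Lm] _ [m' Mm' Lm']].
- by exists 1 => //; rewrite mul1r; apply: RL.
- by exists 1 => //; rewrite mul1r; apply: subring1.
- by exists 1 => //; rewrite mul1r; have [] := xL i iD.
- by exists m.
- by exists m => //; rewrite mulrN; apply: subringN.
- exists (m * m'); first exact: MM.
  rewrite mulrDr mulrAC [m * a * _]mulrC -[m * m' * b]mulrA.
  by apply: subringD => //; apply: subringM => //; apply: ML.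
exists (m * m'); first exact: MM.
by rewrite mulrACA; apply: subringM.
Qed.

(* [u] and [v] are coprime in [L], in the only sense needed: [u] divides [h]
   as soon as it divides [h * v]. *)
Definition cancels L (u v : F) : Prop :=
  forall h, L h -> L (h * v / u) -> L (h / u).

(** The powers of [u] are removed one at a time: [u] divides [u ^+ a.+1 * z] times
    [v ^+ b * w ^+ c], and the last two factors can be cancelled. *)
Lemma coprime_denominators L u v w z a b c : subring_pred L ->
  u != 0 -> L u -> L v -> L w -> cancels L u v -> cancels L u w ->
  L (u ^+ a * z) -> L (v ^+ b * w ^+ c * z) -> L z.
Proof.
move=> Ls u0 Lu Lv Lw cv cw; elim: a => [|a IH]; first by rewrite mul1r.
move=> Lua Lz; apply: IH => //.
have cX t e h : cancels L u t -> L t -> L h -> L (h * t ^+ e / u) -> L (h / u).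
  move=> ct Lt; elim: e h => [|e IHe] h Lh; first by rewrite mulr1.
  rewrite exprS mulrA => Le; apply: ct => //; apply: IHe => //; exact: subringM.
have -> : u ^+ a * z = u ^+ a.+1 * z / u by rewrite exprS; field.
apply: (cX v b) => //; apply: (cX w c) => //.
  by apply: subringM => //; apply: subringX.
have -> : u ^+ a.+1 * z * v ^+ b * w ^+ c / u = u ^+ a * (v ^+ b * w ^+ c * z).
  by rewrite exprS; field.
by apply: subringM => //; apply: subringX.
Qed.

End LaurentSubring.
#[global] Hint Extern 0 (subring_pred _) => exact: laurent_subring : core.

Section Independence.
Variables (F : fieldType) (I : finType) (R : F -> Prop).
Implicit Types (D : {set I}) (x y : I -> F).

(** One power of [x j] serves as denominator for all coefficients, which makes [q] a polynomial in
    two variables. *)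
Lemma poly_laurent_polyE D x j (q : {poly F}) : j \in D -> x j != 0 ->
  poly_over (laurent R D x) q ->
  exists (r : nat -> {poly F}) (m : nat), forall i,
    poly_over (laurent R (D :\ j) x) (r i) /\ q`_i = (r i).[x j] / x j ^+ m.
Proof.
move=> jD xj0; set L := laurent R _ x.
have Ps : subring_pred (poly_over (laurent R (D :\ j) x)) by apply: poly_over_subring.
elim/poly_ind: q => [|q c IH] Lq.
  exists (fun=> 0), 0%N => i; rewrite horner0 coef0 mul0r; split=> //; exact: (subring0 Ps).
have [i|r [m rP]] := IH.
  by have := Lq i.+1; rewrite coefD coefMX coefC addr0.
have Lc : L c by have := Lq 0%N; rewrite coefD coefMX coefC add0r.
have [s [k [Ls ->]]] := laurent_polyE jD xj0 Lc.
exists (fun i => if i is i'.+1 then r i' * 'X^k else s * 'X^m), (m + k)%N => -[|i].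
  rewrite coefD coefMX coefC add0r /=; split.
    by apply: (subringM Ps) => //; apply: poly_overXn.
  by rewrite hornerM hornerXn exprD; field; rewrite !expf_neq0.
rewrite coefD coefMX coefC addr0 /=; have [Lr ->] := rP i; split.
  by apply: (subringM Ps) => //; apply: poly_overXn.
by rewrite hornerM hornerXn exprD; field; rewrite !expf_neq0.
Qed.

(** For the new variable, clearing denominators turns a relation for [a / x j] into one for [x j].
    For an old variable [x i], a relation is a polynomial in [y j] and [x i], read first in [y j]
    and then in [x i]. *)
Lemma independent_exchange x y j a : independent R x ->
  (forall i, i != j -> y i = x i) -> y j = a / x j ->
  laurent R (setT :\ j) x a -> a != 0 -> independent R y.
Proof.
move=> xI yx yj La a0; have xj0 := independent_neq0 j xI.
have Lyx D : laurent R (D :\ j) y =1 laurent R (D :\ j) x.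
  by move=> f; apply/boolp.propext; split; apply: laurent_mono => // i;
    rewrite !inE => /andP[/yx->].
have yjT : transcendental (laurent R (setT :\ j) x) (y j).
  move=> q Lq q0; set m := size q.
  (* The reversed polynomial: [r.[x j]] is [q.[a / x j]] multiplied by [x j ^+ m.-1]. *)
  pose r := \poly_(i < m) (q`_(m.-1 - i) * a ^+ (m.-1 - i)).
  have Lr : poly_over (laurent R (setT :\ j) x) r.
    move=> i; rewrite coef_poly; case: ifP => _; last exact: subring0.
    by apply: laurentM; [apply: Lq|apply: subringX].
  have rx : r.[x j] = x j ^+ m.-1 * q.[y j].
    rewrite horner_poly horner_coef -/m (reindex_inj rev_ord_inj) mulr_sumr.
    apply: eq_bigr => i _ /=; have im := ltn_ord i.
    have -> : (m.-1 - (m - i.+1) = i)%N by lia.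
    have -> : x j ^+ m.-1 = x j ^+ (m - i.+1) * x j ^+ i by rewrite -exprD; congr (_ ^+ _); lia.
    by rewrite yj expr_div_n; field; rewrite expf_neq0.
  have r0 : r = 0 by apply: (xI j) => //; rewrite rx q0 mulr0.
  apply/polyP => i; rewrite coef0; have [|im] := leqP m i.
    by move/leq_sizeP; apply.
  have := congr1 (fun p : {poly F} => p`_(m.-1 - i)) r0.
  rewrite coef_poly coef0; have -> : (m.-1 - i < m)%N by lia.
  have -> : (m.-1 - (m.-1 - i) = i)%N by lia.
  by move/eqP; rewrite mulf_eq0 expf_eq0 (negPf a0) andbF orbF => /eqP.
move=> i; have [->|ij] := eqVneq i j.
  by move=> q Lq; apply: yjT => k; rewrite -Lyx; apply: Lq.
move=> q Lq q0.
have jD : j \in setT :\ i by rewrite !inE eq_sym ij.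
have yj0 : y j != 0 by rewrite yj mulf_neq0 ?invr_eq0.
have [r [m rP]] := poly_laurent_polyE jD yj0 Lq.
have Lr k l : laurent R (setT :\ i :\ j) x (r k)`_l by rewrite -Lyx; apply: (rP k).1.
(* The same relation as a polynomial in [y j], with the powers of [x i] absorbed in its
   coefficients. *)
pose s := \sum_(k < size q) (x i ^+ k) *: r k.
have s0 : s = 0.
  apply: yjT => [l|].
    rewrite coef_sum; apply: subring_sum => // k _; rewrite coefZ.
    apply: laurentM; first by apply: subringX => //; apply: laurent_var; rewrite !inE ij.
    by apply: laurent_mono (Lr k l) => //; apply: setSD; apply: subsetT.
  transitivity (y j ^+ m * q.[y i]); last by rewrite q0 mulr0.
  rewrite horner_sum horner_coef mulr_sumr.
  apply: eq_bigr => k _; rewrite hornerZ (rP k).2 (yx _ ij).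
  by field; rewrite expf_neq0.
have r0 k l : (k < size q)%N -> (r k)`_l = 0.
  move=> ks; pose t := \poly_(k < size q) (r k)`_l.
  have t0 : t = 0.
    apply: (xI i) => [k'|].
      rewrite coef_poly; case: ifP => _; last exact: subring0.
      by apply: laurent_mono (Lr k' l) => //; apply: subD1set.
    have := congr1 (fun p : {poly F} => p`_l) s0.
    rewrite coef_sum coef0 horner_poly => e; rewrite -[RHS]e.
    by apply: eq_bigr => k' _; rewrite coefZ mulrC.
  by have := congr1 (fun p : {poly F} => p`_k) t0; rewrite coef_poly ks coef0.
apply/polyP => k; rewrite coef0; have [/leq_sizeP->//|ks] := leqP (size q) k.
rewrite (rP k).2; have -> : r k = 0 by apply/polyP => l; rewrite coef0 r0.
by rewrite horner0 mul0r.
Qed.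

End Independence.

(** * Mutations *)

Section SemifieldTheory.
Variable P : semifieldType.
Implicit Types p q : P.

Lemma semifield_mulCA p q r : (p * (q * r) = q * (p * r))%g.
Proof. by rewrite !mulgA (semifield_mulC p). Qed.

Lemma semifield_mulAC p q r : (p * q * r = p * r * q)%g.
Proof. by rewrite -!mulgA (semifield_mulC q). Qed.

Lemma semifield_mulACA p q r t : (p * q * (r * t) = p * r * (q * t))%g.
Proof. by rewrite -!mulgA (semifield_mulCA q). Qed.

Lemma mul_oplusr p q r : (p * oplus q r = oplus (p * q) (p * r))%g.
Proof. by rewrite !(semifield_mulC p) mul_oplusl. Qed.

Lemma semifield_expgMn p q m : ((p * q) ^+ m = p ^+ m * q ^+ m)%g.
Proof. by rewrite expgMn //; apply: semifield_mulC. Qed.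

Lemma semifield_oplusV p : (p * oplus 1 p^-1 = oplus 1 p)%g.
Proof. by rewrite mul_oplusr mulg1 mulgV oplusC. Qed.

Lemma expgzN p (m : nat) : expgz p (- m%:Z) = (p ^- m)%g.
Proof. by case: m => [|m]; rewrite ?oppr0 /= ?expg0 ?invg1 //. Qed.

End SemifieldTheory.

Section Mutation.
Variables (P : semifieldType) (F : fieldType) (n : nat) (sg : P -> F).
Implicit Types (s : seed n P F) (i j k : 'I_n).

(** An arbitrary map [sg] replaces [scalar_of iota] here and in [mutate], because the same theory
    must apply once the semifield is extended by a tropical variable. For [sg := scalar_of iota]
    both agree with the original notions by conversion. *)
Definition binomial_of s k : F :=
  let B := exchange_matrix s in
  let X := coefficients s in
  let A := cluster s in
  sg (X k / oplus 1 (X k))%g * \prod_(j < n | 0 < B j k) A j ^ B j k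
  + sg (oplus 1 (X k))^-1%g * \prod_(j < n | B j k < 0) A j ^ (- B j k).

Definition mutate k s : seed n P F :=
  let B := exchange_matrix s in
  let X := coefficients s in
  let A := cluster s in
  Seed
    (\matrix_(i, j)
       if (i == k) || (j == k) then - B i j
       else B i j + Num.sg (B i k) * Num.max (B i k * B k j) 0)
    [ffun i =>
       if i == k then (X k)^-1%g
       else (X i * expgz (X k) (Num.max (B k i) 0)
             * expgz (oplus 1 (X k)) (- B k i))%g]
    [ffun i =>
       if i == k then (A k)^-1 * binomial_of s k else A i].

Lemma skew_symmetrizableE (B : 'M[int]_n) : skew_symmetrizable B ->
  exists2 d : 'I_n -> int, (forall i, 0 < d i)
    & forall i j, d i * B i j = - (d j * B j i).
Proof.
move=> [d [d0 dB]]; exists (d 0) => // i j.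
by have /matrixP/(_ j i) := dB; rewrite mul_diag_mx !mxE.
Qed.

Lemma skew_symmetrizableP (B : 'M[int]_n) (d : 'I_n -> int) :
  (forall i, 0 < d i) -> (forall i j, d i * B i j = - (d j * B j i)) ->
  skew_symmetrizable B.
Proof.
move=> d0 dB; exists (\row_i d i); split=> [i|]; first by rewrite mxE.
by apply/matrixP => i j; rewrite mul_diag_mx !mxE.
Qed.

Lemma skew_diag (B : 'M[int]_n) k : skew_symmetrizable B -> B k k = 0.
Proof.
move=> /skew_symmetrizableE[d d0 dB]; have := dB k k; have := d0 k; nia.
Qed.

Lemma skew_sign (B : 'M[int]_n) j k : skew_symmetrizable B ->
  [/\ (B j k == 0) = (B k j == 0), (0 < B j k) = (B k j < 0)
    & (B j k < 0) = (0 < B k j)].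
Proof.
move=> /skew_symmetrizableE[d d0 dB]; have := dB j k; have := d0 k; have := d0 j.
by move=> d1 d2 e; split; apply/idP/idP; nia.
Qed.

Lemma mutate_mxE s i j k :
  exchange_matrix (mutate k s) i j =
    if (i == k) || (j == k) then - exchange_matrix s i j
    else exchange_matrix s i j + Num.sg (exchange_matrix s i k)
      * Num.max (exchange_matrix s i k * exchange_matrix s k j) 0.
Proof. by rewrite mxE. Qed.

Lemma mutation_termE (a b : int) : Num.sg a * Num.max (a * b) 0 =
  if 0 <= b then Num.max a 0 * b else Num.max (- a) 0 * b.
Proof. by case: sgzP => *; case: ifP => *; nia. Qed.

(** Here [a], [a'], [c], [c'] are the entries [b_ik], [b_ki], [b_jk], [b_kj]: the diagonal that
    skew-symmetrizes the matrix does the same for the correction term. *)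
Lemma mutation_term_skew (di dj dk a a' c c' : int) :
  0 < di -> 0 < dj -> 0 < dk -> di * a = - (dk * a') -> dj * c = - (dk * c') ->
  di * (Num.sg a * Num.max (a * c') 0) = - (dj * (Num.sg c * Num.max (c * a') 0)).
Proof.
move=> i0 j0 k0 ea ec; rewrite !mutation_termE.
have e1 : di * (a * c') = - (dk * a' * c') by rewrite mulrA ea mulNr.
have e2 : dj * (c * a') = - (dk * a' * c') by rewrite mulrA ec; ring.
have [a'0|a'0] := lerP 0 a'; have [c'0|c'0] := lerP 0 c'.
- have [-> ->] : Num.max a 0 = 0 /\ Num.max c 0 = 0 by nia.
  by rewrite !mul0r !mulr0 oppr0.
- have [-> ->] : Num.max (- a) 0 = - a /\ Num.max c 0 = c by nia.
  by rewrite mulNr mulrN e1 e2.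
- have [-> ->] : Num.max a 0 = a /\ Num.max (- c) 0 = - c by nia.
  by rewrite mulNr mulrN e1 e2 opprK.
have [-> ->] : Num.max (- a) 0 = 0 /\ Num.max (- c) 0 = 0 by nia.
by rewrite !mul0r !mulr0 oppr0.
Qed.

Lemma mutate_skew s k : skew_symmetrizable (exchange_matrix s) ->
  skew_symmetrizable (exchange_matrix (mutate k s)).
Proof.
set B := exchange_matrix s; move=> /skew_symmetrizableE[d d0 dB].
apply: (skew_symmetrizableP d0) => i j; rewrite !mutate_mxE -/B orbC.
case: ifP => _; first by have := dB i j; lia.
by rewrite !mulrDr dB opprD; congr (_ + _); apply: (@mutation_term_skew _ _ (d k)).
Qed.

(** The last clause keeps an exchange binomial nonzero when its column of the matrix vanishes: it is
    then [sg p + 1] up to a unit, with [p] the coefficient. *)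
Record coefficient_map : Prop := CoefficientMap {
  sg1 : sg 1%g = 1;
  sgM : forall p q, sg (p * q)%g = sg p * sg q;
  sgN1 : forall p, sg p + 1 != 0
}.

Hypothesis sgP : coefficient_map.
Let sg1 := sg1 sgP.
Let sgM := sgM sgP.
Let sgN1 := sgN1 sgP.

Lemma sg_neq0 p : sg p != 0.
Proof.
apply/eqP => p0; have := sgM p p^-1%g.
by rewrite mulgV sg1 p0 mul0r => /eqP; rewrite oner_eq0.
Qed.
Hint Resolve sg_neq0 : core.

Lemma sgV p : sg p^-1%g = (sg p)^-1.
Proof.
by apply: (mulfI (sg_neq0 p)); rewrite -sgM mulgV sg1 divff.
Qed.

Lemma sgX p m : sg (p ^+ m)%g = sg p ^+ m.
Proof.
by elim: m => [|m IH]; rewrite ?expg0 // expgS sgM IH exprS.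
Qed.

Lemma sg_expgz p (z : int) : sg (expgz p z) = sg p ^ z.
Proof. by case: z => m /=; rewrite ?NegzE -?exprnN ?sgV sgX. Qed.

Definition coef_range (c : F) : Prop := exists p, c = sg p.

Definition coef_pos s k := sg (coefficients s k / oplus 1 (coefficients s k))%g.
Definition coef_neg s k := sg (oplus 1 (coefficients s k))^-1%g.

(** The two monomials of the [k]-th binomial with the variable [j] removed. They involve neither [j]
    nor [k], hence are units in the Laurent ring of the other variables. *)
Definition rest_pos s j k := coef_pos s k *
  \prod_(i | (i != j) && (i != k)) cluster s i ^ Num.max (exchange_matrix s i k) 0.
Definition rest_neg s j k := coef_neg s k *
  \prod_(i | (i != j) && (i != k)) cluster s i ^ Num.max (- exchange_matrix s i k) 0.

Lemma binomialE s k : binomial_of s k =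
  coef_pos s k * \prod_i cluster s i ^ Num.max (exchange_matrix s i k) 0
  + coef_neg s k * \prod_i cluster s i ^ Num.max (- exchange_matrix s i k) 0.
Proof.
rewrite /binomial_of; congr (_ * _ + _ * _); rewrite big_mkcond /=.
  by apply: eq_bigr => i _; case: ltrP => // _; rewrite expr0z.
by apply: eq_bigr => i _; rewrite -oppr_gt0; case: ltrP => // _; rewrite expr0z.
Qed.

Lemma binomial_split s j k : skew_symmetrizable (exchange_matrix s) -> j != k ->
  binomial_of s k =
    cluster s j ^ Num.max (exchange_matrix s j k) 0 * rest_pos s j k
    + cluster s j ^ Num.max (- exchange_matrix s j k) 0 * rest_neg s j k.
Proof.
move=> sk jk; have Bkk := skew_diag k sk.
have aux e : e k = 0 -> \prod_i cluster s i ^ e i =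
    cluster s j ^ e j * \prod_(i | (i != j) && (i != k)) cluster s i ^ e i.
  move=> ek; rewrite (bigD1 j) //= (bigD1 k) 1?eq_sym //= ek expr0z mul1r.
  by [].
rewrite binomialE !aux ?Bkk ?oppr0 ?maxxx // /rest_pos /rest_neg.
by congr (_ + _); rewrite mulrCA.
Qed.

Lemma prod_exprz_laurent s (D : {set 'I_n}) (Q : pred 'I_n) (e : 'I_n -> int) :
  (forall i, Q i -> i \in D) ->
  laurent coef_range D (cluster s) (\prod_(i | Q i) cluster s i ^ e i).
Proof.
by move=> QD; apply: subring_prod => // i /QD; apply: laurent_exprz.
Qed.

Lemma rest_pos_laurent s j k :
  laurent coef_range (setT :\ k :\ j) (cluster s) (rest_pos s j k).
Proof.
apply: laurentM; first by apply: laurent_const; eexists.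
by apply: prod_exprz_laurent => i /andP[ij ik]; rewrite !inE ij ik.
Qed.

Lemma rest_posV_laurent s j k :
  laurent coef_range (setT :\ k :\ j) (cluster s) (rest_pos s j k)^-1.
Proof.
rewrite invfM; apply: laurentM; first by apply: laurent_const; rewrite -sgV; eexists.
rewrite -prodfV; under eq_bigr do rewrite invr_expz.
by apply: prod_exprz_laurent => i /andP[ij ik]; rewrite !inE ij ik.
Qed.

Lemma rest_neg_laurent s j k :
  laurent coef_range (setT :\ k :\ j) (cluster s) (rest_neg s j k).
Proof.
apply: laurentM; first by apply: laurent_const; eexists.
by apply: prod_exprz_laurent => i /andP[ij ik]; rewrite !inE ij ik.
Qed.

Lemma rest_negV_laurent s j k :
  laurent coef_range (setT :\ k :\ j) (cluster s) (rest_neg s j k)^-1.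
Proof.
rewrite invfM; apply: laurentM; first by apply: laurent_const; rewrite -sgV; eexists.
rewrite -prodfV; under eq_bigr do rewrite invr_expz.
by apply: prod_exprz_laurent => i /andP[ij ik]; rewrite !inE ij ik.
Qed.

Lemma binomial_laurent s k : skew_symmetrizable (exchange_matrix s) ->
  laurent coef_range (setT :\ k) (cluster s) (binomial_of s k).
Proof.
move=> sk; rewrite binomialE (bigD1 k) //= (bigD1 (P := predT) k) //=.
rewrite (skew_diag k sk) oppr0 maxxx !expr0z !mul1r.
by apply: laurentD; apply: laurentM;
  [apply: laurent_const; eexists|apply: prod_exprz_laurent => i ik; rewrite !inE ik
  |apply: laurent_const; eexists|apply: prod_exprz_laurent => i ik; rewrite !inE ik].
Qed.

Section Independent.
Variable (s : seed n P F).
Hypothesis sk : skew_symmetrizable (exchange_matrix s).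
Hypothesis xI : independent coef_range (cluster s).

Lemma cluster_neq0 i : cluster s i != 0.
Proof. exact: independent_neq0 xI. Qed.
Hint Resolve cluster_neq0 : core.

Lemma prod_exprz_neq0 (Q : pred 'I_n) (e : 'I_n -> int) :
  \prod_(i | Q i) cluster s i ^ e i != 0.
Proof. by apply/prodf_neq0 => i _; rewrite expfz_neq0. Qed.

Lemma rest_pos_neq0 j k : rest_pos s j k != 0.
Proof. by rewrite mulf_neq0 ?prod_exprz_neq0 ?sg_neq0. Qed.

Lemma rest_neg_neq0 j k : rest_neg s j k != 0.
Proof. by rewrite mulf_neq0 ?prod_exprz_neq0 ?sg_neq0. Qed.

(** If some [b_jk] is nonzero, the two monomials have different degrees in [A_j] and cannot cancel;
    otherwise the last clause of [coefficient_map] applies. *)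
Lemma binomial_neq0 k : binomial_of s k != 0.
Proof.
have [/forallP B0|/forallPn[j Bjk]] := boolP [forall j, exchange_matrix s j k == 0].
  rewrite binomialE !big1 ?mulr1 => [|i _|i _]; last 2 first.
  - by rewrite (eqP (B0 i)) oppr0.
  - by rewrite (eqP (B0 i)).
  by rewrite /coef_pos sgM -/(coef_neg s k) -[X in _ + X]mul1r -mulrDl mulf_neq0 ?sg_neq0.
have jk : j != k by apply: contraNneq Bjk => ->; rewrite skew_diag.
apply/eqP; rewrite (binomial_split sk jk) => e0.
set b := exchange_matrix s j k in Bjk e0.
have DD : setT :\ k :\ j \subset setT :\ j by apply: setSD; apply: subsetT.
have Lp := laurent_mono DD (fun _ _ => erefl) (rest_pos_laurent s j k).
have Ln := laurent_mono DD (fun _ _ => erefl) (rest_neg_laurent s j k).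
pose q := (rest_pos s j k)%:P * 'X^`|Num.max b 0| +
  (rest_neg s j k)%:P * 'X^`|Num.max (- b) 0|.
have q0 : q = 0.
  apply: (xI (j:=j) (q:=q)) => [i|].
    rewrite coefD !coefCM; apply: laurentD; apply: laurentM => //;
      exact: poly_overXn.
  have -> : q.[cluster s j] = cluster s j ^+ `|Num.max b 0| * rest_pos s j k
      + cluster s j ^+ `|Num.max (- b) 0| * rest_neg s j k.
    by rewrite hornerD !hornerM !hornerC !hornerXn; congr (_ + _); rewrite mulrC.
  by rewrite -[RHS]e0 !exprnP !gez0_abs //; lia.
have := congr1 (fun p : {poly F} => p`_`|Num.max b 0|) q0.
rewrite coefD !coefCM !coefXn coef0 eqxx mulr1.
have -> : (`|Num.max b 0| == `|Num.max (- b) 0|)%N = false by lia.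
by rewrite mulr0 addr0 => /eqP; rewrite (negPf (rest_pos_neq0 j k)).
Qed.

Lemma mutate_cluster_neq i k : i != k -> cluster (mutate k s) i = cluster s i.
Proof. by rewrite ffunE => /negPf->. Qed.

Lemma mutate_cluster k : cluster (mutate k s) k = binomial_of s k / cluster s k.
Proof. by rewrite ffunE eqxx mulrC. Qed.

Lemma mutate_independent k : independent coef_range (cluster (mutate k s)).
Proof.
apply: (independent_exchange (j := k) (a := binomial_of s k) xI).
- by move=> i; apply: mutate_cluster_neq.
- exact: mutate_cluster.
- exact: binomial_laurent.
exact: binomial_neq0.
Qed.

End Independent.
End Mutation.

(** * Two mutation directions *)

Section RankTwo.
Variables (F : fieldType) (I : finType) (R : F -> Prop) (x : I -> F).
Hypothesis xI : independent R x.
Variable j : I.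
Local Notation L := (laurent R setT x).
Local Notation Lj := (laurent R (setT :\ j) x).

Let Lsub : subring_pred L.
Proof. by []. Qed.

Let Ljsub : subring_pred Lj.
Proof. by []. Qed.

Let xj0 : x j != 0.
Proof. exact: independent_neq0 xI. Qed.

Let LjL f : Lj f -> L f.
Proof. by apply: laurent_mono => //; apply: subsetT. Qed.

Let Lx i : L (x i).
Proof. by apply: laurent_var; rewrite inE. Qed.

Let LxV i : L (x i)^-1.
Proof. by apply: laurent_varV; rewrite inE. Qed.

(** A form of Gauss's lemma: [p] is free of [x j], and the affine factor has a unit as leading
    coefficient. Hence, if [p] divides the product of this factor with [q], it divides [q],
    coefficient by coefficient. *)
Lemma cancels_linear p c0 c1 : Lj p -> p != 0 -> Lj c0 -> Lj c1 -> Lj c1^-1 -> c1 != 0 ->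
  cancels L (p / x j) (c1 * x j + c0).
Proof.
move=> Lp p0 Lc0 Lc1 Lc1V c10 h Lh Lhc.
have jT : j \in [set: I] by rewrite inE.
have [q [m [Lq hE]]] := laurent_polyE jT xj0 Lh.
have [r [l [Lr hcE]]] := laurent_polyE jT xj0 Lhc.
have Ps : subring_pred (poly_over Lj) by apply: poly_over_subring.
have E : (c1%:P * 'X + c0%:P) * q * 'X^(l.+1) = p%:P * r * 'X^m.
  apply: (transcendental_inj Ljsub (xI (j := j))).
  - apply: (subringM Ps); last exact: poly_overXn.
    apply: (subringM Ps) => //; apply: (subringD Ps); last exact: poly_overC.
    by apply: (subringM Ps); [apply: poly_overC|apply: (poly_overXn Ljsub 1)].
  - apply: (subringM Ps); last exact: poly_overXn.
    by apply: (subringM Ps) => //; apply: poly_overC.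
  rewrite hornerM hornerXn [in LHS]hornerM hornerD hornerM !hornerC hornerX.
  rewrite !hornerM hornerC hornerXn.
  have -> : r.[x j] = h * (c1 * x j + c0) / (p / x j) * x j ^+ l.
    by rewrite hcE divfK // expf_neq0.
  have -> : q.[x j] = h * x j ^+ m by rewrite hE divfK // expf_neq0.
  by rewrite exprS; field; rewrite p0 xj0.
have Lq' : poly_over Lj (p^-1 *: q).
  apply: (poly_over_linear_factor (c0 := c0) (c1 := c1)) => //.
  apply: (@poly_over_mulXn _ _ l.+1).
  have -> : 'X^(l.+1) * ((c1%:P * 'X + c0%:P) * (p^-1 *: q)) = r * 'X^m.
    rewrite mulrC -!scalerAr -scalerAl E -!mulrA mul_polyC scalerA mulVf ?scale1r //.
  by apply: (subringM Ps) => //; apply: poly_overXn.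
have -> : h / (p / x j) = (p^-1 *: q).[x j] * x j * (x j)^-1 ^+ m.
  by rewrite hE hornerZ exprVn; field; rewrite p0 xj0 expf_neq0.
apply: laurentM; last by apply: subringX.
apply: laurentM => //; rewrite horner_coef; apply: subring_sum => // i _.
by apply: laurentM; [apply/LjL/Lq'|apply: subringX].
Qed.

(** Coprimality to [u] depends only on the residue modulo [u]; this reduces exchanged variables to
    units or to affine functions. *)
Lemma cancels_shift u v g : u != 0 -> L g -> cancels L u v -> cancels L u (v + u * g).
Proof.
move=> u0 Lg cv h Lh Lhv; apply: cv => //.
have -> : h * v / u = h * (v + u * g) / u - h * g by field.
by apply: subringB => //; apply: laurentM.
Qed.

Lemma cancels_unit u v : L v^-1 -> v != 0 -> cancels L u v.
Proof.
move=> Lv v0 h Lh Lhv; have -> : h / u = h * v / u * v^-1.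
  by rewrite mulrAC mulfK.
exact: laurentM.
Qed.

Variables (k : I) (jk : k != j).
Local Notation L0 := (laurent R (setT :\ j :\ k) x).
Let L0Lj f : L0 f -> Lj f.
Proof. by apply: laurent_mono => //; apply: subD1set. Qed.

Let xk0 : x k != 0.
Proof. exact: independent_neq0 xI. Qed.

Let Ljx : Lj (x k).
Proof. by apply: laurent_var; rewrite !inE jk. Qed.

Let LjxV : Lj (x k)^-1.
Proof. by apply: laurent_varV; rewrite !inE jk. Qed.

(* Three consecutive exchanges in the directions j, k, j.  Modulo [u] one has
   [v = e' / x k], so by [id] the element [w] is an affine function of [x j]. *)
Lemma rank_two_exchanges (u v w a a' e e' f f' : F) (beta gamma : nat) :
  u != 0 -> (0 < beta)%N ->
  L0 a -> L0 a^-1 -> a != 0 -> L0 a' ->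
  L0 e -> L0 e' -> L0 e'^-1 -> e' != 0 ->
  L0 f -> L0 f' -> L0 f'^-1 -> f' != 0 ->
  x j * u = a' + x k ^+ gamma * a ->
  x k * v = e' + u ^+ beta * e ->
  u * w = f' + v ^+ gamma * f ->
  f * e' ^+ gamma * a = f' * a' ->
  [/\ L u, L v, L w, cancels L u v & cancels L u w].
Proof.
move=> u0 beta0 La LaV a0 La' Le Le' LeV e0 Lf Lf' LfV f0 eu ev ew id.
have LL c : L0 c -> L c by move/L0Lj/LjL.
have Lgamma : Lj (a' + x k ^+ gamma * a).
  by apply: laurentD; [apply: L0Lj|apply: laurentM; [apply: subringX|apply: L0Lj]].
have uE : u = (a' + x k ^+ gamma * a) / x j by rewrite -eu mulrC mulKf.
have Lu : L u by rewrite uE; apply: laurentM => //; apply: LjL.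
pose tau := e' / x k; pose rho := u ^+ beta.-1 * e / x k.
have Ltau : Lj tau by apply: laurentM => //; apply: L0Lj.
have LtauV : Lj tau^-1 by rewrite invfM invrK; apply: laurentM => //; apply: L0Lj.
have tau0 : tau != 0 by rewrite mulf_neq0 ?invr_eq0.
have Lrho : L rho.
  by apply: laurentM => //; apply: laurentM; [apply: subringX|apply: LL].
have vE : v = tau + u * rho.
  apply: (mulfI xk0); rewrite ev /tau /rho -{1}(prednK beta0) exprS.
  by field.
have Lv : L v by rewrite vE; apply: laurentD; [apply: LjL|apply: laurentM].
pose nu := f' / (a * x k ^+ gamma).
have Lnu : Lj nu.
  by rewrite /nu invfM -exprVn; apply: laurentM; [|apply: laurentM; [|apply: subringX]];
    do ?exact: L0Lj.
have LnuV : Lj nu^-1.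
  by rewrite /nu invfM invrK; apply: laurentM; [|apply: laurentM; [|apply: subringX]];
    do ?exact: L0Lj.
have nu0 : nu != 0 by rewrite !(mulf_neq0, invr_eq0, expf_neq0).
have vX m : exists2 g, L g & v ^+ m = tau ^+ m + u * g.
  elim: m => [|m [g Lg IH]]; first by exists 0; [apply: subring0|rewrite mulr0 addr0].
  exists (rho * v ^+ m + tau * g).
    apply: laurentD; apply: laurentM => //; [by apply: subringX|by apply: LjL].
  by rewrite exprS {1}vE mulrDl {1}IH [tau ^+ m.+1]exprS; ring.
(* The cofactor of [v - tau] in [v ^+ gamma - tau ^+ gamma]. Modulo [u] it is
   [tau ^+ gamma.-1 *+ gamma], correctly 0 for [gamma = 0]. *)
pose G := \sum_(i < gamma) v ^+ (gamma.-1 - i) * tau ^+ i.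
have LG : L G.
  by apply: subring_sum => // i _; apply: laurentM; apply: subringX => //; apply: LjL.
have [g Lg GE] : exists2 g, L g & G = tau ^+ gamma.-1 *+ gamma + u * g.
  have /fin_all_exists[g gP] : forall i : 'I_gamma, exists g,
      L g /\ v ^+ (gamma.-1 - i) = tau ^+ (gamma.-1 - i) + u * g.
    by move=> i; have [g] := vX (gamma.-1 - i)%N; exists g.
  exists (\sum_(i < gamma) g i * tau ^+ i).
    apply: subring_sum => // i _; apply: laurentM; first exact: (gP i).1.
    by apply: subringX => //; apply: LjL.
  rewrite mulr_sumr -[X in _ *+ X]card_ord -sumr_const -big_split /=.
  apply: eq_bigr => i _; rewrite (gP i).2 mulrDl -exprD mulrA; congr (tau ^+ _ + _).
  by move: (ltn_ord i); clear; lia.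
(* By [id], [f' + tau ^+ gamma * f] equals [nu * (x j * u)], so [u] divides the right-hand side of
   [ew]. *)
have wE : w = nu * x j + f * rho * G.
  apply: (mulfI u0); rewrite ew.
  have -> : v ^+ gamma = tau ^+ gamma + u * rho * G.
    apply/eqP; rewrite addrC -subr_eq subrXX; apply/eqP; congr (_ * _).
    by rewrite vE; ring.
  have fE : f = f' * a' / (e' ^+ gamma * a).
    by rewrite -id; field; rewrite expf_neq0 ?a0.
  have -> : u * (nu * x j + f * rho * G) = nu * (x j * u) + f * rho * G * u by ring.
  rewrite eu /nu mulrDl {1}fE /tau expr_div_n; field.
  by rewrite !expf_neq0 // a0.
have Lw : L w.
  rewrite wE; apply: laurentD; first by apply: laurentM => //; apply: LjL.
  by apply: laurentM => //; apply: laurentM => //; apply: LL.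
have p0 : a' + x k ^+ gamma * a != 0 by rewrite -eu mulf_neq0.
split=> //.
  by rewrite vE; apply: cancels_shift => //; apply: cancels_unit => //; apply: LjL.
(* For [beta = 1] the element [rho] is free of [x j]; for larger [beta] it is a multiple of [u], and
   the constant term is 0. *)
have [c [g' [Lc Lg' wE']]] : exists c g', [/\ Lj c, L g' & w = nu * x j + c + u * g'].
  have [beta1|beta1] : beta = 1%N \/ (1 < beta)%N by move: beta0; clear; lia.
    exists (f * rho * (tau ^+ gamma.-1 *+ gamma)), (f * rho * g); split.
    - have LR : Lj rho by rewrite /rho beta1 mul1r; apply: laurentM => //; apply: L0Lj.
      apply: laurentM; first by apply: laurentM => //; apply: L0Lj.
      by apply: subringMn => //; apply: subringX.
    - by apply: laurentM => //; apply: laurentM => //; apply: LL.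
    by rewrite wE GE; ring.
  exists 0, (f * (u ^+ beta.-2 * e / x k) * G); split; first exact: subring0.
  - apply: laurentM => //; apply: laurentM; first exact: LL.
    by apply: laurentM => //; apply: laurentM; [apply: subringX|apply: LL].
  rewrite wE /rho; have -> : beta.-1 = beta.-2.+1 by move: beta1; clear; lia.
  by rewrite exprS; field.
rewrite wE'; apply: cancels_shift => //; rewrite uE.
exact: cancels_linear.
Qed.

End RankTwo.

(** The factors that another coefficient acquires in two successive mutations in one direction
    cancel, because [oplus 1 p] is [p] times [oplus 1 p^-1]. *)
Lemma mutation_expgzK (P : semifieldType) (p : P) (b : int) :
  (expgz p (Num.max b 0) * expgz (oplus 1 p) (- b)
    * expgz p^-1 (Num.max (- b) 0) * expgz (oplus 1 p^-1) b = 1)%g.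
Proof.
set q := oplus _ p; set r := oplus _ p^-1%g.
have qE m : (q ^+ m = p ^+ m * r ^+ m)%g.
  by rewrite -semifield_expgMn semifield_oplusV.
case: b => m.
  have -> : Num.max m%:Z 0 = m by apply/max_idPl; lia.
  have -> : Num.max (- m%:Z) 0 = 0 by apply/max_idPr; lia.
  rewrite expgzN qE; change (p ^+ m * (p ^+ m * r ^+ m)^-1 * 1 * r ^+ m = 1)%g.
  by rewrite mulg1 semifield_mulAC mulgV.
have -> : Num.max (Negz m) 0 = 0 by apply/max_idPr; lia.
have -> : Num.max (- Negz m) 0 = m.+1 by apply/max_idPl; lia.
change (1 * q ^+ m.+1 * p^-1 ^+ m.+1 * (r ^+ m.+1)^-1 = 1)%g.
by rewrite mul1g qE expVgn semifield_mulAC mulgK mulgV.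
Qed.

Section MutationRules.
Variables (P : semifieldType) (F : fieldType) (n : nat) (sg : P -> F).
Hypothesis sgP : coefficient_map sg.
Implicit Types (s : seed n P F) (i j k : 'I_n).
Local Notation mu := (mutate sg).
Local Notation B := exchange_matrix.
Local Notation X := coefficients.
Local Notation A := cluster.

Lemma mutate_coef k s : X (mu k s) k = (X s k)^-1%g.
Proof. by rewrite ffunE eqxx. Qed.

Lemma mutate_coef_neq k i s : i != k -> X (mu k s) i =
  (X s i * expgz (X s k) (Num.max (B s k i) 0) * expgz (oplus 1 (X s k)) (- B s k i))%g.
Proof. by rewrite ffunE => /negPf->. Qed.

Lemma mutate_coef_pos k s : coef_pos sg (mu k s) k = coef_neg sg s k.
Proof.
rewrite /coef_pos mutate_coef; congr sg.
by rewrite -invgM (semifield_mulC _ (X s k)) semifield_oplusV.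
Qed.

Lemma mutate_coef_neg k s : coef_neg sg (mu k s) k = coef_pos sg s k.
Proof.
rewrite /coef_pos /coef_neg mutate_coef; congr sg.
by rewrite -[in RHS](semifield_oplusV (X s k)) invgM semifield_mulCA mulgV mulg1.
Qed.

Lemma coef_posE s k : coef_pos sg s k = coef_neg sg s k * sg (X s k).
Proof. by rewrite /coef_pos /coef_neg (sgM sgP) mulrC. Qed.

Lemma mutate_diag_col k s i : B (mu k s) i k = - B s i k.
Proof. by rewrite mutate_mxE eqxx orbT. Qed.

Lemma mutate_diag_row k s i : B (mu k s) k i = - B s k i.
Proof. by rewrite mutate_mxE eqxx. Qed.

Lemma mutate_binomial k s : skew_symmetrizable (B s) ->
  binomial_of sg (mu k s) k = binomial_of sg s k.
Proof.
move=> sk; rewrite !binomialE mutate_coef_pos mutate_coef_neg addrC.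
congr (_ * _ + _ * _); apply: eq_bigr => i _; rewrite mutate_diag_col ?opprK;
  have [->|ik] := eqVneq i k; rewrite ?(skew_diag k sk) ?oppr0 ?maxxx ?expr0z //;
  by rewrite mutate_cluster_neq.
Qed.

Lemma mutateK k s : skew_symmetrizable (B s) -> A s k != 0 -> binomial_of sg s k != 0 ->
  mu k (mu k s) = s.
Proof.
move=> sk x0 p0; case E : (mu k (mu k s)) => [B' X' A'].
have -> : B' = B s.
  have -> : B' = B (mu k (mu k s)) by rewrite E.
  apply/matrixP => i j; rewrite mutate_mxE.
  have [->|ik] := eqVneq i k; first by rewrite mutate_diag_row opprK.
  have [->|jk] := eqVneq j k; first by rewrite mutate_diag_col opprK.
  rewrite mutate_diag_col mutate_diag_row mutate_mxE (negPf ik) (negPf jk) [LHS]/=.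
  by rewrite mulrNN sgrN mulNr addrK.
have -> : X' = X s.
  have -> : X' = X (mu k (mu k s)) by rewrite E.
  apply/ffunP => i; have [->|ik] := eqVneq i k; first by rewrite !mutate_coef invgK.
  rewrite (mutate_coef_neq (mu k s) ik) (mutate_coef_neq s ik) mutate_coef mutate_diag_row opprK.
  have := mutation_expgzK (X s k) (B s k i); rewrite -!mulgA => ->.
  by rewrite mulg1.
have -> : A' = A s.
  have -> : A' = A (mu k (mu k s)) by rewrite E.
  apply/ffunP => i; have [->|ik] := eqVneq i k; last by rewrite !mutate_cluster_neq.
  by rewrite !mutate_cluster mutate_binomial // invfM invrK mulVKf.
by case: (s).
Qed.
End MutationRules.

Lemma positive_part_neg (a : int) : a < 0 ->
  [/\ Num.max a 0 = 0, Num.max (- a) 0 = `|a|%N, - a = `|a|%N & (0 < `|a|)%N].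
Proof. by move=> a0; split; lia. Qed.

Lemma positive_part_pos (a : int) : 0 < a ->
  [/\ Num.max a 0 = `|a|%N, Num.max (- a) 0 = 0, a = `|a|%N & (0 < `|a|)%N].
Proof. by move=> a0; split; lia. Qed.

(** The exponents of a third variable [A_i] on the two sides of the compatibility identity demanded
    by [rank_two_exchanges]. Here [b] and [c] are [b_ij] and [b_kj] at the base seed, and [a] is
    [b_ik] after the first mutation. *)
Lemma exponent_balance_neg (b c a : int) : c < 0 ->
  Num.max (- (- b + Num.max a 0 * - c)) 0 + Num.max a 0 * `|c|%N + Num.max (- b) 0
  = Num.max (- b + Num.max a 0 * - c) 0 + Num.max b 0.
Proof. by move=> c0; nia. Qed.

Lemma exponent_balance_pos (b c a : int) : 0 < c ->
  Num.max (- b + Num.max (- a) 0 * - c) 0 + Num.max (- a) 0 * `|c|%N + Num.max b 0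
  = Num.max (- (- b + Num.max (- a) 0 * - c)) 0 + Num.max (- b) 0.
Proof. by move=> c0; nia. Qed.

Section TwoDirections.
Variables (P : semifieldType) (F : fieldType) (n : nat) (sg : P -> F).
Hypothesis sgP : coefficient_map sg.
Implicit Types (s : seed n P F) (i j k : 'I_n).
Local Notation mu := (mutate sg).
Local Notation B := exchange_matrix.
Local Notation X := coefficients.
Local Notation A := cluster.
Local Notation R := (coef_range sg).

Lemma sg_mutate_coef_neq k i s : i != k -> sg (X (mu k s) i) =
  sg (X s i) * (if 0 <= B s k i then coef_pos sg s k ^ B s k i
                else coef_neg sg s k ^ B s k i).
Proof.
move=> ik; rewrite mutate_coef_neq // !(sgM sgP) -mulrA; congr (_ * _).
rewrite !(sg_expgz sgP); case: ifP => b0.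
  have -> : Num.max (B s k i) 0 = B s k i by apply/max_idPl.
  by rewrite /coef_pos (sgM sgP) (sgV sgP) expfzMl exprz_inv.
have -> : Num.max (B s k i) 0 = 0 by apply/max_idPr; lia.
by rewrite expr0z mul1r /coef_neg (sgV sgP) exprz_inv.
Qed.

Lemma binomial_commute s j k : skew_symmetrizable (B s) -> j != k -> B s j k = 0 ->
  binomial_of sg (mu k s) j = binomial_of sg s j.
Proof.
move=> sk jk Bjk; have [/esym] := skew_sign j k sk; rewrite Bjk eqxx => /eqP Bkj _ _.
have Xj : X (mu k s) j = X s j.
  by rewrite mutate_coef_neq // Bkj oppr0 maxxx /= !mulg1.
rewrite !binomialE /coef_pos /coef_neg Xj.
congr (_ * _ + _ * _); apply: eq_bigr => i _;
  have [->|ik] := eqVneq i k; rewrite ?mutate_diag_row ?Bkj ?oppr0 ?maxxx ?expr0z //;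
  by rewrite mutate_cluster_neq // mutate_mxE (negPf ik) (negPf jk) Bkj mulr0 maxxx mulr0 addr0.
Qed.

(** For [b_jk = 0] the two exchanges commute, so along the path [j, k, j] the last one undoes the
    first. *)
Lemma commuting_exchanges s j k : skew_symmetrizable (B s) -> j != k -> B s j k = 0 ->
  A s j != 0 -> binomial_of sg s j != 0 ->
  A (mu j (mu k (mu j s))) j = A s j /\ A (mu k (mu j s)) k = A (mu k s) k.
Proof.
move=> sk jk Bjk x0 p0; have sk1 := mutate_skew sg j sk.
have [/esym] := skew_sign j k sk; rewrite Bjk eqxx => /eqP Bkj _ _.
rewrite !mutate_cluster; split.
  rewrite binomial_commute // ?mutate_diag_row ?Bjk ?oppr0 //.
  rewrite mutate_binomial // mutate_cluster_neq // mutate_cluster invfM invrK.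
  by rewrite mulVKf.
by rewrite binomial_commute 1?eq_sym // mutate_cluster_neq // eq_sym.
Qed.

Section NonCommuting.
Variables (s : seed n P F) (j k : 'I_n).
Hypotheses (sk : skew_symmetrizable (B s)) (xI : independent R (A s)) (jk : j != k).
Let s1 := mu j s.
Let s2 := mu k s1.
Let s3 := mu j s2.

Let sk1 : skew_symmetrizable (B s1).
Proof. exact: mutate_skew. Qed.

Let sk2 : skew_symmetrizable (B s2).
Proof. exact: mutate_skew. Qed.

Let kj : k != j.
Proof. by rewrite eq_sym. Qed.

Let B1jk : B s1 j k = - B s j k.
Proof. exact: mutate_diag_row. Qed.

Let B1kj : B s1 k j = - B s k j.
Proof. exact: mutate_diag_col. Qed.

Let B2kj : B s2 k j = B s k j.
Proof. by rewrite [LHS]mutate_diag_row B1kj opprK. Qed.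

Let B2ij i : i != k -> i != j -> B s2 i j = - B s i j +
  (if 0 <= B s1 k j then Num.max (B s1 i k) 0 * B s1 k j
   else Num.max (- B s1 i k) 0 * B s1 k j).
Proof.
move=> ik ij; rewrite -mutation_termE [LHS]mutate_mxE (negPf ik) eq_sym (negPf kj) /=.
by rewrite -[- B s i j](mutate_diag_col sg j s i).
Qed.

(** The coefficient part of the compatibility identity: the first mutation inverts [X_j], the second
    rescales it. *)
Let X2j : sg (X s2 j) * sg (X s j) =
  if 0 <= B s1 k j then coef_pos sg s1 k ^ B s1 k j else coef_neg sg s1 k ^ B s1 k j.
Proof.
rewrite /s2 sg_mutate_coef_neq // mutate_coef (sgV sgP) mulrC mulVKf //.
exact: sg_neq0.
Qed.

Let A2 i : i != k -> i != j -> A s2 i = A s i.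
Proof. by move=> ik ij; rewrite [LHS]mutate_cluster_neq // mutate_cluster_neq. Qed.

Let A1 i : i != j -> A s1 i = A s i.
Proof. exact: mutate_cluster_neq. Qed.

Let e1 : A s j * A s1 j = binomial_of sg s j.
Proof. by rewrite [A s1 j]mutate_cluster mulrC divfK // (independent_neq0 j xI). Qed.

Let e2 : A s k * A s2 k = binomial_of sg s1 k.
Proof.
by rewrite [A s2 k]mutate_cluster A1 // mulrC divfK // (independent_neq0 k xI).
Qed.

Let s1j0 : A s1 j != 0.
Proof.
apply: (independent_neq0 (R := R)); exact: (mutate_independent sgP).
Qed.

Let e3 : A s1 j * A s3 j = binomial_of sg s2 j.
Proof.
by rewrite [A s3 j]mutate_cluster [A s2 j]mutate_cluster_neq // mulrC divfK.
Qed.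

Let L0 := laurent R (setT :\ j :\ k) (A s).

Let L0_rest t i l : (forall i', i' != j -> i' != k -> A t i' = A s i') ->
  ((i, l) = (j, k)) \/ ((i, l) = (k, j)) ->
  [/\ L0 (rest_pos sg t i l), L0 (rest_pos sg t i l)^-1,
      L0 (rest_neg sg t i l), L0 (rest_neg sg t i l)^-1
    & rest_pos sg t i l != 0 /\ rest_neg sg t i l != 0].
Proof.
move=> tA il.
have S f : laurent R (setT :\ l :\ i) (A t) f -> L0 f.
  apply: laurent_mono => [|i'].
    by case: il => -[-> ->] //; rewrite setDDl setUC -setDDl.
  rewrite !inE andbT => /andP[h h']; apply: tA.
    by case: il h h' => -[-> ->].
  by case: il h h' => -[-> ->].
split; [exact/S/rest_pos_laurent|exact/S/rest_posV_laurent|exact/S/rest_neg_laurent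
  |exact/S/rest_negV_laurent|].
have nz e : \prod_(i' | (i' != i) && (i' != l)) A t i' ^ e i' != 0.
  apply/prodf_neq0 => i' /andP[h h']; rewrite expfz_neq0 // tA.
  - exact: (independent_neq0 i' xI).
  - by case: il h h' => -[-> ->].
  by case: il h h' => -[-> ->].
by rewrite !mulf_neq0 ?nz ?(sg_neq0 sgP).
Qed.

Lemma noncommuting_exchanges : B s j k != 0 ->
  let L := laurent R setT (A s) in
  [/\ L (A s1 j), L (A s2 k), L (A s3 j),
      cancels L (A s1 j) (A s2 k) & cancels L (A s1 j) (A s3 j)].
Proof.
move=> Bjk L.
have [a1 a2 a3 a4 [a5 a6]] := @L0_rest s k j (fun _ _ _ => erefl) (or_intror erefl).
have [b1 b2 b3 b4 [b5 b6]] : [/\ L0 (rest_pos sg s1 j k), L0 (rest_pos sg s1 j k)^-1,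
      L0 (rest_neg sg s1 j k), L0 (rest_neg sg s1 j k)^-1
    & rest_pos sg s1 j k != 0 /\ rest_neg sg s1 j k != 0].
  by apply: L0_rest; [move=> i ij _; apply: A1|left].
have [c1 c2 c3 c4 [c5 c6]] : [/\ L0 (rest_pos sg s2 k j), L0 (rest_pos sg s2 k j)^-1,
      L0 (rest_neg sg s2 k j), L0 (rest_neg sg s2 k j)^-1
    & rest_pos sg s2 k j != 0 /\ rest_neg sg s2 k j != 0].
  by apply: L0_rest; [move=> i ij ik; apply: A2|right].
have := e1; rewrite (binomial_split sg sk kj) => E1.
have := e2; rewrite (binomial_split sg sk1 jk) => E2.
have := e3; rewrite (binomial_split sg sk2 kj) B2kj => E3.
rewrite B1jk in E2.
have prodE (e f g : 'I_n -> int) (m : nat) :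
    (\prod_(i | (i != k) && (i != j)) A s2 i ^ e i) *
    (\prod_(i | (i != j) && (i != k)) A s1 i ^ f i) ^+ m *
    (\prod_(i | (i != k) && (i != j)) A s i ^ g i) =
    \prod_(i | (i != k) && (i != j)) A s i ^ (e i + f i * m%:Z + g i).
  rewrite (eq_bigl (fun i => (i != k) && (i != j)) (fun i => A s1 i ^ f i));
    last by move=> i; rewrite andbC.
  rewrite -prodrXl -!big_split; apply: eq_bigr => i /andP[ik ij].
  have x0 := independent_neq0 i xI.
  by rewrite A1 // A2 // !expfzDr // exprnP exprz_exp.
have prodE2 (e g : 'I_n -> int) :
    (\prod_(i | (i != k) && (i != j)) A s2 i ^ e i) *
    (\prod_(i | (i != k) && (i != j)) A s i ^ g i) =
    \prod_(i | (i != k) && (i != j)) A s i ^ (e i + g i).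
  rewrite -!big_split; apply: eq_bigr => i /andP[ik ij].
  by rewrite A2 // !expfzDr // (independent_neq0 i xI).
have regroup (x2 p2 x1 p1 x0 p0 : F) m :
    x2 * p2 * (x1 * p1) ^+ m * (x0 * p0) = (x2 * x1 ^+ m * x0) * (p2 * p1 ^+ m * p0).
  by rewrite exprMn; ring.
have regroup2 (x2 p2 x0 p0 : F) : x2 * p2 * (x0 * p0) = (x2 * x0) * (p2 * p0).
  by ring.
have [_ P1 P2] := skew_sign j k sk.
(* The sign decides which monomial contains the other variable, so the positive and negative parts
   trade places between the two cases. The names [neg] and [pos] refer to the sign of [b_kj],
   opposite to that of [b_jk]. *)
have [neg|pos|eq0] := ltrgt0P (B s j k); last by rewrite eq0 eqxx in Bjk.
- have Bkj : B s k j < 0 by rewrite -P1.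
  have [N1 N2 N3 N4] := positive_part_neg Bkj.
  have [Q1 Q2 Q3 Q4] := positive_part_pos neg.
  rewrite N1 N2 !expr0z !mul1r in E1 E3.
  rewrite opprK Q1 Q2 !expr0z !mul1r in E2.
  apply: (rank_two_exchanges xI kj s1j0 Q4 a3 a4 a6 a1 b3 b1 b2 b5 c3 c1 c2 c5 E1 E2 E3).
  have B1p : 0 <= - B s k j by rewrite oppr_ge0 ltW.
  have := X2j; rewrite B1kj B1p {1}N3.
  rewrite -exprnP => X2E; rewrite /rest_pos /rest_neg regroup -X2E prodE.
  rewrite regroup2 prodE2 !coef_posE //; congr (_ * _); first by ring.
  apply: eq_bigr => i /andP[ik ij]; congr (_ ^ _).
  by rewrite B2ij // B1kj B1p exponent_balance_neg.
have Bkj : 0 < B s k j by rewrite -P2.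
have [N1 N2 N3 N4] := positive_part_pos Bkj.
have [Q1 Q2 Q3 Q4] := positive_part_neg pos.
rewrite N1 N2 !expr0z !mul1r addrC in E1.
rewrite N1 N2 !expr0z !mul1r addrC in E3.
rewrite opprK Q1 Q2 !expr0z !mul1r addrC in E2.
apply: (rank_two_exchanges xI kj s1j0 Q4 a1 a2 a5 a3 b1 b3 b4 b6 c1 c3 c4 c6 E1 E2 E3).
have B1p : (0 <= - B s k j) = false by rewrite oppr_ge0 leNgt Bkj.
have := X2j; rewrite B1kj B1p {1}N3.
rewrite -exprnN => X2E; rewrite /rest_pos /rest_neg regroup prodE.
rewrite regroup2 prodE2 !coef_posE //; congr (_ * _).
  have c0 : coef_neg sg s1 k ^+ `|B s k j| != 0 by rewrite expf_neq0 ?(sg_neq0 sgP).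
  transitivity (coef_neg sg s2 j * coef_neg sg s j
    * (coef_neg sg s1 k ^+ `|B s k j| * (sg (X s2 j) * sg (X s j)))); first by ring.
  by rewrite X2E divff // mulr1.
apply: eq_bigr => i /andP[ik ij]; congr (_ ^ _).
by rewrite B2ij // B1kj B1p exponent_balance_pos.
Qed.

End NonCommuting.
End TwoDirections.

(** * Adjoining a tropical coefficient *)

Section ProductSemifield.
Variables P Q : semifieldType.

Definition oplus_pair (x y : P * Q) : P * Q := (oplus x.1 y.1, oplus x.2 y.2).

Lemma pair_mulC (x y : P * Q) : (x * y = y * x)%g.
Proof.
by case: x y => [x x'] [y y']; congr pair; [exact: (semifield_mulC x y)|exact: (semifield_mulC x' y')].
Qed.

Lemma oplus_pairA : associative oplus_pair.
Proof. by move=> x y z; congr pair; apply: oplusA. Qed.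

Lemma oplus_pairC : commutative oplus_pair.
Proof. by move=> x y; congr pair; apply: oplusC. Qed.

Lemma mul_oplus_pairl (x y z : P * Q) :
  (oplus_pair x y * z = oplus_pair (x * z) (y * z))%g.
Proof. by congr pair; apply: mul_oplusl. Qed.

HB.instance Definition _ := isSemifield.Build (P * Q)%type
  pair_mulC oplus_pairA oplus_pairC mul_oplus_pairl.

End ProductSemifield.

(** An alias of [int] that can carry a multiplicative group: with addition as product and minimum as
    auxiliary addition it is the tropical semifield on one generator. *)
Definition tropical : Type := int.
HB.instance Definition _ := Choice.on tropical.

Definition tropical_mul : tropical -> tropical -> tropical := fun a b => (a + b : int).
Definition tropical_inv : tropical -> tropical := fun a => (- a : int).
Definition tropical_one : tropical := (0 : int).
Definition tropical_oplus : tropical -> tropical -> tropical :=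
  fun a b => (Num.min (a : int) b : int).

HB.instance Definition _ := isGroup.Build tropical
  (@addrA int : associative tropical_mul)
  (@add0r int : left_id tropical_one tropical_mul)
  (@addr0 int : right_id tropical_one tropical_mul)
  (@addNr int : left_inverse tropical_one tropical_inv tropical_mul)
  (@addrN int : right_inverse tropical_one tropical_inv tropical_mul).

HB.instance Definition _ := isSemifield.Build tropical
  (@addrC int : forall x y : tropical, (x * y = y * x)%g)
  (@minA _ int : associative tropical_oplus)
  (@minC _ int : commutative tropical_oplus)
  (@addr_minl int : forall x y z : tropical,
    (tropical_oplus x y * z = tropical_oplus (x * z) (y * z))%g).


Section Extension.
Variables (P : semifieldType) (F F' : fieldType) (n : nat) (sg : P -> F).
Variable e : {rmorphism {poly F} -> F'}.
Hypothesis e_inj : injective e.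
Hypothesis sgP : coefficient_map sg.

Local Notation y := (e 'X).
Local Notation R := (coef_range sg).

(* The tropical integer [m] is read as the power [y ^ m] of a new variable. *)
Definition extended_coef (p : P * tropical) : F' := e (sg p.1)%:P * y ^ (p.2 : int).
Local Notation sg' := extended_coef.
Local Notation R' := (coef_range sg').

Lemma extend_neq0 (p : {poly F}) : (e p == 0) = (p == 0).
Proof. by rewrite -(inj_eq e_inj) rmorph0. Qed.

Lemma extend_y_neq0 : y != 0.
Proof. by rewrite extend_neq0 polyX_eq0. Qed.
Local Hint Resolve extend_y_neq0 : core.

Lemma extended_coef_map : coefficient_map sg'.
Proof.
split=> [|p q|[p z]]; rewrite /sg' /=.
- by rewrite (sg1 sgP) expr0z mulr1 rmorph1.
- by rewrite (sgM sgP) polyCM rmorphM expfzDr // mulrACA.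
have p0 := sg_neq0 sgP p.
case: z => [[|m]|m].
- by rewrite expr0z mulr1 -(rmorph1 e) -rmorphD extend_neq0 -polyCD polyC_eq0 (sgN1 sgP).
- rewrite -exprnP -rmorphXn -rmorphM -(rmorph1 e) -rmorphD extend_neq0.
  apply/eqP => /(congr1 (fun q : {poly F} => q`_0)).
  by rewrite coefD coefCM coefXn mulr0 add0r coef1 coef0 => /eqP; rewrite oner_eq0.
rewrite NegzE -exprnN -rmorphXn.
have -> : e (sg p)%:P / e 'X^(m.+1) + 1 = e ((sg p)%:P + 'X^(m.+1)) / e 'X^(m.+1).
  by rewrite rmorphD; field; rewrite extend_neq0 monic_neq0 ?monicXn.
rewrite mulf_neq0 ?invr_eq0 ?extend_neq0 ?expf_neq0 ?polyX_eq0 //.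
apply/eqP => /(congr1 (fun q : {poly F} => q`_0)).
by rewrite coefD coefC coefXn addr0 coef0 => /eqP; rewrite (negPf p0).
Qed.

Variable x : 'I_n -> F.
Definition extended_cluster i : F' := e (x i)%:P.
Local Notation x' := extended_cluster.

Lemma extend_frac_inj (p q : {poly F}) (a b : nat) :
  e p / y ^+ a = e q / y ^+ b -> p * 'X^b = q * 'X^a.
Proof.
move=> E; apply: e_inj; rewrite !rmorphM !rmorphXn.
apply: (canRL (mulfVK _)); first by rewrite expf_neq0.
by rewrite mulrAC E mulfVK ?expf_neq0.
Qed.

Lemma laurent_extendE (D : {set 'I_n}) f : (forall i, x i != 0) -> laurent R' D x' f ->
  exists (q : {poly F}) (m : nat), poly_over (laurent R D x) q /\ f = e q / y ^+ m.
Proof.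
move=> x0; have Ps : subring_pred (poly_over (laurent R D x)) by apply: poly_over_subring.
have ym m : y ^+ m != 0 by rewrite expf_neq0.
apply: (@laurent_trans _ _ R' D x' (fun f => exists (q : {poly F}) (m : nat),
  poly_over (laurent R D x) q /\ f = e q / y ^+ m)) => [|c [[p z] ->]|i iD]; first split.
- by exists 1, 0%N; rewrite rmorph1 divr1; split=> //; exact: (subring1 Ps).
- by move=> a [q [m [Lq ->]]]; exists (- q), m; rewrite rmorphN mulNr; split=> //; exact: (subringN Ps).
- move=> a b [q [m [Lq ->]]] [r [l [Lr ->]]]; exists (q * 'X^l + r * 'X^m), (m + l)%N; split.
    by apply: (subringD Ps); apply: (subringM Ps) => //; apply: poly_overXn.
  by rewrite rmorphD !rmorphM !rmorphXn exprD; field; rewrite !ym.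
- move=> a b [q [m [Lq ->]]] [r [l [Lr ->]]]; exists (q * r), (m + l)%N; split.
    exact: (subringM Ps).
  by rewrite rmorphM exprD; field; rewrite !ym.
- have Lp : laurent R D x (sg p) by apply: laurent_const; exists p.
  rewrite /sg' /=; case: z => m.
    exists ((sg p)%:P * 'X^m), 0%N; rewrite divr1 rmorphM rmorphXn; split=> //.
    by apply: (subringM Ps); [apply: poly_overC|apply: poly_overXn].
  exists (sg p)%:P, m.+1; rewrite NegzE -exprnN; split=> //; exact: poly_overC.
split.
  exists (x i)%:P, 0%N; rewrite divr1; split=> //; apply: poly_overC => //; exact: laurent_var.
exists (x i)^-1%:P, 0%N; rewrite divr1; split; last first.
  apply: (mulfI (_ : x' i != 0)); first by rewrite extend_neq0 polyC_eq0.
  by rewrite mulfV ?extend_neq0 ?polyC_eq0 // -rmorphM -polyCM mulfV // rmorph1.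
by apply: poly_overC => //; apply: laurent_varV.
Qed.

Lemma laurent_extendC (D : {set 'I_n}) c : laurent R D x c -> laurent R' D x' (e c%:P).
Proof.
have L's := laurent_subring R' D x'.
apply: (@laurent_trans _ _ R D x (fun c => laurent R' D x' (e c%:P))) => [|d [p ->]|i iD].
- split=> [|a La|a b La Lb|a b La Lb].
  + by rewrite rmorph1; apply: laurent1.
  + by rewrite polyCN rmorphN; apply: laurentN.
  + by rewrite polyCD rmorphD; apply: laurentD.
  by rewrite polyCM rmorphM; apply: laurentM.
- by apply: laurent_const; exists (p, 0 : tropical); rewrite /sg' expr0z mulr1.
split; first exact: laurent_var.
have [xi0|xi0] := eqVneq (x i) 0; first by rewrite xi0 invr0 rmorph0; apply: subring0.
have -> : e (x i)^-1%:P = (x' i)^-1.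
  apply: (mulfI (_ : x' i != 0)); first by rewrite extend_neq0 polyC_eq0.
  by rewrite mulfV ?extend_neq0 ?polyC_eq0 // -rmorphM -polyCM mulfV // rmorph1.
exact: laurent_varV.
Qed.

Lemma laurent_extend (D : {set 'I_n}) (q : {poly F}) (m : nat) :
  poly_over (laurent R D x) q -> laurent R' D x' (e q / y ^+ m).
Proof.
move=> Lq; have L's := laurent_subring R' D x'.
have Ly z : laurent R' D x' (y ^ z).
  apply: laurent_const; exists (1%g, z : tropical).
  by rewrite /sg' (sg1 sgP) rmorph1 mul1r.
apply: laurentM; last by rewrite exprnN; apply: Ly.
rewrite -[q]coefK poly_def rmorph_sum; apply: subring_sum => // i _.
rewrite -mul_polyC rmorphM rmorphXn; apply: laurentM; last exact: (Ly i).
exact: laurent_extendC.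
Qed.

Lemma poly_laurent_extendE (D : {set 'I_n}) (q : {poly F'}) : (forall i, x i != 0) ->
  poly_over (laurent R' D x') q ->
  exists (r : nat -> {poly F}) (m : nat), forall i,
    poly_over (laurent R D x) (r i) /\ q`_i = e (r i) / y ^+ m.
Proof.
move=> x0; have Ps : subring_pred (poly_over (laurent R D x)) by apply: poly_over_subring.
have ym m : y ^+ m != 0 by rewrite expf_neq0.
elim/poly_ind: q => [|q c IH] Lq.
  exists (fun=> 0), 0%N => i; rewrite rmorph0 coef0 mul0r; split=> //; exact: (subring0 Ps).
have [i|r [m rP]] := IH.
  by have := Lq i.+1; rewrite coefD coefMX coefC addr0.
have Lc : laurent R' D x' c by have := Lq 0%N; rewrite coefD coefMX coefC add0r.
have [s [k [Ls ->]]] := laurent_extendE x0 Lc.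
exists (fun i => if i is i'.+1 then r i' * 'X^k else s * 'X^m), (m + k)%N => -[|i].
  rewrite coefD coefMX coefC add0r /=; split.
    by apply: (subringM Ps) => //; apply: poly_overXn.
  by rewrite rmorphM rmorphXn exprD; field; rewrite !ym.
rewrite coefD coefMX coefC addr0 /=; have [Lr ->] := rP i; split.
  by apply: (subringM Ps) => //; apply: poly_overXn.
by rewrite rmorphM rmorphXn exprD; field; rewrite !ym.
Qed.

(** A relation is expanded in powers of [y], which is transcendental over [F]; each coefficient is
    then a relation for [x i] over the original constants. *)
Lemma extended_independent : independent R x -> independent R' x'.
Proof.
move=> xI i q Lq q0; have x0 j : x j != 0 by apply: independent_neq0 xI.
have [r [m rP]] := poly_laurent_extendE x0 Lq.
have ym : y ^+ m != 0 by rewrite expf_neq0.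
have s0 : \sum_(l < size q) (x i ^+ l) *: r l = 0.
  apply/eqP; rewrite -extend_neq0 rmorph_sum; apply/eqP.
  transitivity (y ^+ m * q.[x' i]); last by rewrite q0 mulr0.
  rewrite horner_coef mulr_sumr; apply: eq_bigr => l _.
  by rewrite (rP l).2 -mul_polyC rmorphM polyC_exp rmorphXn /x'; field.
have r0 l : (l < size q)%N -> r l = 0.
  move=> ls; apply/polyP => t; rewrite coef0.
  pose T := \poly_(l < size q) (r l)`_t.
  have T0 : T = 0.
    apply: (xI i) => [k|].
      by rewrite coef_poly; case: ifP => _; [apply: (rP k).1|apply: subring0].
    have := congr1 (fun p : {poly F} => p`_t) s0.
    rewrite coef_sum coef0 horner_poly => E; rewrite -[RHS]E.
    by apply: eq_bigr => k _; rewrite coefZ mulrC.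
  by have := congr1 (fun p : {poly F} => p`_l) T0; rewrite coef_poly ls coef0.
apply/polyP => l; rewrite coef0; have [/leq_sizeP->//|ls] := leqP (size q) l.
by rewrite (rP l).2 r0 // rmorph0 mul0r.
Qed.

(** The argument of [cancels_linear] with [y] in the role of [x j]: the first element is free of
    [y], the second affine in [y] with an invertible leading coefficient. *)
Lemma extended_cancels (p c0 c1 : F) j k : (forall i, x i != 0) ->
  p != 0 -> c1 != 0 -> laurent R setT x c0 -> laurent R setT x c1^-1 ->
  cancels (laurent R' setT x') (e p%:P / x' j) (e (c1%:P * 'X + c0%:P) / x' k).
Proof.
move=> x0 p0 c10 Lc0 Lc1 h Lh Lhv.
have Ls := laurent_subring R setT x.
have Ps : subring_pred (poly_over (laurent R setT x)) by apply: poly_over_subring.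
have x'0 i : x' i != 0 by rewrite extend_neq0 polyC_eq0.
have [q [m [Lq hE]]] := laurent_extendE x0 Lh.
have [r [l [Lr hvE]]] := laurent_extendE x0 Lhv.
have ep0 : e p%:P != 0 by rewrite extend_neq0 polyC_eq0.
have E : 'X^l * ((c1%:P * 'X + c0%:P) * (p^-1 *: q)) = (x k / x j) *: (r * 'X^m).
  have : e (x j *: ((c1%:P * 'X + c0%:P) * q)) / y ^+ m =
         e ((x k * p) *: r) / y ^+ l.
    rewrite -!mul_polyC !rmorphM.
    have -> : e r = h * (e (c1%:P * 'X + c0%:P) / x' k) / (e p%:P / x' j) * y ^+ l.
      by rewrite hvE mulfVK ?expf_neq0.
    rewrite hE /x'; field.
    by apply/and5P; split; [exact: expf_neq0|exact: (x'0 j)|exact: ep0|exact: (x'0 k)|exact: expf_neq0].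
  move/extend_frac_inj => E.
  have -> : 'X^l * ((c1%:P * 'X + c0%:P) * (p^-1 *: q)) =
     (x j * p)^-1 *: (x j *: ((c1%:P * 'X + c0%:P) * q) * 'X^l).
    rewrite -scalerAl scalerA invfM mulrAC mulVf // mul1r.
    by rewrite -!scalerAr mulrC.
  rewrite E -scalerAl scalerA; congr (_ *: _).
  by field; rewrite p0 x0.
have Lq' : poly_over (laurent R setT x) (p^-1 *: q).
  apply: (poly_over_linear_factor Ls Lc0 Lc1 c10).
  apply: (@poly_over_mulXn _ _ l); rewrite E -mul_polyC.
  apply: (subringM Ps); last by apply: (subringM Ps) => //; apply: poly_overXn.
  apply: poly_overC => //; apply: laurentM; first by apply: laurent_var; rewrite inE.
  by apply: laurent_varV; rewrite inE.
have -> : h / (e p%:P / x' j) = x' j * (e (p^-1 *: q) / y ^+ m).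
  rewrite hE -mul_polyC rmorphM.
  have -> : e p^-1%:P = (e p%:P)^-1.
    by apply: (mulfI ep0); rewrite mulfV // -rmorphM -polyCM mulfV // rmorph1.
  by field; rewrite expf_neq0 // ep0 x'0.
apply: laurentM; first by apply: laurent_var; rewrite inE.
exact: laurent_extend.
Qed.

End Extension.

Definition mutations (P : semifieldType) (F : fieldType) (n : nat) (sg : P -> F)
    (s : seed n P F) (w : seq 'I_n) : seed n P F :=
  foldl (fun s k => mutate sg k s) s w.

Section Mutations.
Variables (P : semifieldType) (F : fieldType) (n : nat) (sg : P -> F).
Hypothesis sgP : coefficient_map sg.
Variable s : seed n P F.
Hypothesis sk : skew_symmetrizable (exchange_matrix s).

Lemma mutations_skew w : skew_symmetrizable (exchange_matrix (mutations sg s w)).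
Proof.
by elim/last_ind: w => // w k IH; rewrite /mutations foldl_rcons; apply: mutate_skew.
Qed.

Lemma mutations_independent w : independent (coef_range sg) (cluster s) ->
  independent (coef_range sg) (cluster (mutations sg s w)).
Proof.
move=> xI; elim/last_ind: w => // w k IH; rewrite /mutations foldl_rcons.
by apply: mutate_independent => //; apply: mutations_skew.
Qed.

End Mutations.

(** * Specialization of the tropical variable at 1 *)

Section Specialization.
Variables (P : semifieldType) (F F' : fieldType) (n : nat) (sg : P -> F).
Variable e : {rmorphism {poly F} -> F'}.
Hypothesis e_inj : injective e.
Hypothesis sgP : coefficient_map sg.

Local Notation y := (e 'X).
Local Notation sg' := (extended_coef sg e).
Local Notation R := (coef_range sg).
Local Notation R' := (coef_range sg').
Local Notation B := exchange_matrix.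
Local Notation X := coefficients.
Local Notation A := cluster.

Let ym m : y ^+ m != 0.
Proof. by rewrite expf_neq0 // extend_y_neq0. Qed.

(* [f] is a Laurent polynomial in [y] whose value at [y = 1] is [v]. *)
Definition specializes (f : F') (v : F) : Prop :=
  exists (q : {poly F}) (m : nat), f = e q / y ^+ m /\ v = q.[1].

Lemma specializes_inj f v v' : specializes f v -> specializes f v' -> v = v'.
Proof.
move=> [q [m [-> ->]]] [r [l [/(extend_frac_inj e_inj) E ->]]].
have := congr1 (fun p : {poly F} => p.[1]) E.
by rewrite !hornerM !hornerXn !expr1n !mulr1.
Qed.

Lemma specializesC c : specializes (e c%:P) c.
Proof. by exists c%:P, 0%N; rewrite divr1 hornerC. Qed.

Lemma specializesD f g v w : specializes f v -> specializes g w ->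
  specializes (f + g) (v + w).
Proof.
move=> [q [m [-> ->]]] [r [l [-> ->]]]; exists (q * 'X^l + r * 'X^m), (m + l)%N.
rewrite hornerD !hornerM !hornerXn !expr1n !mulr1; split=> //.
by rewrite rmorphD !rmorphM !rmorphXn exprD; field; rewrite !ym.
Qed.

Lemma specializesM f g v w : specializes f v -> specializes g w ->
  specializes (f * g) (v * w).
Proof.
move=> [q [m [-> ->]]] [r [l [-> ->]]]; exists (q * r), (m + l)%N.
by rewrite hornerM; split=> //; rewrite rmorphM exprD; field; rewrite !ym.
Qed.

Lemma specializesX f v (z : int) : 0 <= z -> specializes f v -> specializes (f ^ z) (v ^ z).
Proof.
case: z => // m _ fv; rewrite -!exprnP; elim: m => [|m IH].
  by rewrite !expr0 -(rmorph1 e); apply: specializesC.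
by rewrite !exprS; apply: specializesM.
Qed.

Lemma specializes_prod (I : Type) (r : seq I) (f : I -> F') (v : I -> F) :
  (forall i, specializes (f i) (v i)) ->
  specializes (\prod_(i <- r) f i) (\prod_(i <- r) v i).
Proof.
move=> fv; apply: (big_ind2 specializes) => // [|f1 v1 f2 v2].
  by rewrite -(rmorph1 e); apply: specializesC.
exact: specializesM.
Qed.

Lemma specializes_coef p : specializes (sg' p) (sg p.1).
Proof.
rewrite /extended_coef -[X in specializes _ X]mulr1; apply: specializesM.
  exact: specializesC.
case: (p.2 : int) => m.
  by exists 'X^m, 0%N; rewrite divr1 rmorphXn hornerXn expr1n.
by exists 1, m.+1; rewrite NegzE -exprnN hornerC rmorph1 mul1r.
Qed.

Lemma specializes_neq0 f v : specializes f v -> v != 0 -> f != 0.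
Proof.
move=> fv; apply: contraNneq => f0; apply/eqP; apply: specializes_inj fv _.
by rewrite f0 -(rmorph0 e); apply: specializesC.
Qed.

Lemma specializes_laurent (x : 'I_n -> F) f : (forall i, x i != 0) ->
  laurent R' setT (extended_cluster e x) f ->
  exists2 v, laurent R setT x v & specializes f v.
Proof.
move=> x0 /(laurent_extendE e_inj x0)[q [m [Lq ->]]]; exists q.[1]; last by exists q, m.
by rewrite horner_coef; apply: subring_sum => // i _; rewrite expr1n mulr1.
Qed.

Definition lies_over (s' : seed n (P * tropical) F') (s : seed n P F) : Prop :=
  [/\ B s' = B s, forall i, (X s' i).1 = X s i & forall i, specializes (A s' i) (A s i)].

Lemma lies_over_binomial s' s k : lies_over s' s ->
  specializes (binomial_of sg' s' k) (binomial_of sg s k).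
Proof.
move=> [Bs Xs As]; rewrite !binomialE Bs.
have ge0 (a : int) : 0 <= Num.max a 0 by rewrite le_max lexx orbT.
apply: specializesD; apply: specializesM; try by
  apply: specializes_prod => i; apply: specializesX.
- by rewrite /coef_pos -Xs; apply: (specializes_coef (_ / _)%g).
- by rewrite /coef_neg -Xs; apply: (specializes_coef (_^-1)%g).
Qed.

Lemma fst_expgz (p : P * tropical) z : (expgz p z).1 = expgz p.1 z.
Proof.
have eX m : ((p ^+ m).1 = p.1 ^+ m)%g.
  by elim: m => [|m IH]; rewrite ?expg0 // !expgS /= IH.
by case: z => m /=; rewrite eX.
Qed.

(** Only Laurent polynomials in [y] have a value at [y = 1], so the existence of a value for the new
    variable is a hypothesis, supplied later by the Laurent phenomenon; the exchange relation then
    determines this value. *)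
Lemma lies_over_mutate s' s k : lies_over s' s -> A s k != 0 ->
  (exists v, specializes (A (mutate sg' k s') k) v) ->
  lies_over (mutate sg' k s') (mutate sg k s).
Proof.
move=> ss Ak [v vP]; have Pk := lies_over_binomial k ss; case: (ss) => [Bs Xs As].
split=> [|i|i]; first by apply/matrixP => i j; rewrite !mutate_mxE Bs.
  have [->|ik] := eqVneq i k; first by rewrite !mutate_coef -Xs.
  by rewrite !mutate_coef_neq // -!Xs Bs /= !fst_expgz.
have [->|ik] := eqVneq i k; last by rewrite !mutate_cluster_neq.
rewrite [in X in specializes _ X]mutate_cluster.
suff <- : v = binomial_of sg s k / A s k by [].
apply: (canRL (mulfK Ak)); apply: specializes_inj (specializesM vP (As k)) _.
by rewrite mutate_cluster mulfVK // (specializes_neq0 (As k)).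
Qed.

Lemma mutations_lies_over s' s w : skew_symmetrizable (B s) -> independent R (A s) ->
  lies_over s' s ->
  (forall u v i, w = u ++ v -> exists v, specializes (A (mutations sg' s' u) i) v) ->
  lies_over (mutations sg' s' w) (mutations sg s w).
Proof.
move=> sk xI ss; elim/last_ind: w => // w k IH sp.
rewrite /mutations !foldl_rcons; apply: lies_over_mutate.
- by apply: IH => u v i wE; apply: (sp u (rcons v k) i); rewrite wE rcons_cat.
- exact: (independent_neq0 k (mutations_independent sgP sk xI)).
by have := sp (rcons w k) [::] k (esym (cats0 _)); rewrite /mutations foldl_rcons.
Qed.

(* Only the coefficient in direction [k] involves [y], which makes the exchange
   binomial in direction [k] affine in [y] with invertible leading coefficient. *)
Definition extended_seed (s : seed n P F) (k : 'I_n) : seed n (P * tropical) F' :=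
  Seed (B s) [ffun i => (X s i, if i == k then 1 : int else 0)] [ffun i => e (A s i)%:P].

Lemma extended_seed_cluster s k : A (extended_seed s k) = extended_cluster e (A s) :> (_ -> _).
Proof. by apply/boolp.funext => i; rewrite ffunE. Qed.

Lemma extended_seed_lies_over s k : lies_over (extended_seed s k) s.
Proof.
split=> // i; rewrite ffunE //; exact: specializesC.
Qed.

(** The tropical part of [oplus 1 X_k] is the minimum of 0 and 1, hence trivial: [y] enters only the
    positive coefficient in direction [k]. *)
Lemma extended_coef_pos s k i : coef_pos sg' (extended_seed s k) i =
  e (coef_pos sg s i)%:P * (if i == k then y else 1).
Proof.
rewrite /coef_pos [X in sg' (X / _)%g]ffunE [X in sg' (_ / oplus 1 X)%g]ffunE.
by rewrite /extended_coef; case: (i == k); congr (_ * _).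
Qed.

Lemma extended_coef_neg s k i :
  coef_neg sg' (extended_seed s k) i = e (coef_neg sg s i)%:P.
Proof.
rewrite /coef_neg [X in sg' (oplus 1 X)^-1%g]ffunE /extended_coef -[RHS]mulr1.
by case: (i == k); congr (_ * _).
Qed.

Lemma extended_monomial s k (m : 'I_n -> int) :
  \prod_i A (extended_seed s k) i ^ Num.max (m i) 0 =
  e (\prod_i A s i ^ Num.max (m i) 0)%:P.
Proof.
rewrite rmorph_prod rmorph_prod; apply: eq_bigr => i _; rewrite ffunE.
have : 0 <= Num.max (m i) 0 by rewrite le_max lexx orbT.
by case: (Num.max _ _) => // l _; rewrite -!exprnP !rmorphXn.
Qed.

Lemma extended_binomial_neq s j k : j != k ->
  binomial_of sg' (extended_seed s k) j = e (binomial_of sg s j)%:P.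
Proof.
move=> jk; rewrite !binomialE polyCD rmorphD !polyCM !rmorphM !extended_monomial.
by rewrite extended_coef_pos extended_coef_neg (negPf jk) mulr1.
Qed.

Lemma extended_binomial s k :
  binomial_of sg' (extended_seed s k) k =
  e ((coef_pos sg s k * \prod_i A s i ^ Num.max (B s i k) 0)%:P * 'X +
     (coef_neg sg s k * \prod_i A s i ^ Num.max (- B s i k) 0)%:P).
Proof.
rewrite !binomialE rmorphD !polyCM !rmorphM !extended_monomial.
by rewrite extended_coef_pos extended_coef_neg eqxx mulrAC.
Qed.

End Specialization.

(** * The Laurent phenomenon *)

Section LaurentPhenomenon.

(** Being Laurent at [s1] clears [z] by a power of one new variable, being Laurent at [s3] by powers
    of two others; coprimality removes these denominators. *)
Lemma laurent_descent (P : semifieldType) (F : fieldType) (n : nat) (sg : P -> F)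
    (s s1 s3 : seed n P F) (j k : 'I_n) z :
  let L := laurent (coef_range sg) setT (cluster s) in
  cluster s1 j != 0 -> cluster s3 j != 0 -> cluster s3 k != 0 ->
  (forall i, i != j -> cluster s1 i = cluster s i) ->
  (forall i, i != j -> i != k -> cluster s3 i = cluster s i) ->
  [/\ L (cluster s1 j), L (cluster s3 k), L (cluster s3 j),
      cancels L (cluster s1 j) (cluster s3 k) & cancels L (cluster s1 j) (cluster s3 j)] ->
  laurent (coef_range sg) setT (cluster s1) z ->
  laurent (coef_range sg) setT (cluster s3) z -> L z.
Proof.
move=> L u0 w0 v0 s1E s3E [Lu Lv Lw cv cw] Lz1 Lz3.
have Ls : subring_pred L by apply: laurent_subring.
have LR c : coef_range sg c -> L c by apply: laurent_const.
have Lx i : L (cluster s i) by apply: laurent_var; rewrite inE.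
have LxV i : L (cluster s i)^-1 by apply: laurent_varV; rewrite inE.
have [_ [a ->] Lza] : exists2 m, exists a, m = cluster s1 j ^+ a & L (m * z).
  apply: (laurent_poly_denom Ls _ _ _ LR _ Lz1) => [|_ _ [a ->] [b ->]|_ [a ->]|i _].
  - by exists 0%N.
  - by exists (a + b)%N; rewrite exprD.
  - exact: subringX.
  have [->|ij] := eqVneq i j.
    split=> //; exists (cluster s1 j); first by exists 1%N.
    by rewrite divff //; apply: subring1.
  by rewrite s1E //; split=> //; exists 1; [exists 0%N|rewrite div1r].
have [_ [b [c ->]] Lzbc] : exists2 m,
    exists b c, m = cluster s3 k ^+ b * cluster s3 j ^+ c & L (m * z).
  apply: (laurent_poly_denom Ls _ _ _ LR _ Lz3)
    => [|_ _ [a1 [b1 ->]] [a2 [b2 ->]]|_ [a1 [b1 ->]]|i _].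
  - by exists 0%N, 0%N; rewrite mulr1.
  - by exists (a1 + a2)%N, (b1 + b2)%N; rewrite !exprD mulrACA.
  - by apply: subringM => //; apply: subringX.
  have [->|ij] := eqVneq i j.
    split=> //; exists (cluster s3 j); first by exists 0%N, 1%N; rewrite mul1r.
    by rewrite divff //; apply: subring1.
  have [->|ik] := eqVneq i k.
    split=> //; exists (cluster s3 k); first by exists 1%N, 0%N; rewrite mulr1.
    by rewrite divff //; apply: subring1.
  by rewrite s3E //; split=> //; exists 1; [exists 0%N, 0%N; rewrite mulr1|rewrite div1r].
exact: (coprime_denominators Ls u0 Lu Lv Lw cv cw Lza Lzbc).
Qed.

Lemma laurent_mutation (P : semifieldType) (F : fieldType) (n : nat) (sg : P -> F)
    (s : seed n P F) k : skew_symmetrizable (exchange_matrix s) ->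
  laurent (coef_range sg) setT (cluster s) (cluster (mutate sg k s) k).
Proof.
move=> sk; rewrite mutate_cluster; apply: laurentM; last first.
  by apply: laurent_varV; rewrite inE.
exact: (laurent_mono (subsetT _) (fun _ _ => erefl) (binomial_laurent sg k sk)).
Qed.

Theorem laurent_phenomenon (P : semifieldType) (F : fieldType) (n : nat) (sg : P -> F)
    (s : seed n P F) (w : seq 'I_n) i :
  coefficient_map sg -> skew_symmetrizable (exchange_matrix s) ->
  independent (coef_range sg) (cluster s) ->
  laurent (coef_range sg) setT (cluster s) (cluster (mutations sg s w) i).
Proof.
(* The semifield and the field vary in the induction, because the case [b_jk = 0] uses it for an
   extended seed. *)
have [m] := ubnP (size w); elim: m => // m IH in P F sg s w i *.
case: w => [|j [|k w]] wm sgP sk xI.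
- by apply: laurent_var; rewrite inE.
- have [->|ij] := eqVneq i j; first exact: laurent_mutation.
  rewrite /mutations /= -/(mutate sg j s) mutate_cluster_neq //.
  by apply: laurent_var; rewrite inE.
have mutK (P' : semifieldType) (F' : fieldType) (sg' : P' -> F') (t : seed n P' F') l :
    coefficient_map sg' -> skew_symmetrizable (exchange_matrix t) ->
    independent (coef_range sg') (cluster t) ->
    mutate sg' l (mutate sg' l t) = t.
  move=> sgP' tk tI; apply: mutateK => //; first exact: independent_neq0 tI.
  exact: binomial_neq0.
have [jk|jk] := eqVneq j k.
  rewrite -jk /mutations /= -/(mutate sg j s) -/(mutate sg j (mutate sg j s)).
  by rewrite mutK //; apply: IH => //; move: wm => /=; lia.
have descent (P' : semifieldType) (F' : fieldType) (sg' : P' -> F') (t : seed n P' F') l :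
    coefficient_map sg' -> skew_symmetrizable (exchange_matrix t) ->
    independent (coef_range sg') (cluster t) ->
    let L := laurent (coef_range sg') setT (cluster t) in
    let t1 := mutate sg' j t in let t2 := mutate sg' k t1 in
    let t3 := mutate sg' j t2 in
    [/\ L (cluster t1 j), L (cluster t2 k), L (cluster t3 j),
      cancels L (cluster t1 j) (cluster t2 k) & cancels L (cluster t1 j) (cluster t3 j)] ->
    L (cluster (mutations sg' t [:: j, k & w]) l).
  move=> sgP' tk tI L t1 t2 t3 H.
  have sk1 := mutate_skew sg' j tk; have I1 : independent (coef_range sg') (cluster t1) by exact: mutate_independent.
  have sk2 := mutate_skew sg' k sk1; have I2 : independent (coef_range sg') (cluster t2) by exact: mutate_independent.
  have sk3 := mutate_skew sg' j sk2; have I3 : independent (coef_range sg') (cluster t3) by exact: mutate_independent.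
  have t3k : cluster t3 k = cluster t2 k by rewrite mutate_cluster_neq // eq_sym.
  apply: (@laurent_descent _ _ _ sg' t t1 t3 j k).
  - exact: independent_neq0 I1.
  - exact: independent_neq0 I3.
  - exact: independent_neq0 I3.
  - by move=> l' ?; rewrite mutate_cluster_neq.
  - by move=> l' ??; rewrite !mutate_cluster_neq.
  - by rewrite t3k.
  - by apply: (IH _ _ _ t1 (k :: w)) => //; move: wm => /=; lia.
  (* Mutation in direction [j] is an involution, so the target is reached from [t3] by [j :: w], a
     word shorter by one letter. *)
  have -> : mutations sg' t [:: j, k & w] = mutations sg' t3 (j :: w).
    by rewrite /mutations /= -/t1 -/t2 mutK.
  by apply: IH => //; move: wm => /=; lia.
have [Bjk|Bjk] := eqVneq (exchange_matrix s j k) 0; last first.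
  by apply: descent => //; apply: noncommuting_exchanges.
pose e := @tofrac {poly F}.
have e_inj : injective e by move=> p q /eqP; rewrite tofrac_eq => /eqP.
pose sg' := extended_coef sg e; pose s' := extended_seed e s k.
have x0 l : cluster s l != 0 by apply: independent_neq0 xI.
have sgP' : coefficient_map sg' by apply: extended_coef_map.
have s'E : cluster s' = extended_cluster e (cluster s) :> (_ -> _).
  exact: extended_seed_cluster.
have s'I : independent (coef_range sg') (cluster s').
  by rewrite s'E; apply: extended_independent.
have p0 := binomial_neq0 sgP sk xI j.
have p'0 := binomial_neq0 sgP' (sk : skew_symmetrizable (exchange_matrix s')) s'I j.
have x'0 := independent_neq0 j s'I.
have [wE vE] := commuting_exchanges (sk : skew_symmetrizable (exchange_matrix s'))
  jk Bjk x'0 p'0.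
have L's' l : laurent (coef_range sg') setT (cluster s')
    (cluster (mutations sg' s' [:: j, k & w]) l).
  apply: descent => //; rewrite wE vE; split.
  - exact: laurent_mutation.
  - exact: laurent_mutation.
  - by apply: laurent_var; rewrite inE.
  - rewrite !mutate_cluster extended_binomial_neq // extended_binomial s'E.
    apply: extended_cancels => //.
    - by rewrite mulf_neq0 ?(sg_neq0 sgP) // (prod_exprz_neq0 xI).
    - apply: laurentM; first by apply: laurent_const; eexists.
      by apply: prod_exprz_laurent => a _; rewrite inE.
    rewrite invfM -prodfV; apply: laurentM.
      by apply: laurent_const; rewrite -(sgV sgP); eexists.
    under eq_bigr do rewrite invr_expz.
    by apply: prod_exprz_laurent => a _; rewrite inE.
  by apply: cancels_unit => //; apply: laurent_varV; rewrite inE.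
(* Values at [y = 1] are required along every prefix of the path: the induction hypothesis covers
   the proper prefixes and [L's'] the full path. *)
have [|_ _ /(_ i) spi] := mutations_lies_over (w := [:: j, k & w]) e_inj sgP sk xI
  (extended_seed_lies_over e s k).
  move=> u v l wE'.
  have : laurent (coef_range sg') setT (cluster s') (cluster (mutations sg' s' u) l).
    case: v wE' => [|a v] wE'; first by rewrite cats0 in wE'; rewrite -wE'; apply: L's'.
    apply: IH => //.
    by have := congr1 size wE'; rewrite size_cat /=; move: wm => /=; lia.
  by rewrite s'E => /(specializes_laurent e_inj x0)[v' _ ?]; exists v'.
have := L's' i; rewrite s'E => /(specializes_laurent e_inj x0)[v Lv spv].
by rewrite (specializes_inj e_inj spi spv).
Qed.

End LaurentPhenomenon.

(** * Units *)

Lemma laurent_sub (F : fieldType) (I : finType) (R R1 : F -> Prop) (D : {set I}) x f :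
  (forall c, R1 c -> R c) -> laurent R1 D x f -> laurent R D x f.
Proof.
move=> sub; apply: laurent_trans => // [c /sub|i iD]; first exact: laurent_const.
by split; [apply: laurent_var|apply: laurent_varV].
Qed.

Lemma independent_sub (F : fieldType) (I : finType) (R R1 : F -> Prop) (x : I -> F) :
  (forall c, R1 c -> R c) -> independent R x -> independent R1 x.
Proof. by move=> sub xI j q Lq; apply: (xI j) => i; apply: laurent_sub (Lq i). Qed.

Lemma transcendental_notin (F : fieldType) (L : F -> Prop) a :
  subring_pred L -> transcendental L a -> ~ L a.
Proof.
move=> Ls tr La; have /eqP : 'X - a%:P = 0.
  apply: tr; last by rewrite hornerXsubC subrr.
  apply: (subringB (poly_over_subring Ls)); last exact: poly_overC.
  exact: (poly_overXn Ls 1).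
by rewrite polyXsubC_eq0.
Qed.

Lemma exprz_quotient (F : fieldType) (a : F) (z : int) : a != 0 ->
  exists m l : nat, a ^ z * a ^+ l = a ^+ m /\ z = m%:Z - l%:Z.
Proof.
move=> a0; case: z => m; first by exists m, 0%N; rewrite expr0 mulr1 subr0.
exists 0%N, m.+1; rewrite expr0 NegzE sub0r -exprnN mulVf //.
exact: expf_neq0.
Qed.

Section LaurentUnits.
Variables (F : fieldType) (I : finType) (R : F -> Prop) (x : I -> F).
Hypothesis xI : independent R x.

Let x0 i : x i != 0.
Proof. exact: independent_neq0 xI. Qed.

Lemma laurent_monomial (D : {set I}) (c : I -> int) :
  laurent R D x (\prod_(i in D) x i ^ c i).
Proof. by apply: subring_prod => // i; apply: laurent_exprz. Qed.

Lemma monomial_neq0 (D : pred I) (c : I -> int) : \prod_(i | D i) x i ^ c i != 0.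
Proof. by apply/prodf_neq0 => i _; rewrite expfz_neq0. Qed.

(** Variables are removed one by one. The numerators of [f] and of its inverse multiply to a power
    of the indeterminate, so that of [f] is [c *: 'X^l]; both [c] and [c^-1] occur as coefficients
    of these numerators. *)
Lemma laurent_unit (D : {set I}) f : laurent R D x f -> laurent R D x f^-1 -> f != 0 ->
  exists (u : F) (c : I -> int),
    [/\ laurent R set0 x u, laurent R set0 x u^-1 & f = u * \prod_(i in D) x i ^ c i].
Proof.
have [m] := ubnP #|D|; elim: m D f => // m IH D f Dm Lf LfV f0.
have [D0|[j jD]] := set_0Vmem D.
  by exists f, (fun=> 0); rewrite D0 big_set0 mulr1 -D0.
set L := laurent R (D :\ j) x.
have [q [a [Lq qE]]] := laurent_polyE jD (x0 j) Lf.
have [r [b [Lr rE]]] := laurent_polyE jD (x0 j) LfV.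
have DL f' : L f' -> laurent R (setT :\ j) x f'.
  by apply: laurent_mono => //; apply: setSD; apply: subsetT.
have Ps : subring_pred (poly_over L) by apply: poly_over_subring.
have qrE : q * r = 'X^(a + b).
  apply: (transcendental_inj _ (xI (j := j))) => // [i|i|].
  - by apply: DL; apply: (subringM Ps).
  - by apply: DL; apply: poly_overXn.
  rewrite hornerM hornerXn exprD.
  have -> : q.[x j] = f * x j ^+ a by rewrite qE mulfVK ?expf_neq0.
  have -> : r.[x j] = f^-1 * x j ^+ b by rewrite rE mulfVK ?expf_neq0.
  by field.
have : q %| ('X - 0%:P) ^+ (a + b) by rewrite subr0 -qrE dvdp_mulIl.
case/dvdp_exp_XsubCP => l lab /eqpf_eq[c c0]; rewrite subr0 => qX.
have Lc : L c by have := Lq l; rewrite qX coefZ coefXn eqxx mulr1.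
have LcV : L c^-1.
  have := congr1 (fun p : {poly F} => p`_(a + b)) qrE.
  rewrite qX -scalerAl coefZ coefXnM ltnNge lab coefXn eqxx /= => E.
  by have -> : c^-1 = r`_(a + b - l) by apply: (mulfI c0); rewrite E mulfV.
have [|u [d [Lu LuV cE]]] := IH (D :\ j) c _ Lc LcV c0.
  by move: Dm; rewrite (cardsD1 j D) jD; lia.
exists u, (fun i => if i == j then l%:Z - a%:Z else d i); split=> //.
rewrite (bigD1 j) //= eqxx qE qX hornerZ hornerXn expfzDr // -exprnN -exprnP cE.
have -> : \prod_(i in D | i != j) x i ^ (if i == j then l%:Z - a%:Z else d i) =
    \prod_(i in D :\ j) x i ^ d i.
  apply: eq_big => [i|i /andP[_ /negPf->]] //.
  by rewrite !inE andbC.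
by ring.
Qed.

Lemma transcendental_exprz L (a u v : F) (z : int) : subring_pred L -> transcendental L a ->
  L u -> L v -> u != 0 -> v != 0 -> u * a ^ z = v -> z = 0.
Proof.
move=> Ls tr Lu Lv u0 v0; have a0 := transcendental_neq0 Ls tr.
have [m [l [zE zml]]] := exprz_quotient z a0 => E.
have : u%:P * 'X^m = v%:P * 'X^l.
  have Ps := poly_over_subring Ls.
  apply: (transcendental_inj Ls tr).
  - by apply: (subringM Ps); [apply: poly_overC|apply: poly_overXn].
  - by apply: (subringM Ps); [apply: poly_overC|apply: poly_overXn].
  by rewrite !hornerM !hornerC !hornerXn -zE -E mulrA.
move=> /(congr1 (fun p : {poly F} => p`_m)); rewrite !coefCM !coefXn eqxx mulr1.
case: eqP => [ml _|_]; first by rewrite zml ml subrr.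
by rewrite mulr0 => /eqP; rewrite (negPf u0).
Qed.

Lemma monomial_exponent_inj (u v : F) (c d : I -> int) :
  laurent R set0 x u -> laurent R set0 x v -> u != 0 -> v != 0 ->
  u * \prod_(i in setT) x i ^ c i = v * \prod_(i in setT) x i ^ d i -> c =1 d.
Proof.
move=> Lu Lv u0 v0 E j; apply/eqP; rewrite -subr_eq0; apply/eqP.
have L0 f : laurent R set0 x f -> laurent R (setT :\ j) x f.
  by apply: laurent_mono => //; apply: sub0set.
have Lp e : laurent R (setT :\ j) x (\prod_(i in setT | i != j) x i ^ e i).
  apply: subring_prod => // i /andP[_ ij]; apply: laurent_exprz.
  by rewrite !inE ij.
apply: (@transcendental_exprz (laurent R (setT :\ j) x) (x j)
  (u * \prod_(i in setT | i != j) x i ^ c i) (v * \prod_(i in setT | i != j) x i ^ d i)) => //.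
- by apply: laurentM => //; apply: L0.
- by apply: laurentM => //; apply: L0.
- by rewrite mulf_neq0 // monomial_neq0.
- by rewrite mulf_neq0 // monomial_neq0.
have jT : j \in [set: I] by rewrite inE.
move: E; rewrite !(bigD1 (P := mem setT) j) //= expfzDr // -invr_expz => E.
apply: (mulIf (_ : x j ^ d j != 0)); first by rewrite expfz_neq0.
rewrite mulrA mulfVK ?expfz_neq0 // mulrAC -mulrA E; ring.
Qed.

(** The constant is read off as a coefficient, one variable at a time. With [R1] the image of [P],
    this turns the Laurent phenomenon into the integrality of a unit. *)
Lemma monomial_coefficient (R1 : F -> Prop) (D : {set I}) (u : F) (c : I -> int) :
  (forall a, R1 a -> R a) -> laurent R set0 x u ->
  laurent R1 D x (u * \prod_(i in D) x i ^ c i) -> laurent R1 set0 x u.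
Proof.
move=> sub; have [m] := ubnP #|D|; elim: m D => // m IH D Dm Lu Lf.
have [D0|[j jD]] := set_0Vmem D; first by move: Lf; rewrite D0 big_set0 mulr1.
have [q [a [Lq qE]]] := laurent_polyE jD (x0 j) Lf.
set L := laurent R1 (D :\ j) x.
have DL f' : L f' -> laurent R (setT :\ j) x f'.
  move/(laurent_sub sub); apply: laurent_mono => //; apply: setSD; exact: subsetT.
apply: (IH (D :\ j)) => //; first by move: Dm; rewrite (cardsD1 j D) jD; lia.
set v := u * _.
have Lv : laurent R (setT :\ j) x v.
  apply: laurentM; first by apply: laurent_mono Lu => //; apply: sub0set.
  apply: laurent_mono (laurent_monomial _ c) => //; apply: setSD; exact: subsetT.
have [k [l [xE _]]] := exprz_quotient (c j) (x0 j).
have Rs := laurent_subring R (setT :\ j) x.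
have Ps : subring_pred (poly_over (laurent R (setT :\ j) x)) by apply: poly_over_subring.
have E : v%:P * 'X^(k + a) = q * 'X^l.
  apply: (transcendental_inj _ (xI (j := j))) => //.
  - by apply: (subringM Ps); [apply: poly_overC|apply: poly_overXn].
  - by apply: (subringM Ps); [move=> i; apply: DL|apply: poly_overXn].
  have -> : (v%:P * 'X^(k + a)).[x j] = v * x j ^ c j * x j ^+ l * x j ^+ a.
    by rewrite hornerM hornerC hornerXn exprD -xE !mulrA.
  have <- : u * \prod_(i in D) x i ^ c i = v * x j ^ c j.
    rewrite (bigD1 j) //= /v -mulrA; congr (_ * _).
    rewrite mulrC; congr (_ * _); apply: eq_bigl => i.
    by rewrite !inE andbC.
  by rewrite qE hornerM hornerXn mulrAC mulfVK // expf_neq0.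
have <- : (q * 'X^l)`_(k + a) = v by rewrite -E coefCM coefXn eqxx mulr1.
by apply: (subringM (poly_over_subring (laurent_subring R1 (D :\ j) x))) => //;
  apply: poly_overXn.
Qed.

End LaurentUnits.

(** * Invertible exchange binomials *)

Section ExchangeUnits.
Variables (P : semifieldType) (F : fieldType) (n : nat) (sg : P -> F).
Hypothesis sgP : coefficient_map sg.
Variable R : F -> Prop.
Hypothesis subR : forall c, coef_range sg c -> R c.
Variable s : seed n P F.
Hypothesis sk : skew_symmetrizable (exchange_matrix s).
Local Notation x := (cluster s).
Hypothesis xI : independent R x.

(** A unit is a monomial times a constant, whereas a nonzero entry [b_jk] gives the binomial two
    terms of different degrees in [A_j]. If the column vanishes, the binomial is itself a
    constant. *)
Lemma binomial_unit k : laurent R setT x (binomial_of sg s k)^-1 ->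
  laurent R set0 x (binomial_of sg s k) /\ laurent R set0 x (binomial_of sg s k)^-1.
Proof.
move=> LpV; set p := binomial_of sg s k in LpV *.
have xI' := independent_sub subR xI.
have p0 : p != 0 := binomial_neq0 sgP sk xI' k.
have Lp : laurent R setT x p.
  apply: (laurent_sub subR).
  exact: (laurent_mono (subsetT _) (fun _ _ => erefl) (binomial_laurent sg k sk)).
have [u [c [Lu LuV pE]]] := laurent_unit xI Lp LpV p0.
have u0 : u != 0 by apply: contraNneq p0 => u0; rewrite pE u0 mul0r.
have [/forallP B0|/forallPn[j Bjk]] := boolP [forall j, exchange_matrix s j k == 0].
  have Lp0 : laurent R set0 x p.
    rewrite /p binomialE !big1 ?mulr1 => [|i _|i _]; last 2 first.
    - by rewrite (eqP (B0 i)) oppr0.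
    - by rewrite (eqP (B0 i)).
    by apply: laurentD; apply: laurent_const; apply: subR; eexists.
  have c0 : c =1 fun=> 0.
    by apply: (monomial_exponent_inj xI Lu Lp0) => //; rewrite -pE [X in _ * X]big1 ?mulr1.
  have pu : p = u by rewrite pE big1 ?mulr1 // => i _; rewrite c0.
  by rewrite pu.
exfalso; have jk : j != k by apply: contraNneq Bjk => ->; rewrite skew_diag.
have DD : setT :\ k :\ j \subset setT :\ j by apply: setSD; apply: subsetT.
have Lrp := laurent_sub subR (laurent_mono DD (fun _ _ => erefl) (rest_pos_laurent sg s j k)).
have Lrn := laurent_sub subR (laurent_mono DD (fun _ _ => erefl) (rest_neg_laurent sg s j k)).
have rp0 := rest_pos_neq0 sgP xI' j k; have rn0 := rest_neg_neq0 sgP xI' j k.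
have xj0 := independent_neq0 j xI.
have [m [l [xE _]]] := exprz_quotient (c j) xj0.
pose v := u * \prod_(i in setT | i != j) x i ^ c i.
have Lv : laurent R (setT :\ j) x v.
  apply: laurentM; first by apply: laurent_mono Lu => //; apply: sub0set.
  by apply: subring_prod => // i /andP[_ ij]; apply: laurent_exprz; rewrite !inE ij.
set b := exchange_matrix s j k in Bjk.
pose a1 := `|Num.max b 0|%N; pose a2 := `|Num.max (- b) 0|%N.
have a12 : a1 != a2 by rewrite /a1 /a2; lia.
have E : ((rest_pos sg s j k)%:P * 'X^a1 + (rest_neg sg s j k)%:P * 'X^a2) * 'X^l = v%:P * 'X^m.
  have Rs := laurent_subring R (setT :\ j) x.
  have Ps : subring_pred (poly_over (laurent R (setT :\ j) x)) by apply: poly_over_subring.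
  have PX t d : laurent R (setT :\ j) x t -> poly_over (laurent R (setT :\ j) x) (t%:P * 'X^d).
    by move=> Lt; apply: (subringM Ps); [apply: poly_overC|apply: poly_overXn].
  apply: (transcendental_inj Rs (xI (j := j))).
  - apply: (subringM Ps); last exact: poly_overXn.
    by apply: (subringD Ps); apply: PX.
  - exact: PX.
  have -> : (v%:P * 'X^m).[x j] = p * x j ^+ l.
    rewrite hornerM hornerC hornerXn -xE pE [in RHS](bigD1 (P := mem setT) j) ?inE //= /v.
    by ring.
  rewrite hornerM hornerXn; congr (_ * _).
  rewrite hornerD !hornerM !hornerC !hornerXn /p (binomial_split sg sk jk).
  rewrite !exprnP /a1 /a2 !gez0_abs ?le_max ?lexx ?orbT // -/b.
  by rewrite mulrC [X in _ + X]mulrC.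
have C a : rest_pos sg s j k *+ (a == a1) + rest_neg sg s j k *+ (a == a2) =
    v *+ (a + l == m)%N.
  have := congr1 (fun q : {poly F} => q`_(a + l)) E.
  rewrite coefMXn ltnNge leq_addl /= addnK coefD !coefCM !coefXn.
  by rewrite !mulr_natr.
have := C a1; have := C a2; rewrite !eqxx eq_sym (negPf a12) mulr0n addr0 add0r !mulr1n.
case: eqP => [e2|_]; last by move=> /eqP; rewrite (negPf rn0).
case: eqP => [e1|_]; last by move=> _ /eqP; rewrite (negPf rp0).
by move/eqP: a12 => []; apply: (@addIn l); rewrite e1 e2.
Qed.

End ExchangeUnits.

(** * Torsion-freeness and finite orders on a semifield *)

Section TorsionFree.
Variable P : semifieldType.
Implicit Types (p q g : P) (C : P -> Prop).
Local Open Scope group_scope.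

(** The sum of the powers of [p] with exponents from 0 to [m], in Horner form. *)
Fixpoint geometric_oplus p m : P :=
  if m is m'.+1 then oplus 1 (p * geometric_oplus p m') else 1.

Lemma geometric_oplusSr p m :
  geometric_oplus p m.+1 = oplus (geometric_oplus p m) (p ^+ m.+1).
Proof.
elim: m => [|m IH]; first by rewrite /= mulg1.
have -> : geometric_oplus p m.+2 = oplus 1 (p * geometric_oplus p m.+1) by [].
by rewrite {1}IH mul_oplusr -expgS oplusA.
Qed.

(** If [p ^+ m = 1], multiplication by [p] permutes the summands [1, p, ..., p ^+ m.-1] cyclically
    and fixes their sum, which is then cancelled in the group. *)
Lemma semifield_torsion_free p m : (0 < m)%N -> p ^+ m = 1 -> p = 1.
Proof.
case: m => // m _ pm; have E : p * geometric_oplus p m = geometric_oplus p m.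
  case: m pm => [|m] pm; first by rewrite /= mulg1 -[RHS]pm expg1.
  by rewrite {1}geometric_oplusSr mul_oplusr -expgS pm oplusC.
by rewrite -[LHS](mulgK (geometric_oplus p m)) E mulgV.
Qed.

(** The strictly positive elements of a partial order on the group, in which [a] is above [b] when
    [C (a * b^-1)]. *)
Definition cone C : Prop := (forall p q, C p -> C q -> C (p * q)) /\ ~ C 1.

Lemma coneX C p m : cone C -> C p -> (0 < m)%N -> C (p ^+ m).
Proof.
move=> [CM _] Cp; case: m => // m _; elim: m => [|m IH]; first by rewrite expg1.
by rewrite expgS; apply: CM.
Qed.

(** The semigroup generated by [C] and [g]; the second condition excludes the empty product. *)
Definition extend_cone C g h : Prop :=
  exists c m, [/\ C c \/ c = 1, C c \/ (0 < m)%N & h = c * g ^+ m].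

(* If adjoining neither g nor its inverse gave a cone, then g would be torsion. *)
Lemma extend_cone_or C g : cone C -> g <> 1 ->
  cone (extend_cone C g) \/ cone (extend_cone C g^-1).
Proof.
move=> Cc g1; have [CM C1] := Cc.
have closed e p q : extend_cone C e p -> extend_cone C e q -> extend_cone C e (p * q).
  move=> [c [m [hc hm ->]]] [d [l [hd hl ->]]]; exists (c * d), (m + l)%N; split.
  - case: hc hd => [hc|->] [hd|->]; rewrite ?mul1g ?mulg1; by [right|left|left; apply: CM].
  - case: hc hm hd => [hc _|-> [//|hm]] [hd|->]; rewrite ?mul1g ?mulg1;
      by [left|left; apply: CM|right; rewrite addn_gt0 hm].
  by rewrite expgnDr semifield_mulACA.
have [D1|] := boolp.EM (extend_cone C g 1); last by left; split=> //; apply: closed.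
have [D2|] := boolp.EM (extend_cone C g^-1 1); last by right; split=> //; apply: closed.
case: D1 D2 => [c [a [hc ha E]]] [d [b [hd hb E']]]; exfalso.
have tor (e : P) m : e <> 1 -> (0 < m)%N -> 1 = 1 * e ^+ m -> False.
  by move=> e1 m0; rewrite mul1g => /esym em; apply: e1; apply: semifield_torsion_free em.
have a0 : (0 < a)%N.
  by case: a ha E => // -[//|//] Cc1; rewrite expg0 mulg1 => c1; case: C1; rewrite c1.
have b0 : (0 < b)%N.
  by case: b hb E' => // -[//|//] Cc1; rewrite expg0 mulg1 => c1; case: C1; rewrite c1.
case: hc E => [Cc1|->] E; last exact: tor g1 a0 E.
(* Eliminating [g] from [c * g ^+ a = 1] and [d * g^-1 ^+ b = 1] gives this relation, which puts 1
   in the cone. *)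
apply: C1; have -> : 1 = c ^+ b * d ^+ a.
  have : 1 = (c * g ^+ a) ^+ b * (d * g^-1 ^+ b) ^+ a by rewrite -E -E' !expg1n mulg1.
  rewrite !semifield_expgMn -!expgnA (mulnC b a) !expVgn => ->.
  by rewrite !mulgA (semifield_mulAC _ _ (d ^+ a)) mulgK.
case: hd => [Cd|->]; first by apply: CM; apply: coneX.
by rewrite expg1n mulg1; apply: coneX.
Qed.

Lemma cone_exists (l : seq P) :
  exists2 C, cone C & forall g, g \in l -> g <> 1 -> C g \/ C g^-1.
Proof.
elim: l => [|g l [C Cc Cl]]; first by exists (fun=> False) => //; split.
have [->|/eqP g1] := eqVneq g 1.
  by exists C => // h; rewrite inE => /orP[/eqP->//|/Cl].
have sub e h : C h -> extend_cone C e h.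
  by move=> Ch; exists h, 0%N; split; [left|left|rewrite expg0 mulg1].
have gen e : extend_cone C e e.
  by exists 1, 1%N; split; [right|right|rewrite expg1 mul1g].
have [Ce|Ce] := extend_cone_or Cc g1.
  exists (extend_cone C g) => // h; rewrite inE => /orP[/eqP-> _|hl h1]; first by left.
  by case: (Cl h hl h1) => Ch; [left|right]; apply: sub.
exists (extend_cone C g^-1) => // h; rewrite inE => /orP[/eqP-> _|hl h1]; first by right.
by case: (Cl h hl h1) => Ch; [left|right]; apply: sub.
Qed.

Definition cone_max C (s : seq P) a : Prop :=
  a \in s /\ forall b, b \in s -> b = a \/ C (a * b^-1).

Lemma cone_max_exists C (s : seq P) : cone C ->
  (forall a b, a \in s -> b \in s -> a <> b -> C (a * b^-1) \/ C (b * a^-1)) ->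
  s != [::] -> exists a, cone_max C s a.
Proof.
move=> [CM _]; elim: s => // c s IH tot _.
have [s0|s0] := eqVneq s [::].
  exists c; split; first by rewrite inE eqxx.
  by move=> b; rewrite s0 inE => /eqP; left.
have [|a [as_ amax]] := IH _ s0.
  by move=> a b as_ bs; apply: tot; rewrite inE ?as_ ?bs orbT.
have [ca|/eqP ca] := eqVneq c a.
  exists a; split; first by rewrite inE as_ orbT.
  by move=> b; rewrite inE => /orP[/eqP->|/amax//]; left.
have [||Cca|Cac] := tot c a _ _ ca; rewrite ?inE ?eqxx ?as_ ?orbT //.
  exists c; split; first by rewrite inE eqxx.
  move=> b; rewrite inE => /orP[/eqP->|/amax[->|Cab]]; [by left|by right|right].
  have -> : c * b^-1 = (c * a^-1) * (a * b^-1) by rewrite mulgA mulgVK.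
  exact: CM.
exists a; split; first by rewrite inE as_ orbT.
by move=> b; rewrite inE => /orP[/eqP->|/amax//]; right.
Qed.

(** Lowering a factor strictly lowers the product. *)
Lemma cone_max_product C (s t : seq P) a b p q : cone C ->
  cone_max C s a -> cone_max C t b -> p \in s -> q \in t -> p * q = a * b ->
  p = a /\ q = b.
Proof.
move=> [CM C1] [_ amax] [_ bmax] /amax[->|Ca] /bmax[->|Cb] E //.
- by move/(mulgI a): E.
- by move: E; rewrite !(semifield_mulC _ b) => /(mulgI b).
case: C1; have -> : 1 = (a * p^-1) * (b * q^-1).
  rewrite mulgA (semifield_mulAC a) -E -mulgA -invgM (semifield_mulC q) mulgV //.
exact: CM.
Qed.

Lemma cone_opp C : cone C -> cone (fun p => C p^-1).
Proof.
move=> [CM C1]; split=> [p q Cp Cq|]; last by rewrite invg1.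
by rewrite invgM; apply: CM.
Qed.

(* The two pairs are the products of the largest and of the smallest elements. *)
Lemma two_unique_products (s t : seq P) : s != [::] -> t != [::] ->
  exists a b c d, [/\ a \in s, b \in t, c \in s & d \in t] /\
   [/\ forall p q, p \in s -> q \in t -> p * q = a * b -> p = a /\ q = b,
       forall p q, p \in s -> q \in t -> p * q = c * d -> p = c /\ q = d
     & a * b = c * d -> forall p, p \in s -> p = a].
Proof.
move=> s0 t0; pose l := [seq a * b^-1 | a <- s ++ t, b <- s ++ t].
have [C Cc Cl] := cone_exists l.
have tot a b : a \in s ++ t -> b \in s ++ t -> a <> b -> C (a * b^-1) \/ C (b * a^-1).
  move=> ha hb ab; have := Cl (a * b^-1); rewrite invgM invgK; apply.
    by apply: allpairs_f.
  by move=> /(congr1 (fun x => x * b)); rewrite mulgVK mul1g.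
have tots a b (ha : a \in s) (hb : b \in s) := tot a b
  (etrans (mem_cat _ _ _) (introT orP (or_introl ha)))
  (etrans (mem_cat _ _ _) (introT orP (or_introl hb))).
have tott a b (ha : a \in t) (hb : b \in t) := tot a b
  (etrans (mem_cat _ _ _) (introT orP (or_intror ha)))
  (etrans (mem_cat _ _ _) (introT orP (or_intror hb))).
have Oc := cone_opp Cc.
have opp (u : seq P) : (forall a b, a \in u -> b \in u -> a <> b ->
    C (a * b^-1) \/ C (b * a^-1)) ->
  forall a b, a \in u -> b \in u -> a <> b -> C (a * b^-1)^-1 \/ C (b * a^-1)^-1.
  by move=> H a b ha hb ab; rewrite !invgM !invgK; case: (H a b ha hb ab); [right|left].
have [a aM] := cone_max_exists Cc tots s0.
have [b bM] := cone_max_exists Cc tott t0.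
have [c cM] := cone_max_exists Oc (opp s tots) s0.
have [d dM] := cone_max_exists Oc (opp t tott) t0.
exists a, b, c, d; split; first by case: aM bM cM dM => [? _] [? _] [? _] [? _].
split=> [p q|p q|E p ps]; [exact: cone_max_product Cc aM bM|exact: cone_max_product Oc cM dM|].
have [ca _] := cone_max_product Cc aM bM cM.1 dM.1 (esym E).
case: (aM.2 p ps) => // Cap; case: (cM.2 p ps) => [->//|]; rewrite ca invgM invgK => Cpa.
case: Cc => CM []; have -> : 1 = (a * p^-1) * (p * a^-1) by rewrite mulgA mulgVK mulgV.
exact: CM.
Qed.

End TorsionFree.

(** * Units of the group ring and integrality *)

Section GroupRingUnits.
Import monalg.
Variables (K : idomainType) (P : semifieldType).
Local Notation G := (groupring K P).
Implicit Types g h : G.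

Lemma groupring_mcoeffM g h q : (g * h : G)@_q =
  \sum_(p1 <- msupp g) \sum_(p2 <- msupp h) g@_p1 * h@_p2 *+ ((p1 * p2)%g == q).
Proof.
rewrite [g * h]/(grmul g h) /grmul raddf_sum; apply: eq_bigr => p1 _.
by rewrite raddf_sum; apply: eq_bigr => p2 _; rewrite /= mcoeffU.
Qed.

Lemma groupring_mcoeff1 q : (1 : G)@_q = (1%g == q)%:R.
Proof. by rewrite -[1 : G]/(grone K P) mcoeffU. Qed.

Lemma mcoeff_unique_product g h a b : a \in msupp g -> b \in msupp h ->
  (forall p q, p \in msupp g -> q \in msupp h -> (p * q = a * b)%g -> p = a /\ q = b) ->
  (g * h : G)@_(a * b)%g = g@_a * h@_b.
Proof.
move=> ag bh uniq_ab; rewrite groupring_mcoeffM (bigD1_seq a) //= (bigD1_seq b) //=.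
rewrite eqxx big1_seq => [|q /andP[qb qh]]; last first.
  case: eqP => // /(uniq_ab _ _ ag qh)[_ qE]; by rewrite qE eqxx in qb.
rewrite addr0 big1_seq ?addr0 // => p /andP[pa pg]; rewrite big1_seq // => q /andP[_ qh].
by case: eqP => // /(uniq_ab _ _ pg qh)[pE]; rewrite pE eqxx in pa.
Qed.

(** A product attained only once has a nonzero coefficient in [g * h], so it equals 1. Hence the
    largest and the smallest products coincide, and the support of [g] is a single element. *)
Lemma groupring_unit g h : g * h = 1 -> exists c p, g = << c *g p >>.
Proof.
move=> gh; have supp0 (f : G) : f != 0 -> (msupp f : seq P) != [::].
  move=> f0; apply: contra_neq f0 => f0; rewrite (monalgE f).
  by rewrite big1_seq // => k; rewrite /= f0.
have g0 : g != 0 by apply/eqP => g0; move/eqP: gh; rewrite g0 mul0r eq_sym oner_eq0.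
have h0 : h != 0 by apply/eqP => h0; move/eqP: gh; rewrite h0 mulr0 eq_sym oner_eq0.
have [a [b [c [d [[ag bh cg dh] [uab ucd H]]]]]] :=
  two_unique_products (supp0 _ g0) (supp0 _ h0).
have one p q : p \in msupp g -> q \in msupp h ->
    (g * h : G)@_(p * q)%g = g@_p * h@_q -> (p * q = 1)%g.
  move=> pg qh; rewrite gh groupring_mcoeff1; case: eqP => // _ /esym/eqP.
  by rewrite mulf_eq0 !mcoeff_eq0 pg qh.
have ab := one _ _ ag bh (mcoeff_unique_product ag bh uab).
have cd := one _ _ cg dh (mcoeff_unique_product cg dh ucd).
have ga p : p \in msupp g -> p = a by apply: H; rewrite ab cd.
exists g@_a, a; apply/malgP => k; rewrite mcoeffU; case: eqP => [<-//|ak].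
by apply: mcoeff_outdom; apply/negP => /ga ka; apply: ak.
Qed.

Definition integral g : Prop := forall p, exists z : int, g@_p = z%:~R.

Lemma integral_subring : subring_pred integral.
Proof.
have Is : subring_pred (fun a : K => exists z : int, a = z%:~R).
  split=> [|_ [z ->]|_ _ [z ->] [z' ->]|_ _ [z ->] [z' ->]].
  - by exists 1.
  - by exists (- z); rewrite mulrNz.
  - by exists (z + z'); rewrite intrD.
  by exists (z * z'); rewrite intrM.
split=> [p|g Ig p|g h Ig Ih p|g h Ig Ih p].
- by rewrite groupring_mcoeff1; exists (1%g == p : nat)%:Z; rewrite -pmulrn.
- by rewrite mcoeffN; apply: (subringN Is).
- by rewrite mcoeffD; apply: (subringD Is).
rewrite groupring_mcoeffM; apply: (subring_sum Is) => p1 _.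
apply: (subring_sum Is) => p2 _; apply: (subringMn Is).
exact: (subringM Is).
Qed.

Lemma groupring_ofM (p q : P) :
  groupring_of K (p * q)%g = groupring_of K p * groupring_of K q.
Proof. by rewrite [RHS](grmulUU 1 1 p q) mulr1. Qed.

Lemma integral_groupring_of (p : P) : integral (groupring_of K p).
Proof. by move=> q; exists (p == q : nat)%:Z; rewrite mcoeffU -pmulrn. Qed.

Section CharacteristicZero.
Hypothesis char0 : [pchar K] =i pred0.

Lemma natr_eq0_char0 m : (m%:R == 0 :> K) = (m == 0)%N.
Proof. by move/pcharf0P: char0 => ->. Qed.

Lemma natr_inj_char0 m l : m%:R = l%:R :> K -> m = l.
Proof.
wlog ml : m l / (m <= l)%N => [H E|E].
  by case/orP: (leq_total m l) => h; [apply: H|apply/esym/H].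
have := natr_eq0_char0 (l - m); rewrite natrB // E subrr eqxx => /esym.
by rewrite subn_eq0 => lm; apply/eqP; rewrite eqn_leq ml.
Qed.

Lemma intr_inj_char0 (z z' : int) : z%:~R = z'%:~R :> K -> z = z'.
Proof.
move/eqP; rewrite -subr_eq0 -intrB => zz'; apply/eqP; rewrite -subr_eq0.
case: (z - z') zz' => m; first by rewrite -pmulrn natr_eq0_char0.
by rewrite NegzE mulrNz oppr_eq0 -pmulrn natr_eq0_char0.
Qed.

Lemma integral_unit g h : g * h = 1 -> integral g -> integral h ->
  exists p, g = groupring_of K p \/ g = - groupring_of K p.
Proof.
move=> gh Ig Ih; have [c [p gE]] := groupring_unit gh.
have [d [q hE]] : exists d q, h = << d *g q >> by apply: (groupring_unit (h := g)); rewrite mulrC.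
have [z cz] := Ig p; have [z' dz'] := Ih q.
rewrite gE mcoeffUU in cz; rewrite hE mcoeffUU in dz'.
have cd : c * d = 1.
  move: gh; rewrite gE hE [LHS](grmulUU c d p q) => E.
  have := congr1 (fun f : G => f@_1%g) E; rewrite mcoeffU groupring_mcoeff1 eqxx.
  by case: eqP => // _ /esym/eqP; rewrite oner_eq0.
have zz' : z * z' = 1 by apply: intr_inj_char0; rewrite intrM -cz -dz' cd.
have H : z = 1 \/ z = -1.
  by have /eqP := congr1 absz zz'; rewrite abszM muln_eq1 => /andP[/eqP]; lia.
exists p; rewrite gE cz; case: H => ->; [by left|right].
by rewrite mulrNz monalgUN.
Qed.

Lemma sum_groupring_of_coef (s : seq P) q :
  (\sum_(p <- s) groupring_of K p : G)@_q = (count_mem q s)%:R.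
Proof.
rewrite raddf_sum -sum1_count natr_sum [RHS]big_mkcond; apply: eq_bigr => p _.
by rewrite /= mcoeffU; case: (p == q).
Qed.

(** In characteristic 0 the coefficients recover the multiplicities, so a nonempty sum has a
    well-defined value in the semifield. *)
Lemma sum_groupring_of_inj (s t : seq P) :
  \sum_(p <- s) groupring_of K p = \sum_(p <- t) groupring_of K p -> perm_eq s t.
Proof.
move=> E; apply/allP => q _; apply/eqP/natr_inj_char0.
by rewrite -!sum_groupring_of_coef E.
Qed.

End CharacteristicZero.
End GroupRingUnits.

Section SemifieldSum.
Variable P : semifieldType.
Implicit Types (p q : P) (s t : seq P).

(* The empty sum is [None], since a semifield has no zero. *)
Definition semifield_sum s : option P :=
  \big[oAC (@oplusA P) (@oplusC P)/None]_(p <- s) Some p.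

Lemma semifield_sum_perm s t : perm_eq s t -> semifield_sum s = semifield_sum t.
Proof. exact: perm_big. Qed.

Lemma semifield_sum_cat s t p q : semifield_sum s = Some p -> semifield_sum t = Some q ->
  semifield_sum (s ++ t) = Some (oplus p q).
Proof. by rewrite /semifield_sum big_cat => -> ->. Qed.

Lemma semifield_sum1 p : semifield_sum [:: p] = Some p.
Proof. by rewrite /semifield_sum big_seq1. Qed.

Lemma semifield_sum_mul q s p : semifield_sum s = Some p ->
  semifield_sum [seq (q * r)%g | r <- s] = Some (q * p)%g.
Proof.
elim: s p => [|r s IH] p; first by rewrite /semifield_sum big_nil.
case E : (semifield_sum s) => [p'|].
  rewrite -cat1s (semifield_sum_cat (semifield_sum1 r) E) => -[<-].
  by rewrite map_cat (semifield_sum_cat (semifield_sum1 _) (IH _ E)) mul_oplusr.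
case: s E {IH} => [_|r' s E].
  by rewrite !semifield_sum1 => -[->].
by move: E; rewrite /semifield_sum big_cons; case: (\big[_/_]_(_ <- _) _).
Qed.

Lemma semifield_sum_allpairs s t p q : semifield_sum s = Some p -> semifield_sum t = Some q ->
  semifield_sum [seq (a * b)%g | a <- s, b <- t] = Some (p * q)%g.
Proof.
move=> Es Et; elim: s p Es => [|r s IH] p; first by rewrite /semifield_sum big_nil.
have Er := semifield_sum_mul r Et.
case E : (semifield_sum s) => [p'|].
  rewrite -cat1s (semifield_sum_cat (semifield_sum1 r) E) => -[<-].
  by rewrite allpairs_cons (semifield_sum_cat Er (IH _ E)) mul_oplusl.
case: s E {IH} => [_|r' s E].
  by rewrite semifield_sum1 => -[<-]; rewrite allpairs_cons /= cats0.
by move: E; rewrite /semifield_sum big_cons; case: (\big[_/_]_(_ <- _) _).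
Qed.

End SemifieldSum.

(** * Free generators and positivity *)

From mathcomp.multinomials Require Import mpoly.

(* Stated for an abstract ring because rewriting under [mmap] makes unification
   unfold the product of multivariate polynomials. *)
Section Fractions.
Variables (F : fieldType) (A : comNzRingType) (ev : {rmorphism A -> F}).
Implicit Types (p q r : A) (a b : F).

Lemma fractionD a b p q p' q' : a * ev q = ev p -> b * ev q' = ev p' ->
  (a + b) * ev (q * q') = ev (p * q' + p' * q).
Proof. by move=> E E'; rewrite rmorphD !rmorphM -E -E'; ring. Qed.

Lemma fractionM a b p q p' q' : a * ev q = ev p -> b * ev q' = ev p' ->
  (a * b) * ev (q * q') = ev (p * p').
Proof. by move=> E E'; rewrite !rmorphM -E -E'; ring. Qed.

Lemma fraction_scaler a p q r : a * ev q = ev p -> a * ev (q * r) = ev (p * r).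
Proof. by move=> E; rewrite !rmorphM -E; ring. Qed.

Lemma fraction_scalel a p q r : a * ev q = ev p -> a * ev (r * q) = ev (p * r).
Proof. by move=> E; rewrite !rmorphM -E; ring. Qed.

Lemma rmorph_addf_div p q p' q' : ev q != 0 -> ev q' != 0 ->
  ev p / ev q + ev p' / ev q' = ev (p * q' + p' * q) / (ev q * ev q').
Proof. by move=> q0 q'0; rewrite rmorphD !rmorphM addf_div. Qed.

End Fractions.

Section FreeGenerators.
Variables (K : idomainType) (P : semifieldType) (F : fieldType) (n : nat).
Variable iota : {rmorphism groupring K P -> F}.
Local Notation G := (groupring K P).

Definition scalar_range (c : F) : Prop := exists u : G, c = iota u.

Lemma scalar_range_subring : subring_pred scalar_range.
Proof.
split=> [|_ [u ->]|_ _ [u ->] [v ->]|_ _ [u ->] [v ->]].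
- by exists 1; rewrite rmorph1.
- by exists (- u); rewrite rmorphN.
- by exists (u + v); rewrite rmorphD.
by exists (u * v); rewrite rmorphM.
Qed.

Variable x : 'I_n -> F.

Lemma mmapM (p q : {mpoly G[n]}) : mmap iota x (p * q) = mmap iota x p * mmap iota x q.
Proof. exact: rmorphM. Qed.

Lemma mmap1r : mmap iota x 1 = 1.
Proof. exact: rmorph1. Qed.

Lemma mmapXn i m : mmap iota x ('X_i ^+ m) = x i ^+ m.
Proof.
elim: m => [|m IH]; first by rewrite !expr0 mmap1r.
by rewrite !exprS mmapM IH mmapX mmap1U.
Qed.

Lemma free_mmap_neq0 p : free_generating_set iota x -> p != 0 -> mmap iota x p != 0.
Proof. by move=> [inj _]; apply: contraNneq => /inj ->. Qed.

Lemma free_iota_inj (u v : G) : free_generating_set iota x -> iota u = iota v -> u = v.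
Proof.
move=> [inj _] uv; have E : ((u - v)%:MP_[n] : {mpoly G[n]}) = 0.
  by apply: inj; rewrite mmapC raddfB /= uv subrr.
have := congr1 (fun p : {mpoly G[n]} => p@_0%MM) E.
by rewrite mcoeffC eqxx mulr1 mcoeff0 => /eqP; rewrite subr_eq0 => /eqP.
Qed.

Section Free.
Hypothesis xF : free_generating_set iota x.
Variable j : 'I_n.

(* Its fixed points are the polynomials in which the j-th variable does not
   occur. *)
Definition kill_var : {mpoly G[n]} -> {mpoly G[n]} :=
  mmap (@mpolyC n G) (fun i => if i == j then 0 else 'X_i).

Lemma kill_var0 : kill_var 0 = 0. Proof. exact: rmorph0. Qed.
Lemma kill_var1 : kill_var 1 = 1. Proof. exact: rmorph1. Qed.
Lemma kill_varN : {morph kill_var : p / - p}. Proof. exact: rmorphN. Qed.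
Lemma kill_varD : {morph kill_var : p q / p + q}. Proof. exact: rmorphD. Qed.
Lemma kill_varM : {morph kill_var : p q / p * q}. Proof. exact: rmorphM. Qed.

Lemma kill_varX i : kill_var 'X_i = if i == j then 0 else 'X_i.
Proof. by rewrite /kill_var mmapX mmap1U. Qed.

Lemma kill_varC c : kill_var c%:MP = c%:MP.
Proof. exact: mmapC. Qed.

Definition fraction_of (f : F) (p q : {mpoly G[n]}) : Prop :=
  [/\ kill_var p = p, kill_var q = q, mmap iota x q != 0
    & f * mmap iota x q = mmap iota x p].

Lemma laurent_fraction f : laurent scalar_range (setT :\ j) x f ->
  exists p q, fraction_of f p q.
Proof.
elim=> {f} [_ [u ->]| |i|i|a _ [p [q [Ep Eq q0 E]]]|a b _ [p [q [Ep Eq q0 E]]] _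
  [p' [q' [Ep' Eq' q'0 E']]]|a b _ [p [q [Ep Eq q0 E]]] _ [p' [q' [Ep' Eq' q'0 E']]]].
- by exists u%:MP, 1; split; rewrite ?kill_varC ?kill_var1 ?mmap1r ?oner_eq0 ?mmapC ?mulr1.
- by exists 1, 1; split; rewrite ?kill_var1 ?mmap1r ?oner_eq0 ?mulr1.
- rewrite !inE andbT => /negPf ij; exists 'X_i, 1.
  by split; rewrite ?kill_varX ?ij ?kill_var1 ?mmap1r ?oner_eq0 ?mulr1 ?mmapX ?mmap1U.
- rewrite !inE andbT => /negPf ij; exists 1, 'X_i.
  have xi0 : mmap iota x 'X_i != 0.
    apply: free_mmap_neq0 => //; apply/eqP => /(congr1 (mcoeff U_(i)%MM)).
    by rewrite mcoeffX eqxx mcoeff0 => /eqP; rewrite oner_eq0.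
  split; rewrite ?kill_varX ?ij ?kill_var1 ?mmap1r //.
  by rewrite mmapX mmap1U in xi0 *; rewrite mulVf.
- exists (- p), q; split; [by rewrite kill_varN Ep|by []|by []|by rewrite mulNr mmapN E].
- exists (p * q' + p' * q), (q * q'); split.
  + by rewrite kill_varD !kill_varM Ep Eq' Ep' Eq.
  + by rewrite kill_varM Eq Eq'.
  + by rewrite mmapM mulf_neq0.
  exact: (fractionD (ev := mmap iota x) E E').
exists (p * p'), (q * q'); split.
- by rewrite kill_varM Ep Ep'.
- by rewrite kill_varM Eq Eq'.
- by rewrite mmapM mulf_neq0.
exact: (fractionM (ev := mmap iota x) E E').
Qed.

Lemma poly_laurent_fraction (f : {poly F}) :
  poly_over (laurent scalar_range (setT :\ j) x) f ->
  exists (p : nat -> {mpoly G[n]}) q, forall i, fraction_of f`_i (p i) q.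
Proof.
elim/poly_ind: f => [|f c IH] Lf.
  exists (fun=> 0), 1 => i; rewrite coef0.
  by split; rewrite ?kill_var0 ?mmap0 ?kill_var1 ?mmap1r ?oner_eq0 ?mul0r.
have [i|p [q pq]] := IH.
  by have := Lf i.+1; rewrite coefD coefMX coefC addr0.
have [p0 [q0 [Ep0 Eq0 q00 E0]]] : exists p q, fraction_of c p q.
  by apply: laurent_fraction; have := Lf 0%N; rewrite coefD coefMX coefC add0r.
exists (fun i => if i is i'.+1 then p i' * q0 else p0 * q), (q * q0) => -[|i].
  have [_ Eq qN0 _] := pq 0%N; rewrite coefD coefMX coefC add0r /=; split.
  - by rewrite kill_varM Ep0 Eq.
  - by rewrite kill_varM Eq Eq0.
  - by rewrite mmapM mulf_neq0.
  exact: (fraction_scalel (ev := mmap iota x) q E0).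
have [Ep Eq qN0 E] := pq i; rewrite coefD coefMX coefC addr0 /=; split.
- by rewrite kill_varM Ep Eq0.
- by rewrite kill_varM Eq Eq0.
- by rewrite mmapM mulf_neq0.
exact: (fraction_scaler (ev := mmap iota x) q0 E).
Qed.

Lemma kill_var_coefficients N (p : nat -> {mpoly G[n]}) : (forall i, kill_var (p i) = p i) ->
  \sum_(i < N) p i * 'X_j ^+ i = 0 -> forall i, (i < N)%N -> p i = 0.
Proof.
elim: N p => // N IH p Ep; rewrite big_ord_recl expr0 mulr1 => E.
have E' : p 0%N + 'X_j * \sum_(i < N) p i.+1 * 'X_j ^+ i = 0.
  rewrite -[RHS]E; congr (_ + _); rewrite mulr_sumr; apply: eq_bigr => i _.
  by rewrite exprS mulrCA.
have p0 : p 0%N = 0.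
  by have := congr1 kill_var E'; rewrite kill_varD kill_varM kill_varX eqxx mul0r addr0 Ep kill_var0.
rewrite p0 add0r in E'.
have xj0 : mmap iota x 'X_j != 0.
  apply: free_mmap_neq0 => //; apply/eqP => /(congr1 (mcoeff U_(j)%MM)).
  by rewrite mcoeffX eqxx mcoeff0 => /eqP; rewrite oner_eq0.
(* The variable is cancelled after evaluation in the field, which is injective by freeness. *)
have S0 : \sum_(i < N) p i.+1 * 'X_j ^+ i = 0.
  apply/eqP; apply: contraTT xj0 => /(free_mmap_neq0 xF) S0; rewrite negbK.
  have := mmapM 'X_j (\sum_(i < N) p i.+1 * 'X_j ^+ i); rewrite E' mmap0 => /esym/eqP.
  by rewrite mulf_eq0 (negPf S0) orbF.
by case=> [|i] // iN; apply: (IH (fun i => p i.+1)).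
Qed.

(** Clearing denominators gives a polynomial relation whose coefficients avoid the [j]-th variable.
    By freeness it holds identically, so its coefficients vanish one by one. *)
Lemma free_transcendental :
  transcendental (laurent scalar_range (setT :\ j) x) (x j).
Proof.
move=> f Lf f0; have [p [q pq]] := poly_laurent_fraction Lf.
have q0 : mmap iota x q != 0 by case: (pq 0%N).
have S0 : \sum_(i < size f) p i * 'X_j ^+ i = 0.
  apply: (xF.1); transitivity (f.[x j] * mmap iota x q); last by rewrite f0 mul0r.
  rewrite [LHS]rmorph_sum horner_coef mulr_suml; apply: eq_bigr => i _.
  have [_ _ _ E] := pq i; rewrite [LHS]mmapM mmapXn -E.
  by rewrite mulrAC.
have p0 := kill_var_coefficients (fun i => let: And4 h _ _ _ := pq i in h) S0.
apply/polyP => i; rewrite coef0; have [/leq_sizeP->//|iN] := leqP (size f) i.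
apply: (mulIf q0); have [_ _ _ ->] := pq i.
by rewrite p0 // mmap0 mul0r.
Qed.

End Free.

Lemma free_independent : free_generating_set iota x -> independent scalar_range x.
Proof. by move=> xF j; apply: free_transcendental. Qed.

End FreeGenerators.

Lemma laurent_ringP (K : idomainType) (P : semifieldType) (F : fieldType) (n : nat)
    (iota : {rmorphism groupring K P -> F}) (s : seed n P F) f :
  (forall i, cluster s i != 0) ->
  laurent_ring iota s f <-> laurent (scalar_range iota) setT (cluster s) f.
Proof.
move=> x0; set x := cluster s.
have monE (m : 'I_n -> nat) : \prod_i x i ^+ m i = mmap iota x 'X_[[multinom m i | i < n]].
  by rewrite mmapX; apply: eq_bigr => i _; rewrite mnmE.
have mon0 (m : 'I_n -> nat) : \prod_i x i ^+ m i != 0.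
  by apply/prodf_neq0 => i _; rewrite expf_neq0.
split=> [[p [m ->]]|].
  have Lx i : laurent (scalar_range iota) setT x (x i) by apply: laurent_var; rewrite inE.
  apply: laurentM.
    apply: subring_sum => // m' _; apply: laurentM.
      by apply: laurent_const; eexists.
    by apply: subring_prod => // i _; apply: subringX.
  rewrite -prodfV; apply: subring_prod => // i _; rewrite -exprVn.
  by apply: subringX => //; apply: laurent_varV; rewrite inE.
apply: (@laurent_trans _ _ (scalar_range iota) setT x (laurent_ring iota s)) =>
  [|_ [u ->]|i _]; first split.
- by exists 1, (fun=> 0%N); rewrite mmap1r big1 ?divr1.
- by move=> _ [p [m ->]]; exists (- p), m; rewrite mmapN mulNr.
- move=> _ _ [p [m ->]] [p' [m' ->]].
  exists (p * 'X_[[multinom m' i | i < n]] + p' * 'X_[[multinom m i | i < n]]),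
    (fun i => (m i + m' i)%N).
  under [in RHS]eq_bigr do rewrite exprD.
  rewrite big_split; have := mon0 m; have := mon0 m'; rewrite !monE => m'0 m0.
  exact: (rmorph_addf_div (ev := mmap iota x) p p' m0 m'0).
- move=> _ _ [p [m ->]] [p' [m' ->]].
  exists (p * p'), (fun i => (m i + m' i)%N).
  under [in RHS]eq_bigr do rewrite exprD.
  by rewrite big_split mmapM mulf_div.
- by exists u%:MP, (fun=> 0%N); rewrite mmapC big1 ?divr1.
split.
  by exists 'X_i, (fun=> 0%N); rewrite mmapX mmap1U big1 ?divr1.
exists 1, (fun i' => (i' == i) : nat).
rewrite mmap1r (bigD1 i) //= eqxx expr1 big1 ?mulr1 ?div1r // => i' /negPf ->.
by rewrite expr0.
Qed.

(** * Subtraction-free elements and their semifield values *)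

Section Positivity.
Variables (K : idomainType) (P : semifieldType) (F : fieldType) (n : nat).
Hypothesis char0 : [pchar K] =i pred0.
Variable iota : {rmorphism groupring K P -> F}.
Local Notation G := (groupring K P).
Local Notation sg := (scalar_of iota).
Variable x : 'I_n -> F.
Hypothesis xF : free_generating_set iota x.

Lemma scalar_of_coefficient_map : coefficient_map sg.
Proof.
split=> [|p q|p].
- exact: rmorph1.
- by rewrite /scalar_of groupring_ofM rmorphM.
apply/eqP => p0; have := sum_groupring_of_inj char0 (s := [:: p; 1%g]) (t := [::]).
rewrite big_cons big_seq1 big_nil.
suff -> : groupring_of K p + groupring_of K 1%g = 0 :> G by move=> /(_ erefl) /perm_size.
apply: (free_iota_inj xF); rewrite rmorphD rmorph0 -[RHS]p0; congr (_ + _).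
exact: rmorph1.
Qed.

Definition at_one (a : {mpoly G[n]}) : G := a.@[fun=> 1].

(* Setting all variables to 1 turns a polynomial with coefficients in N P into
   a sum of elements of P, which is then evaluated in the semifield P. *)
Definition subtraction_free_poly (a : {mpoly G[n]}) (p : P) : Prop :=
  exists2 s : seq P, at_one a = \sum_(q <- s) groupring_of K q & semifield_sum s = Some p.

Lemma subtraction_free_poly_neq0 a p : subtraction_free_poly a p -> a != 0.
Proof.
move=> [s aE sE]; apply/eqP => a0; move: aE; rewrite a0 /at_one meval0 => E.
have := sum_groupring_of_inj char0 (s := s) (t := [::]); rewrite big_nil -E.
move=> /(_ erefl) /perm_nilP s0; move: sE; by rewrite s0 /semifield_sum big_nil.
Qed.

Lemma subtraction_free_polyD a b p q : subtraction_free_poly a p -> subtraction_free_poly b q ->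
  subtraction_free_poly (a + b) (oplus p q).
Proof.
move=> [s aE sE] [t bE tE]; exists (s ++ t); last exact: semifield_sum_cat.
by rewrite /at_one mevalD -!/(at_one _) aE bE big_cat.
Qed.

Lemma subtraction_free_polyM a b p q : subtraction_free_poly a p -> subtraction_free_poly b q ->
  subtraction_free_poly (a * b) (p * q)%g.
Proof.
move=> [s aE sE] [t bE tE]; exists [seq (u * v)%g | u <- s, v <- t].
  rewrite /at_one mevalM -!/(at_one _) aE bE big_allpairs_dep mulr_suml; apply: eq_bigr => u _.
  by rewrite mulr_sumr; apply: eq_bigr => v _; rewrite groupring_ofM.
exact: semifield_sum_allpairs.
Qed.

Lemma subtraction_free_polyC p : subtraction_free_poly (groupring_of K p)%:MP p.
Proof. by exists [:: p]; rewrite ?semifield_sum1 // big_seq1 /at_one mevalC. Qed.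

Lemma subtraction_free_polyX i : subtraction_free_poly 'X_i 1%g.
Proof. by exists [:: 1%g]; rewrite ?semifield_sum1 // big_seq1 /at_one mevalXU. Qed.

Definition subtraction_free (f : F) (p : P) : Prop :=
  exists a b pa pb, [/\ subtraction_free_poly a pa, subtraction_free_poly b pb,
    f * mmap iota x b = mmap iota x a & p = (pa / pb)%g].

Lemma subtraction_free_polyE f a p : subtraction_free_poly a p -> f = mmap iota x a -> subtraction_free f p.
Proof.
move=> ap fE; exists a, 1, p, 1%g; split=> //; last by rewrite divg1.
  exact: subtraction_free_polyC.
by rewrite mmap1r mulr1.
Qed.

Lemma subtraction_free_coef p : subtraction_free (sg p) p.
Proof. by apply: subtraction_free_polyE (subtraction_free_polyC p) _; rewrite mmapC. Qed.

Lemma subtraction_free_var i : subtraction_free (x i) 1%g.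
Proof. by apply: subtraction_free_polyE (subtraction_free_polyX i) _; rewrite mmapX mmap1U. Qed.

Let pos0 a p : subtraction_free_poly a p -> mmap iota x a != 0.
Proof. by move/subtraction_free_poly_neq0; apply: free_mmap_neq0. Qed.

Lemma subtraction_free_neq0 f p : subtraction_free f p -> f != 0.
Proof.
move=> [a [b [pa [pb [aP bP E _]]]]]; apply: contraNneq (pos0 aP) => f0.
by rewrite -E f0 mul0r.
Qed.

Lemma subtraction_freeD f g p q : subtraction_free f p -> subtraction_free g q -> subtraction_free (f + g) (oplus p q).
Proof.
move=> [a [b [pa [pb [aP bP E ->]]]]] [c [d [pc [pd [cP dP E' ->]]]]].
exists (a * d + c * b), (b * d), (oplus (pa * pd) (pc * pb))%g, (pb * pd)%g; split.
- by apply: subtraction_free_polyD; apply: subtraction_free_polyM.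
- exact: subtraction_free_polyM.
- exact: (fractionD (ev := mmap iota x) E E').
rewrite mul_oplusl invgM; congr oplus.
  by rewrite mulgA mulgK.
by rewrite (semifield_mulC pd^-1%g) mulgA mulgK.
Qed.

Lemma subtraction_freeM f g p q : subtraction_free f p -> subtraction_free g q -> subtraction_free (f * g) (p * q)%g.
Proof.
move=> [a [b [pa [pb [aP bP E ->]]]]] [c [d [pc [pd [cP dP E' ->]]]]].
exists (a * c), (b * d), (pa * pc)%g, (pb * pd)%g; split.
- exact: subtraction_free_polyM.
- exact: subtraction_free_polyM.
- exact: (fractionM (ev := mmap iota x) E E').
by rewrite invgM (semifield_mulC pd^-1%g) semifield_mulACA.
Qed.

Lemma subtraction_freeV f p : subtraction_free f p -> subtraction_free f^-1 p^-1%g.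
Proof.
move=> fP; have f0 := subtraction_free_neq0 fP; move: fP => [a [b [pa [pb [aP bP E ->]]]]].
exists b, a, pb, pa; split=> //; last by rewrite invgM invgK.
by rewrite -E mulKf.
Qed.

Lemma subtraction_free1 : subtraction_free 1 1%g.
Proof. by rewrite -(sg1 scalar_of_coefficient_map); apply: subtraction_free_coef. Qed.

Lemma subtraction_free_prod1 (r : seq 'I_n) (f : 'I_n -> F) :
  (forall i, subtraction_free (f i) 1%g) -> subtraction_free (\prod_(i <- r) f i) 1%g.
Proof.
move=> fP; apply: (big_ind (fun f => subtraction_free f 1%g)) => [|f1 f2 P1 P2|//].
  exact: subtraction_free1.
by have := subtraction_freeM P1 P2; rewrite mulg1.
Qed.

Lemma subtraction_freeX1 f (z : int) : subtraction_free f 1%g -> subtraction_free (f ^ z) 1%g.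
Proof.
move=> fP; have fX m : subtraction_free (f ^+ m) 1%g.
  elim: m => [|m IH]; first exact: subtraction_free1.
  by rewrite exprS; have := subtraction_freeM fP IH; rewrite mulg1.
case: z => m; first exact: (fX m).
rewrite NegzE -exprnN; have := subtraction_freeV (fX m.+1).
by rewrite invg1.
Qed.

(** If all variables of a seed have value 1, an exchange binomial has the value of [X_k] divided by
    [oplus 1 X_k], plus the inverse of [oplus 1 X_k], which is 1 in the semifield. *)
Lemma subtraction_free_mutations (s : seed n P F) (w : seq 'I_n) i : cluster s = x :> (_ -> _) ->
  subtraction_free (cluster (mutations sg s w) i) 1%g.
Proof.
move=> sx; elim/last_ind: w i => [|w k IH] i; first by rewrite /mutations /= sx; apply: subtraction_free_var.
rewrite /mutations foldl_rcons -/(mutations sg s w); set t := mutations _ _ _ in IH *.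
have [->|ik] := eqVneq i k; last by rewrite mutate_cluster_neq.
rewrite mutate_cluster; have -> : (1 = 1 * 1^-1 :> P)%g by rewrite mulgV.
apply: subtraction_freeM; last exact: subtraction_freeV.
have M (e : 'I_n -> int) : subtraction_free (\prod_i cluster t i ^ e i) 1%g.
  by apply: subtraction_free_prod1 => j; apply: subtraction_freeX1.
rewrite binomialE; set c := coefficients t k.
have -> : (1 = oplus (c / oplus 1 c * 1) ((oplus 1 c)^-1 * 1) :> P)%g.
  rewrite !mulg1 -[X in oplus _ X]mul1g -mul_oplusl (oplusC c) mulgV //.
by apply: subtraction_freeD; apply: subtraction_freeM => //; apply: subtraction_free_coef.
Qed.

(** A fraction of value 1 representing [iota g] gives two sums of elements of [P] with equal values,
    one being [g] times the other. A minus sign would make a nonempty sum vanish; with a plus sign,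
    comparing values yields [p = 1]. *)
Lemma subtraction_free_unit p g : g = groupring_of K p \/ g = - groupring_of K p ->
  subtraction_free (iota g) 1%g -> g = 1.
Proof.
move=> gE [a [b [pa [pb [[s aE sE] bP E papb]]]]].
have pab : pa = pb by rewrite -[LHS](mulgVK pb) -papb mul1g.
have {}E : g%:MP * b = a.
  apply/eqP; rewrite -subr_eq0; apply/eqP; apply: (xF.1).
  by rewrite mmapB mmapM mmapC -E subrr.
move: bP => [t bE tE].
have {}E : g * \sum_(q <- t) groupring_of K q = \sum_(q <- s) groupring_of K q.
  by rewrite -aE -bE -E /at_one mevalM mevalC.
have pt : groupring_of K p * \sum_(q <- t) groupring_of K q =
    \sum_(q <- [seq (p * r)%g | r <- t]) groupring_of K q.
  by rewrite mulr_sumr big_map; apply: eq_bigr => q _; rewrite groupring_ofM.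
case: gE E => -> E.
  rewrite pt in E; have := semifield_sum_perm (sum_groupring_of_inj char0 E).
  rewrite sE (semifield_sum_mul p tE) pab => -[pE].
  have -> : p = 1%g by rewrite -[LHS](mulgK pb) pE mulgV.
  by [].
move/eqP: E; rewrite mulNr pt eq_sym -addr_eq0 -big_cat => /eqP E.
have := sum_groupring_of_inj char0 (t := [::]) (etrans E (esym (big_nil _ _ _ _))).
move/perm_nilP; case: s sE {E aE} => //.
by rewrite /semifield_sum big_nil.
Qed.

End Positivity.

(** * The upper cluster algebra *)

Lemma integral_of_laurent (K : idomainType) (P : semifieldType) (F : fieldType) (n : nat)
    (iota : {rmorphism groupring K P -> F}) (x : 'I_n -> F) f :
  laurent (coef_range (scalar_of iota)) set0 x f -> exists2 g, integral g & f = iota g.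
Proof.
have Is := integral_subring K P.
apply: (@laurent_trans _ _ _ set0 x (fun f => exists2 g, integral g & f = iota g)) =>
  [|_ [p ->]|i]; last by rewrite inE.
  split=> [|_ [g Ig ->]|_ _ [g Ig ->] [h Ih ->]|_ _ [g Ig ->] [h Ih ->]].
  - by exists 1; [apply: (subring1 Is)|rewrite rmorph1].
  - by exists (- g); [apply: (subringN Is)|rewrite rmorphN].
  - by exists (g + h); [apply: (subringD Is)|rewrite rmorphD].
  by exists (g * h); [apply: (subringM Is)|rewrite rmorphM].
by exists (groupring_of K p) => //; apply: integral_groupring_of.
Qed.

Lemma valuation_pairing0 (F : fieldType) (U : F -> Prop) (a L : F) :
  a != 0 -> (forall f g, U f -> U g -> U (f * g)) -> U 1 -> U a -> U L -> ~ U (L / a) ->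
  valuation_pairing U a L = Some 0%N.
Proof.
move=> a0 UM U1 Ua UL NU.
have only0 r : U (L / a ^+ r) -> (r <= 0)%N.
  case: r => // r Ur; case: NU; have -> : L / a = L / a ^+ r.+1 * a ^+ r.
    by rewrite exprS; field; rewrite expf_neq0.
  apply: (UM) => //; elim: (r) => [|r' IH]; first by rewrite expr0.
  by rewrite exprS; apply: UM.
have L0 : is_largest_power U a L 0 by split=> //; rewrite expr0 divr1.
rewrite /valuation_pairing; case: boolp.pselect => [ex|[]]; last by exists 0%N.
case: (boolp.cid ex) => r [Ur _] /=; congr Some.
by apply/eqP; rewrite -leqn0; apply: only0.
Qed.

Section UpperClusterAlgebra.
Variables (K : idomainType) (P : semifieldType) (n : nat) (F : fieldType).
Hypothesis char0 : [pchar K] =i pred0.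
Variable iota : {rmorphism groupring K P -> F}.
Variable S : tree_vertex n -> seed n P F.
Hypothesis S_pattern : is_seed_pattern iota S.
Hypothesis P_noninvertible : forall t k,
  ~ invertible_in_groupring iota (exchange_binomial iota (S t) k).

Local Notation U := (upper_cluster_algebra iota S).
Local Notation A t := (cluster (S t)).
Local Notation sg := (scalar_of iota).
Local Notation R := (scalar_range iota).

Let Sfree t : free_generating_set iota (A t).
Proof. by case: S_pattern => /(_ t)[]. Qed.

Let Sskew t : skew_symmetrizable (exchange_matrix (S t)).
Proof. by case: S_pattern => /(_ t)[]. Qed.

Let SI t : independent R (A t).
Proof. exact: free_independent. Qed.
Arguments SI : clear implicits.

Let subR c : coef_range sg c -> R c.
Proof. by move=> [p ->]; exists (groupring_of K p). Qed.

Let sgP (t : tree_vertex n) : coefficient_map sg.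
Proof. exact: (scalar_of_coefficient_map char0 (Sfree t)). Qed.

Let A0 t i : A t i != 0.
Proof. exact: (independent_neq0 i (SI t)). Qed.

Lemma upperP f : U f <-> forall t, laurent R setT (A t) f.
Proof. by split=> Uf t; apply/laurent_ringP => //; apply: Uf. Qed.

Lemma upper_subring : subring_pred U.
Proof.
split=> [|f /upperP Uf|f g /upperP Uf /upperP Ug|f g /upperP Uf /upperP Ug]; apply/upperP => t.
- exact: laurent1.
- exact: laurentN.
- exact: laurentD.
exact: laurentM.
Qed.

Lemma pattern_mutate k t t' : tree_edge k t t' -> S t' = mutate sg k (S t).
Proof. by case: S_pattern => _; apply. Qed.

(** The path goes through the empty word, the root of the tree, and may backtrack. *)
Lemma pattern_mutations t t' : exists w, S t' = mutations sg (S t) w.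
Proof.
pose root : tree_vertex n := exist _ [::] isT.
have step k w t1 : val t1 = k :: w ->
    exists t2 : tree_vertex n, [/\ val t2 = w, tree_edge k t1 t2 & tree_edge k t2 t1].
  move=> E; have ws : sorted [rel i j | i != j] w.
    by have := valP t1; rewrite E; apply: path_sorted.
  by exists (exist _ w ws); split=> //; [right|left].
have down t1 : exists w, S root = mutations sg (S t1) w.
  move E : (val t1) => w; elim: w t1 E => [|k w IH] t1 E.
    by exists [::]; congr S; apply: val_inj.
  have [t2 [/IH[u ->] e _]] := step k w t1 E; exists (k :: u).
  by rewrite (pattern_mutate e).
have up t1 : exists w, S t1 = mutations sg (S root) w.
  move E : (val t1) => w; elim: w t1 E => [|k w IH] t1 E.
    by exists [::]; congr S; apply: val_inj.
  have [t2 [/IH[u uE] _ e]] := step k w t1 E; exists (rcons u k).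
  by rewrite (pattern_mutate e) uE /mutations foldl_rcons.
have [u uE] := down t; have [v vE] := up t'; exists (u ++ v).
by rewrite /mutations foldl_cat -/(mutations sg _ u) -uE.
Qed.

Lemma cluster_laurent t t' i : laurent (coef_range sg) setT (A t) (A t' i).
Proof.
have [w ->] := pattern_mutations t t'; apply: laurent_phenomenon => //.
  exact: sgP.
exact: independent_sub (SI t).
Qed.

Lemma cluster_subtraction_free t t' i : subtraction_free iota (A t) (A t' i) 1%g.
Proof. by have [w ->] := pattern_mutations t t'; apply: subtraction_free_mutations. Qed.

Lemma cluster_upper t i : U (A t i).
Proof. by apply/upperP => t'; apply: (laurent_sub subR); apply: cluster_laurent. Qed.

Lemma laurent_scalar (x : 'I_n -> F) u : laurent R set0 x u -> R u.
Proof.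
by apply: laurent_trans => // [|i]; [apply: scalar_range_subring|rewrite inE].
Qed.

Lemma scalar_upper (x : 'I_n -> F) u : laurent R set0 x u -> U u.
Proof. by move/laurent_scalar => Ru; apply/upperP => t; apply: laurent_const. Qed.

Lemma cluster_not_scalar t i : ~ R (A t i).
Proof.
by move=> Ru; apply: (transcendental_notin _ (SI t i)) => //; apply: laurent_const.
Qed.

(* A negative exponent of [A t i] would make the exchange binomial invertible in
   the Laurent ring of the seed adjacent to [t] in direction [i]. *)
Lemma upper_exponent_ge0 t f u (c : 'I_n -> int) :
  U f -> laurent R set0 (A t) u^-1 -> u != 0 ->
  f = u * \prod_(i in setT) A t i ^ c i -> forall i, 0 <= c i.
Proof.
move=> Uf LuV u0 fE i; have [t' [e _]] := tree_edge_regular i t.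
rewrite leNgt; apply/negP => ci.
have tE : S t' = mutate sg i (S t) := pattern_mutate e.
have At' j : j != i -> A t' j = A t j by move=> ji; rewrite tE mutate_cluster_neq.
set p := binomial_of sg (S t') i.
have pE : p = A t i * A t' i.
  by rewrite /p tE mutate_binomial // mutate_cluster mulrC mulfVK.
have p0 : p != 0 by rewrite pE mulf_neq0.
have L' := laurent_subring R setT (A t').
have LX (z : int) j : laurent R setT (A t') (A t' j ^ z) by apply: laurent_exprz; rewrite inE.
(* Since [A t i = p / A t' i], every factor of [f] other than [p ^ c i] is a unit at [t']. *)
have Lp : laurent R setT (A t') (p ^ c i).
  have -> : p ^ c i = f * u^-1 * \prod_(j in setT | j != i) A t' j ^ (- c j) * A t' i ^ c i.
    have -> : \prod_(j in setT | j != i) A t' j ^ (- c j) =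
        (\prod_(j in setT | j != i) A t j ^ c j)^-1.
      by rewrite -prodfV; apply: eq_bigr => j /andP[_ ji]; rewrite At' // invr_expz.
    rewrite fE (bigD1 (P := mem setT) i) ?inE //= pE expfzMl.
    have pr0 : \prod_(j in setT | j != i) A t j ^ c j != 0.
      by apply/prodf_neq0 => j _; rewrite expfz_neq0.
    by field; apply/andP.
  apply: laurentM => //; apply: laurentM; last by apply: subring_prod.
  apply: laurentM; first by move/upperP: Uf.
  by apply: laurent_const; apply: laurent_scalar LuV.
have LpV : laurent R setT (A t') p^-1.
  have [m cE] : exists m : nat, c i = - (m.+1 : int).
    by exists (`|c i|%N.-1); move: ci; lia.
  have -> : p^-1 = p ^ c i * p ^+ m.
    by rewrite cE -exprnN exprS invfM mulfVK // expf_neq0.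
  apply: laurentM => //; apply: subringX => //; apply: (laurent_sub subR).
  exact: (laurent_mono (subsetT _) (fun _ _ => erefl) (binomial_laurent sg i (Sskew t'))).
have [/laurent_scalar[a aE] /laurent_scalar[b bE]] :=
  binomial_unit (sgP t) subR (Sskew t') (SI t') LpV.
apply: (P_noninvertible (t := t') (k := i)); exists a, b; split; last exact: aE.
apply: (free_iota_inj (Sfree t)); rewrite rmorphM rmorph1 -aE -bE.
exact: mulfV.
Qed.

Lemma proportional_cluster_eq t t' i k v :
  laurent R set0 (A t) v -> laurent R set0 (A t) v^-1 -> v != 0 ->
  A t' i = v * A t k -> A t' i = A t k.
Proof.
move=> Lv LvV v0 E.
have single (s : tree_vertex n) l w : w * A s l =
    w * \prod_(j in setT) A s j ^ (if j == l then 1 else 0).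
  congr (_ * _); rewrite (bigD1 (P := mem setT) l) ?inE //= eqxx expr1z.
  by rewrite big1 ?mulr1 // => j /andP[_ /negPf->].
(* The element [v] is integral by the expansion of [A t' i] at [t], its inverse by the expansion of
   [A t k] at [t']. *)
have Iv : laurent (coef_range sg) set0 (A t) v.
  apply: (monomial_coefficient (SI t) subR Lv (D := setT) (c := fun j => if j == k then 1 else 0)).
  by rewrite -single -E; apply: cluster_laurent.
have IvV : laurent (coef_range sg) set0 (A t') v^-1.
  have L' : laurent R set0 (A t') v^-1 by apply: laurent_const; apply: laurent_scalar LvV.
  apply: (monomial_coefficient (SI t') subR L' (D := setT) (c := fun j => if j == i then 1 else 0)).
  by rewrite -single E mulKf //; apply: cluster_laurent.
have [g Ig vg] := integral_of_laurent Iv; have [h Ih vh] := integral_of_laurent IvV.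
have gh : g * h = 1.
  by apply: (free_iota_inj (Sfree t)); rewrite rmorphM rmorph1 -vg -vh mulfV.
have [p gp] := integral_unit char0 gh Ig Ih.
have vE : v = A t' i / A t k by rewrite E mulfK.
have : subtraction_free iota (A t) v 1%g.
  rewrite vE; have := subtraction_freeM (cluster_subtraction_free t t' i)
    (subtraction_freeV char0 (Sfree t) (cluster_subtraction_free t t k)).
  by rewrite monoid.invg1 monoid.mulg1.
rewrite vg => /(subtraction_free_unit char0 (Sfree t) gp) g1.
by rewrite E vg g1 rmorph1 mul1r.
Qed.

Lemma cluster_divides_monomial t0 t b k :
  U (cluster_monomial (S t) b / A t0 k) -> exists i, (0 < b i)%N /\ A t i = A t0 k.
Proof.
set L := cluster_monomial _ _ => UM; set M := L / A t0 k in UM; set a := A t0 k in M UM *.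
have a0 : a != 0 := A0 t0 k.
have LE : L = \prod_(i in setT) A t i ^ (b i : int) by apply: eq_bigl => i; rewrite inE.
have L0 : L != 0 by rewrite LE; apply/prodf_neq0 => i _; rewrite expfz_neq0.
have M0 : M != 0 by rewrite mulf_neq0 ?invr_eq0.
have Ua : U a := cluster_upper t0 k.
have LLV : laurent R setT (A t) L^-1.
  rewrite LE -prodfV; apply: subring_prod => // i _; rewrite invr_expz.
  by apply: laurent_exprz; rewrite inE.
have La := (upperP a).1 Ua t; have LM := (upperP M).1 UM t.
have LaV : laurent R setT (A t) a^-1.
  by have -> : a^-1 = M * L^-1; [rewrite /M; field; rewrite ?L0 ?a0|apply: laurentM].
have LMV : laurent R setT (A t) M^-1.
  by have -> : M^-1 = a * L^-1; [rewrite /M; field; rewrite ?L0 ?a0|apply: laurentM].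
have [u [c [Lu LuV aE]]] := laurent_unit (SI t) La LaV a0.
have [u' [c' [Lu' Lu'V ME]]] := laurent_unit (SI t) LM LMV M0.
have u0 : u != 0 by apply: contraNneq a0 => u0; rewrite aE u0 mul0r.
have u'0 : u' != 0 by apply: contraNneq M0 => u'0; rewrite ME u'0 mul0r.
have c_ge0 := upper_exponent_ge0 Ua LuV u0 aE.
have c'_ge0 := upper_exponent_ge0 UM Lu'V u'0 ME.
have cb : (fun i => c i + c' i) =1 (fun i => b i : int).
  apply: (monomial_exponent_inj (SI t) (u := u * u') (v := 1)).
  - exact: laurentM.
  - exact: laurent1.
  - exact: mulf_neq0.
  - exact: oner_neq0.
  rewrite mul1r -LE; have -> : L = a * M by rewrite /M mulrC mulfVK.
  rewrite aE ME mulrACA -big_split /=; congr (_ * _); apply: eq_bigr => i _.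
  by rewrite expfzDr.
have [i ci] : exists i, 0 < c i.
  case: (boolP [exists i, 0 < c i]) => [/existsP//|/existsPn c0]; exfalso.
  apply: (@cluster_not_scalar t0 k); rewrite -/a aE big1 ?mulr1.
    exact: laurent_scalar Lu.
  move=> i _; have -> : c i = 0; last by rewrite expr0z.
  by apply/eqP; rewrite eq_le c_ge0 leNgt c0.
exists i; split; first by have := cb i; have := c'_ge0 i; move: ci => /=; lia.
(* This is [a / A t i]: lowering the positive exponent [c i] by one keeps all exponents nonnegative,
   so [N] lies in [U] and the roles of the two seeds can be exchanged. *)
pose N := u * \prod_(j in setT) A t j ^ (c j - (if j == i then 1 else 0)).
have aN : a = A t i * N.
  rewrite aE /N mulrCA; congr (_ * _); rewrite (bigD1 (P := mem setT) i) ?inE //=.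
  rewrite [in RHS](bigD1 (P := mem setT) i) ?inE //= eqxx mulrA -{2}[A t i]expr1z -expfzDr //.
  rewrite addrC subrK; congr (_ * _); apply: eq_bigr => j /andP[_ /negPf ji].
  by rewrite ji subr0.
have UN : U N.
  apply: (subringM upper_subring); first exact: scalar_upper Lu.
  apply: (subring_prod upper_subring) => j _.
  have : 0 <= c j - (if j == i then 1 else 0).
    by have := c_ge0 j; case: eqP => [->|_] ?; rewrite ?subr0 // subr_ge0.
  by case: (_ - _) => // m _; apply: (subringX upper_subring); apply: cluster_upper.
have N0 : N != 0 by apply: contraNneq a0 => N0; rewrite aN N0 mulr0.
have La0V : laurent R setT (A t0) a^-1 by apply: laurent_varV; rewrite inE.
have LAi := (upperP _).1 (cluster_upper t i) t0; have LN := (upperP _).1 UN t0.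
have LAiV : laurent R setT (A t0) (A t i)^-1.
  by have -> : (A t i)^-1 = N * a^-1; [rewrite aN; field; rewrite N0 A0|apply: laurentM].
have LNV : laurent R setT (A t0) N^-1.
  by have -> : N^-1 = A t i * a^-1; [rewrite aN; field; rewrite N0 A0|apply: laurentM].
have [v [d [Lv LvV AiE]]] := laurent_unit (SI t0) LAi LAiV (A0 t i).
have [v' [d' [Lv' Lv'V NE]]] := laurent_unit (SI t0) LN LNV N0.
have v0 : v != 0 by apply: contraNneq (A0 t i) => v0; rewrite AiE v0 mul0r.
have v'0 : v' != 0 by apply: contraNneq N0 => v'0; rewrite NE v'0 mul0r.
have d_ge0 := upper_exponent_ge0 (cluster_upper t i) LvV v0 AiE.
have d'_ge0 := upper_exponent_ge0 UN Lv'V v'0 NE.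
have single : a = \prod_(j in setT) A t0 j ^ (if j == k then 1 else 0).
  rewrite (bigD1 (P := mem setT) k) ?inE //= eqxx expr1z.
  by rewrite big1 ?mulr1 // => j /andP[_ /negPf->].
(* The nonnegative exponents of [A t i] and [N] add up to those of the single variable [A t0 k]; as
   [A t i] is not a scalar, it takes the whole exponent. *)
have dd : (fun j => d j + d' j) =1 (fun j => if j == k then 1 else 0).
  apply: (monomial_exponent_inj (SI t0) (u := v * v') (v := 1)).
  - exact: laurentM.
  - exact: laurent1.
  - exact: mulf_neq0.
  - exact: oner_neq0.
  rewrite mul1r -single aN AiE NE mulrACA -big_split /=; congr (_ * _).
  by apply: eq_bigr => j _; rewrite expfzDr.
have [l dl] : exists l, 0 < d l.
  case: (boolP [exists i, 0 < d i]) => [/existsP//|/existsPn d0]; exfalso.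
  apply: (@cluster_not_scalar t i); rewrite AiE big1 ?mulr1.
    exact: laurent_scalar Lv.
  move=> j _; have -> : d j = 0; last by rewrite expr0z.
  by apply/eqP; rewrite eq_le d_ge0 leNgt d0.
have dE j : d j = if j == k then 1 else 0.
  have lk : l = k.
    by apply/eqP; have := dd l; have := d'_ge0 l; case: eqP => //= _; move: dl; clear; lia.
  have := dd j; have := d_ge0 j; have := d'_ge0 j; rewrite lk in dl; move: dl.
  by case: eqP => [->|_]; clear; lia.
apply: (proportional_cluster_eq Lv LvV v0); rewrite AiE; congr (_ * _).
by rewrite -/a single; apply: eq_bigr => j _; rewrite dE.
Qed.

End UpperClusterAlgebra.

Theorem theorem5p4 (K : idomainType) (K_factorial : factorial_domain K)
    (K_char0 : [pchar K] =i pred0) (P : semifieldType) (n : nat) (F : fieldType)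
    (iota : {rmorphism groupring K P -> F})
    (F_rational : rational_function_field iota n)
    (S : tree_vertex n -> seed n P F) (S_pattern : is_seed_pattern iota S)
    (P_noninvertible : forall t k,
       ~ invertible_in_groupring iota (exchange_binomial iota (S t) k))
    (t0 : tree_vertex n) :
  let U := upper_cluster_algebra iota S in
  let A t := cluster (S t) in
  [/\ forall (t : tree_vertex n) (b : 'I_n -> nat) (k : 'I_n),
        let L := cluster_monomial (S t) b in
        (forall i, (0 < b i)%N -> A t i <> A t0 k) ->
        ~ U (L / A t0 k) /\ valuation_pairing U (A t0 k) L = Some 0%N,
      forall (t : tree_vertex n) (b : 'I_n -> nat),
        let L := cluster_monomial (S t) b in
        (forall i, (0 < b i)%N -> A t i \notin codom (A t0)) ->
        forall k : 'I_n,
          ~ U (L / A t0 k) /\ valuation_pairing U (A t0 k) L = Some 0%N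
    & forall (t : tree_vertex n) (b : 'I_n -> nat),
        let I := [pred i : 'I_n | A t i \in codom (A t0)] in
        local_factorization U (S t0) (cluster_monomial (S t) b)
          (\prod_(i < n | i \in I) A t i ^+ b i)
          (\prod_(j < n | j \notin I) A t j ^+ b j)].
Proof.
move=> U A.
have Us : subring_pred U := upper_subring S_pattern.
have UA t i : U (A t i) := cluster_upper K_char0 S_pattern t i.
have UL t b : U (cluster_monomial (S t) b).
  by apply: (subring_prod Us) => i _; apply: (subringX Us); apply: UA.
have part_i t b k : (forall i, (0 < b i)%N -> A t i <> A t0 k) ->
    ~ U (cluster_monomial (S t) b / A t0 k)
    /\ valuation_pairing U (A t0 k) (cluster_monomial (S t) b) = Some 0%N.
  move=> Nb; have NU : ~ U (cluster_monomial (S t) b / A t0 k).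
    move/(cluster_divides_monomial K_char0 S_pattern P_noninvertible).
    by case=> i [/Nb].
  have [/(_ t0)[_ xF] _] := S_pattern.
  split=> //; apply: (@valuation_pairing0 F U _ _ (independent_neq0 k (free_independent xF))) => //.
  - by move=> f g Uf Ug; apply: (subringM Us).
  - exact: (subring1 Us).
  exact: UA.
have part_ii t b : (forall i, (0 < b i)%N -> A t i \notin codom (A t0)) -> forall k,
    ~ U (cluster_monomial (S t) b / A t0 k)
    /\ valuation_pairing U (A t0 k) (cluster_monomial (S t) b) = Some 0%N.
  move=> Nb k; apply: part_i => i /Nb NA E.
  by rewrite E codom_f in NA.
split=> // t b I.
have UX i : U (A t i ^+ b i) by apply: (subringX Us); apply: UA.
split.
- exact: (subring_prod Us).
- exact: (subring_prod Us).
- by rewrite /cluster_monomial (bigID (fun i => i \in I)).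
- apply: (big_ind (fun N => exists b, N = cluster_monomial (S t0) b)) => [|f g [c ->] [d ->]|i /codomP[k ->]].
  + by exists (fun=> 0%N); rewrite /cluster_monomial big1.
  + exists (fun i => (c i + d i)%N); rewrite /cluster_monomial -big_split.
    by apply: eq_bigr => i _; rewrite exprD.
  exists (fun l => if l == k then b i else 0%N).
  rewrite /cluster_monomial (bigD1 k) //= eqxx big1 ?mulr1 // => l /negPf ->.
  by rewrite expr0.
(* With the exponents over [I] set to 0, the second factor is a cluster monomial in non-initial
   variables. *)
move=> k; have -> : \prod_(j < n | j \notin I) A t j ^+ b j =
    cluster_monomial (S t) (fun j => if j \in I then 0%N else b j).
  by rewrite [LHS]big_mkcond; apply: eq_bigr => j _; case: (j \in I).
by apply: (part_ii _ _ _ k).2 => i; case: ifP => // /negbT.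
Qed.
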